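(* Let $R$ be of type $\mathrm E_8$ and $R'\subset R$ the standard Levi subsystem of type $\mathrm E_7$. Let $\rho$ be an entire function on $\mathbb C$ with $\rho(s)=\rho(1-s)$ all of whose zeroes lie in $0<\mathrm{Re}(s)<1$. Let $\mathfrak R>0$ be such that the segment $\sigma_L$ is contained in the ball $B_{\mathfrak R}(0)\subset V$ of radius $\mathfrak R$ centered at the origin. Then for all $\phi,\psi\in\mathcal P^{\mathfrak R}(V_{\mathbb C})$ the meromorphic function $$\partial_n\big(\Sigma_W(\phi)\,\Sigma'_{W'd}(\psi)\big)\big|_{L_0}$$ on $L_{0,\mathbb C}$ is holomorphic at all points of $d^{-1}(\sigma_L+iV^L)$, i.e. at all points $\lambda_x$ with $\mathrm{Re}(x)\in[-\tfrac{11}2,-4]$.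
   Context: $V$ is the real Euclidean space spanned by $R$, $W=W(\mathrm E_8)$, $W'=W(\mathrm E_7)$, $R_+$ the positive roots, $R'_+=R'\cap R_+$, $\hat\alpha\in V^*$ the coroot of $\alpha$. Vectors of $V_{\mathbb C}$ are written in the basis of fundamental weights (Bourbaki ordering), $\alpha_i$ are the simple roots, $s_i$ the simple reflections, $\alpha_h$ the highest root. $L_0$ is the line of points $\lambda_x=(1,0,0,1,0,0,1,x)$; $d=s_8s_7$; $L=d(L_0)$ is the line of points $d\lambda_x=(1,0,0,1,0,1,x,-1-x)$, with underlying linear space $V^L$; $\sigma_L\subset L$ is the segment of points $d\lambda_x$ with $x\in[-\frac{11}{2},-4]$ (from the center of $L$, at $x=-\frac{11}2$, to the point $(1,0,0,1,0,1,-4,3)$). $N$ is the plane of points $(1,0,0,1,0,1,x,y)$, $N^0=d^{-1}(N)\supset L_0$, and $n=\alpha_h-2(\alpha_7+\alpha_8)$ is a normal vector of $L_0$ in $N^0$; $\partial_n$ is the directional derivative along $n$. $c(\lambda)=\prod_{\alpha\in R_+}\frac{\hat\alpha(\lambda)+1}{\hat\alpha(\lambda)}$, $c'(\lambda)=\prod_{\alpha\in R'_+}\frac{\hat\alpha(\lambda)+1}{\hat\alpha(\lambda)}$, $r(\lambda)=\prod_{\alpha\in R_+}\rho(\hat\alpha(\lambda))$, $$\Sigma_W(\phi)(\lambda)=\sum_{w\in W}c(-w\lambda)\tfrac{r(\lambda)}{r(w\lambda)}\phi(-w\lambda),\qquad \Sigma'_{W'd}(\psi)(\lambda)=\sum_{u\in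 W'd}c'(u\lambda)\tfrac{r(u\lambda)}{r(\lambda)}\psi(u\lambda).$$ $\mathcal P^{\mathfrak R}(V_{\mathbb C})$ is the space of holomorphic functions $\phi$ on $\{\lambda\in V_{\mathbb C}:|\mathrm{Re}\,\lambda|<\mathfrak R\}$ such that for every $N\in\mathbb N$ there is $c_N>0$ with $|\phi(\lambda)|\le c_N(1+|\mathrm{Im}\,\lambda|)^{-N}$. *)

(* Defs.v *)
From HB Require Import structures.
From mathcomp Require Import all_boot all_order all_algebra.
From mathcomp Require Import complex.
From mathcomp Require Import all_classical all_reals all_analysis.

Set Implicit Arguments.
Unset Strict Implicit.
Unset Printing Implicit Defensive.

Import Order.TTheory GRing.Theory Num.Theory.
Import numFieldNormedType.Exports.

Local Open Scope classical_set_scope.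
Local Open Scope ring_scope.

(** Vectors are columns of coordinates in the basis of fundamental weights.
    Bourbaki's index [j] is the ordinal [j - 1 : 'I_8]; in particular [ord_max]
    is Bourbaki's 8 and [~: [set ord_max]] is the Dynkin diagram of E_7. *)

Definition E8_edge (i j : nat) : bool :=
  (i, j) \in [:: (1, 3); (3, 4); (2, 4); (4, 5); (5, 6); (6, 7); (7, 8)]%N.

Definition E8_cartan : 'M[int]_8 :=
  \matrix_(i, j) (if i == j then 2
                  else if E8_edge i.+1 j.+1 || E8_edge j.+1 i.+1 then -1
                  else 0).

(** The simple root with ordinal [j]: its [i]-th fundamental weight coordinate
    is its value under the [i]-th simple coroot. *)
Definition simple_root (j : 'I_8) : 'cV[int]_8 := col j E8_cartan.

(** The matrix of [v |-> v - v_j alpha_j]. *)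
Definition simple_refl (j : 'I_8) : 'M[int]_8 :=
  1%:M - simple_root j *m delta_mx 0 j.

Definition weyl (J : {set 'I_8}) : set 'M[int]_8 :=
  [set w | exists2 s : seq 'I_8,
             {subset s <= J} & w = \prod_(j <- s) simple_refl j].

Definition W_E8 : set 'M[int]_8 := weyl [set: 'I_8]%SET.
Definition W_E7 : set 'M[int]_8 := weyl (~: [set ord_max])%SET.

Definition E8_roots : set 'cV[int]_8 :=
  [set a | exists w j, W_E8 w /\ a = w *m simple_root j].

Definition E8_pos_roots : set 'cV[int]_8 :=
  [set a | E8_roots a /\
           exists k : 'I_8 -> nat, a = \sum_j simple_root j *+ k j].

(** The standard Levi subsystem R', as the set of roots in the span of the first
    seven simple roots. *)
Definition E7_roots : set 'cV[int]_8 :=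
  [set a | E8_roots a /\
           exists k : 'I_8 -> int,
             k ord_max = 0 /\ a = \sum_j simple_root j *~ k j].

Definition highest_root : 'cV[int]_8 :=
  \sum_j simple_root j *+ nth 0%N [:: 2; 3; 4; 6; 5; 4; 3; 2]%N j.

Definition d_mx : 'M[int]_8 := simple_refl (inord 7) *m simple_refl (inord 6).

Definition normal_vec : 'cV[int]_8 :=
  highest_root - (simple_root (inord 6) + simple_root (inord 7)) *+ 2.

Section Euclidean.
Variable K : numFieldType.
Implicit Types u v : 'cV[K]_8.

Definition of_int_mx m n (A : 'M[int]_(m, n)) : 'M[K]_(m, n) :=
  map_mx intr A.

Definition act (w : 'M[int]_8) v : 'cV[K]_8 := of_int_mx w *m v.

(** The W-invariant bilinear form for which roots have square length 2. Its Gram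
    matrix in the basis of fundamental weights is the inverse of the Cartan
    matrix, because the fundamental weights are dual to the simple roots. *)
Definition bform u v : K := (u^T *m invmx (of_int_mx E8_cartan) *m v) 0 0.

Definition coroot (a : 'cV[int]_8) v : K :=
  2 * bform (of_int_mx a) v / bform (of_int_mx a) (of_int_mx a).

Definition cfun (P : set 'cV[int]_8) v : K :=
  \big[*%R/1]_(a \in P) ((coroot a v + 1) / coroot a v).

Definition lam (x : K) : 'cV[K]_8 :=
  \col_i nth 0 [:: 1; 0; 0; 1; 0; 0; 1; x] i.

End Euclidean.

(** The complex numbers, as an abstract [numFieldType] so that they (and
    matrices over them) receive the normed topology of MathComp-Analysis. *)
Definition cplx (R : realType) : numFieldType := R[i].

Section Complexified.
Variable R : realType.
Local Notation C := (cplx R).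
Local Notation VC := ('cV[cplx R]_8).

(** The Euclidean norm (the library norm on matrices is the sup norm). *)
Definition enorm (v : 'cV[R]_8) : R := Num.sqrt (bform v v).

Definition Re_vec (z : VC) : 'cV[R]_8 := map_mx (@complex.Re R) z.
Definition Im_vec (z : VC) : 'cV[R]_8 := map_mx (@complex.Im R) z.

Definition tube (rad : R) : set VC := [set z | enorm (Re_vec z) < rad].

(** Only the values of [phi] on the tube matter. *)
Definition paley_wiener (rad : R) (phi : VC -> C) : Prop :=
  (forall z, tube rad z -> differentiable phi z) /\
  (forall N : nat, exists2 cN : R, 0 < cN &
     forall z, tube rad z ->
       `|phi z| <= (cN * (1 + enorm (Im_vec z)) ^- N)%:C%C).

Definition rfun (rho : C -> C) (z : VC) : C :=
  \big[*%R/1]_(a \in E8_pos_roots) rho (coroot a z).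

Definition Sigma_W (rho : C -> C) (phi : VC -> C) (z : VC) : C :=
  \sum_(w \in W_E8)
    cfun E8_pos_roots (- act w z) * (rfun rho z / rfun rho (act w z))
    * phi (- act w z).

Definition Sigma_W'd (rho : C -> C) (psi : VC -> C) (z : VC) : C :=
  \sum_(u \in [set w *m d_mx | w in W_E7])
    cfun (E7_roots `&` E8_pos_roots) (act u z)
    * (rfun rho (act u z) / rfun rho z) * psi (act u z).

(** The points of the tube at which no denominator in [Sigma_W] or [Sigma_W'd]
    vanishes; off this dense open subset these total functions take junk values
    and do not represent the meromorphic functions they stand for. *)
Definition regular_locus (rho : C -> C) (rad : R) : set VC :=
  [set z | tube rad z /\
           forall a, E8_roots a -> coroot a z != 0 /\ rho (coroot a z) != 0].

(** [G] is holomorphic near [p] and agrees there with the meromorphic function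
    given by [F] on the dense open set [D]. *)
Definition holo_ext (D : set VC) (F G : VC -> C) (p : VC) : Prop :=
  \forall z \near p, differentiable G z /\ (D z -> G z = F z).

(** The derivative along [n] of the meromorphic function given by [F] on [D],
    restricted to L_0 and read in the coordinate [x], as a single-valued relation
    [x |-> v]: it is defined at [x] when the meromorphic function is holomorphic
    (after removal of singularities) at [lam x]. *)
Definition normal_deriv (D : set VC) (F : VC -> C) (n : VC) (x v : C) : Prop :=
  exists2 G : VC -> C, holo_ext D F G (lam x) & 'D_n G (lam x) = v.

(** For a partially defined function of one variable, given by its graph: it is
    defined on a punctured neighbourhood of [x0], where it is the restriction of a
    function with at most a pole, resp. of a holomorphic function, at [x0]. *)
Definition meromorphic_at (f : C -> C -> Prop) (x0 : C) : Prop :=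
  exists (k : nat) (g : C -> C),
    (\forall x \near x0, differentiable g x) /\
    (\forall x \near x0^', f x (g x / (x - x0) ^+ k)).

Definition holomorphic_at (f : C -> C -> Prop) (x0 : C) : Prop :=
  exists g : C -> C,
    (\forall x \near x0, differentiable g x) /\
    (\forall x \near x0^', f x (g x)).

(** Its end points are the center of L and (1,0,0,1,0,1,-4,3). *)
Definition sigma_L : set 'cV[R]_8 :=
  [set act d_mx (lam x) | x in [set x : R | - (11 / 2) <= x <= - 4]].

End Complexified.

(* Main.v *)
From HB Require Import structures.
Require Import Defs.
From mathcomp Require Import all_boot all_order all_algebra.
From mathcomp Require Import complex zify ring lra.
From mathcomp Require Import all_classical all_reals all_analysis.
Import Order.TTheory GRing.Theory Num.Theory.
Import numFieldNormedType.Exports.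
Local Open Scope classical_set_scope.
Local Open Scope ring_scope.
Set Implicit Arguments.
Unset Strict Implicit.
Unset Printing Implicit Defensive.

(** Why the theorem holds.

    Put the terms of the two sums over common denominators. Let
    [rho_all z] be the product of [rho] over all roots, a W-invariant function.
    Then Sigma_W(phi) is r A / rho_all, where A is the quotient of an alternating
    sum over W by the product of the positive roots; an alternating sum vanishes
    on the mirrors, so A is holomorphic on the tube ([calA_ex]). In the same way
    Sigma'_{W'd}(psi) is (B o d) / r with B holomorphic ([calB_ex]). The factors r
    cancel, and the product of the two sums is A (B o d) / rho_all, a quotient of
    holomorphic functions ([F_ext]). On L_0 the denominator is an entire function
    of x that does not vanish at x = 0, where all roots have integral values; so
    the normal derivative has at most poles ([meromorphic_normal]).

    Now let -11/2 <= Re x <= -4. A root with coefficients k takes on L_0 the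
    value [val0 k] + k_8 x, and the zeros of [rho] lie in an open strip of width
    one. Hence rho_all can vanish only if Re x lies in the interval (-K, 1 - K)
    with K = 5 or K = 6, and then only through three kinds of roots
    ([zero_level]): the roots - kappa with kappa in level K - 1 (k_8 = 1 and
    val0 = K - 1), the roots of level K, and, when K = 6, the highest root. Let q_A
    be the product of [rho] over the first kind, q_B over the two others, so
    that rho_all = q_A q_B U with U different from 0 near the point. It is enough
    to show that q_A divides A, and q_B divides B o d, to first order along L_0:

      A = q_A k0  and  (DA) q_A - A (Dq_A) = k1 q_A^2   on L_0,

    with k0 and k1 holomorphic and D the derivative along n, and the same for B o d;
    the quotient rule then expresses the normal derivative without q_A and q_B
    in denominators ([assemble_rule], [holo_assemble]).

    Divisibility of A. Deform L_0 in directions v and u, and pair each kappa of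
    level K - 1 with a root kappa' of level K such that kappa' - kappa is a root
    and keeps the value 1 on the deformation. Consider the term of the
    alternating sum at w, and the positive system defined by w. If
    kappa' - kappa is positive in it, the term has the factor
    (kappa' - kappa) - 1 = 0. Otherwise kappa or - kappa' is positive, and the
    term has the factor rho (- kappa) or
    rho (kappa') = rho (1 + kappa) = rho (- kappa). As the pairing is injective,
    every term is divisible by q_A on the deformation ([divides_termA]), hence so
    is the alternating sum. The direction u is chosen such that q_A has no common
    component with the roots by which the sum is divided; therefore q_A divides
    A itself on the deformation ([coprime_division], [local_good]). This gives
    first-order divisibility along v. It also holds along the simple roots
    alpha_j, j = 2, 3, 5, 6 in Bourbaki's numbering: L_0 lies in their mirrors,
    and A and q_A are invariant under s_j, so that their derivatives along
    alpha_j vanish on L_0 ([div_deriv_mirror]). Suitable v together with these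
    alpha_j combine to n ([normal_split5], [normal_split6]).

    Divisibility of B o d. The sum is over W' d only, so that the roots mapped by d
    to positive roots outside R' are positive in all the positive systems that
    occur ([out_pos]). Only the other four roots of level K need a partner, and
    v = n itself can be used ([divides_termB]).

    All of this needs holomorphic functions on a normed space: the directional
    derivatives of such a function, and its quotient by an affine function on
    whose zero set it vanishes, are again holomorphic ([hol_diff], [quo_diff]).
    Both are proved from Cauchy's formula on a square, which is derived from
    Goursat's theorem; functions of several variables are treated by the
    formula on complex lines, with the point as parameter ([param_int]). *)

(** * Moduli of complex vectors *)

Section Modulus.
Variable R : realType.
Local Notation C := (cplx R).

(** Real-valued, so that real inequalities, and the tactics for them, apply. *)
Definition nrm (V : normedModType C) (v : V) : R := complex.Re `|v|.

Section General.
Variable V : normedModType C.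
Implicit Types u v : V.

Lemma normE v : `|v| = ((nrm v)%:C)%C :> C.
Proof.
have /ger0_Im h : 0 <= (`|v| : R[i]) by exact: normr_ge0.
by rewrite /nrm; case: (`|v| : R[i]) h => a b /= ->.
Qed.

Lemma nrm_ge0 v : 0 <= nrm v.
Proof. by have := normr_ge0 v; rewrite normE ler0c. Qed.

Lemma nrm0 : nrm (0 : V) = 0.
Proof. by rewrite /nrm normr0. Qed.

Lemma nrm_eq0 v : nrm v = 0 -> v = 0.
Proof. by move=> h; apply/normr0_eq0; rewrite normE h. Qed.

Lemma nrm_gt0 v : v != 0 -> 0 < nrm v.
Proof.
move=> v0; rewrite lt_neqAle nrm_ge0 andbT eq_sym.
by apply: contra v0 => /eqP/nrm_eq0->.
Qed.

Lemma nrmN v : nrm (- v) = nrm v.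
Proof. by rewrite /nrm normrN. Qed.

Lemma nrmD u v : nrm (u + v) <= nrm u + nrm v.
Proof. by have := ler_normD u v; rewrite !normE -rmorphD lecR. Qed.

Lemma nrmB u v : nrm (u - v) <= nrm u + nrm v.
Proof. by rewrite -(nrmN v) nrmD. Qed.

Lemma nrm_sub u v : nrm (u - v) = nrm (v - u).
Proof. by rewrite -nrmN opprB. Qed.

Lemma nrmZ (a : C) v : nrm (a *: v) = nrm a * nrm v.
Proof.
apply: (@complexI R).
by rewrite rmorphM /= -!normE normrZ.
Qed.

End General.

Lemma nrmM (a b : C) : nrm (a * b) = nrm a * nrm b.
Proof. exact: nrmZ. Qed.

Lemma nrm1 : nrm (1 : C) = 1.
Proof. by rewrite /nrm normr1. Qed.

Lemma nrmV (a : C) : nrm a^-1 = (nrm a)^-1.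
Proof.
apply: (@complexI R).
by rewrite fmorphV /= -!normE normfV.
Qed.

Lemma nrmX (a : C) n : nrm (a ^+ n) = nrm a ^+ n.
Proof. by elim: n => [|n IH]; rewrite ?expr0 ?nrm1// !exprS nrmM IH. Qed.

Lemma nrm_real (x : R) : nrm ((x%:C)%C : C) = `|x|.
Proof. by rewrite /nrm normc_def /= expr0n addr0 sqrtr_sqr. Qed.

Lemma Re_le_nrm (a : C) : `|complex.Re a| <= nrm a.
Proof. by rewrite -lecR -(normE (a : C)); exact: normc_ge_Re. Qed.

Lemma Im_le_nrm (a : C) : `|complex.Im a| <= nrm a.
Proof.
rewrite /nrm normc_def /= -sqrtr_sqr ler_wsqrtr // lerDr sqr_ge0//.
Qed.

Lemma nrm_le_ReIm (a : C) : nrm a <= `|complex.Re a| + `|complex.Im a|.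
Proof.
rewrite {1}[a]complexE.
apply: (le_trans (nrmD _ _)); rewrite nrmM !nrm_real.
suff -> : nrm (('i%C) : C) = 1 by rewrite mul1r.
by rewrite /nrm normc_def /= expr0n expr1n add0r sqrtr1.
Qed.

Lemma cRe_gt0 (e : C) : 0 < e -> 0 < complex.Re e /\ e = ((complex.Re e)%:C)%C.
Proof.
move=> e0; have ee : e = ((complex.Re e)%:C)%C.
  by have := ger0_Im (ltW e0); case: (e : R[i]) => a b /= ->.
by split=> //; move: e0; rewrite {1}ee ltcR.
Qed.

Section Nbhs.
Variable V : normedModType C.

Lemma nearP (p : V) (P : set V) :
  (\forall z \near p, P z) <->
  exists2 r : R, 0 < r & forall z, nrm (z - p) < r -> P z.
Proof.
split.
  move=> /nbhs_normP[e /= /cRe_gt0[e0 ee] H]; exists (complex.Re e) => //.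
  move=> z hz; apply: H; rewrite /ball_ /= distrC normE ee ltcR//.
move=> [r r0 H]; apply/nbhs_normP; exists ((r%:C)%C : C) => /=.
  by rewrite ltcR.
by move=> z; rewrite /ball_ /= distrC normE ltcR => /H.
Qed.

Lemma dnearP (p : V) (P : set V) :
  (\forall z \near p^', P z) <->
  exists2 r : R, 0 < r & forall z, nrm (z - p) < r -> z != p -> P z.
Proof.
rewrite /dnbhs /within /=; split.
  by move=> /nearP[r r0 H]; exists r => // z hz zp; apply: H.
by move=> [r r0 H]; apply/nearP; exists r => // z hz /H; apply.
Qed.

End Nbhs.

End Modulus.

(** * Complex differentiability *)

Section EpsDiff.
Variable R : realType.
Local Notation C := (cplx R).
Variable V : normedModType C.

(** Complex differentiability with real bounds; with its converse [eps_diff], the form in which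
    derivatives are computed below. *)
Lemma diff_eps (f : V -> C) p : differentiable f p ->
  forall e : R, 0 < e -> exists2 d : R, 0 < d &
    forall u, nrm u < d -> nrm (f (p + u) - f p - 'd f p u) <= e * nrm u.
Proof.
move=> /diff_locally /eqaddoP H e e0.
have /H : 0 < ((e%:C)%C : C) by rewrite ltcR.
move=> /nearP[d d0 Hd]; exists d => // u ud.
have := Hd u; rewrite subr0 => /(_ ud).
rewrite !normE -rmorphM lecR.
have -> : (f \o shift p - (cst (f p) + 'd f p)) u = f (p + u) - f p - 'd f p u.
  by rewrite -[LHS]/(f (u + p) - (f p + 'd f p u)) (addrC u p); ring.
by [].
Qed.

Lemma diff_bnd (f : V -> C) p : differentiable f p ->
  exists2 K : R, 0 < K & forall u, nrm ('d f p u) <= K * nrm u.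
Proof.
move=> /diff_continuous /linear_lipschitz[k /cRe_gt0[k0 ek] H].
exists (complex.Re k) => // u; have := H u.
by rewrite {1}ek !normE -rmorphM lecR.
Qed.

(** The bound on [L] makes it continuous, as the uniqueness of the differential requires. *)
Lemma eps_diff (f L : V -> C) p (K : R) :
  (forall (a : C) u v, L (a *: u + v) = a * L u + L v) ->
  (forall u, nrm (L u) <= K * nrm u) ->
  (forall e : R, 0 < e -> exists2 d : R, 0 < d &
    forall u, nrm u < d -> nrm (f (p + u) - f p - L u) <= e * nrm u) ->
  differentiable f p /\ forall u, 'd f p u = L u.
Proof.
move=> Ll Lb Hf.
pose L' : {linear V -> C} := HB.pack L (GRing.isLinear.Build _ _ _ _ L Ll).
have cL : continuous L'.
  have K0 : (0 : R) < `|K| + 1 by rewrite ltr_pwDr.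
  apply: bounded_linear_continuous; apply/ex_bound.
  exists (((`|K| + 1)%:C)%C : C); apply/nearP; exists 1 => // u.
  rewrite subr0 => u1 /=; rewrite normE lecR; apply: le_trans (Lb u) _.
  have := nrm_ge0 u; have := ler_norm K; nra.
have e1 : f \o shift p = cst (f p) + L' +o_ 0 id.
  apply/eqaddoP => e /cRe_gt0[e0 ee].
  have [d d0 Hd] := Hf _ e0; apply/nearP; exists d => // u; rewrite subr0 => ud.
  rewrite ee !normE -rmorphM lecR.
  have -> : (f \o shift p - (cst (f p) + L')) u = f (p + u) - f p - L u.
    by rewrite -[LHS]/(f (u + p) - (f p + L u)) (addrC u p); ring.
  exact: Hd.
have e2 := diff_unique cL e1.
split; last by move=> u; rewrite e2.
by apply/diff_locallyP; rewrite e2.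
Qed.

Lemma dfD (f g : V -> C) z : differentiable f z -> differentiable g z ->
  differentiable (fun z => f z + g z) z.
Proof. exact: differentiableD. Qed.

Lemma dfB (f g : V -> C) z : differentiable f z -> differentiable g z ->
  differentiable (fun z => f z - g z) z.
Proof. exact: differentiableB. Qed.

Lemma dfN (f : V -> C) z : differentiable f z -> differentiable (fun z => - f z) z.
Proof. exact: differentiableN. Qed.

Lemma dfM (f g : V -> C) z : differentiable f z -> differentiable g z ->
  differentiable (fun z => f z * g z) z.
Proof. exact: differentiableM. Qed.

Lemma dfV (f : V -> C) z : differentiable f z -> f z != 0 ->
  differentiable (fun z => (f z)^-1) z.
Proof. by move=> df f0; apply: (differentiableV df f0). Qed.

Lemma dfc (c : C) (z : V) : differentiable (fun=> c) z.
Proof. exact: differentiable_cst. Qed.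

Lemma df_div (f g : V -> C) z : differentiable f z -> differentiable g z ->
  g z != 0 -> differentiable (fun z => f z / g z) z.
Proof. by move=> df dg g0; apply: dfM => //; exact: dfV. Qed.

Lemma df_sum (T : Type) (s : seq T) (P : pred T) (F : T -> V -> C) z :
  (forall i, differentiable (F i) z) ->
  differentiable (fun z => \sum_(i <- s | P i) F i z) z.
Proof.
move=> H; elim: s => [|i s IH].
  by under eq_fun do rewrite big_nil; exact: dfc.
under eq_fun do rewrite big_cons.
by case: (P i); [exact: dfD|exact: IH].
Qed.

Lemma df_prod (T : Type) (s : seq T) (P : pred T) (F : T -> V -> C) z :
  (forall i, differentiable (F i) z) ->
  differentiable (fun z => \prod_(i <- s | P i) F i z) z.
Proof.
move=> H; elim: s => [|i s IH].
  by under eq_fun do rewrite big_nil; exact: dfc.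
under eq_fun do rewrite big_cons.
by case: (P i); [exact: dfM|exact: IH].
Qed.

Lemma near_eq_diff (f g : V -> C) p : (\forall z \near p, f z = g z) ->
  differentiable g p -> differentiable f p /\ forall u, 'd f p u = 'd g p u.
Proof.
move=> /nearP[r r0 H] dg; have [K K0 HK] := diff_bnd dg.
apply: (@eps_diff f ('d g p) p K _ HK _); first by move=> a u v; rewrite linearP.
move=> e e0; have [d d0 Hd] := diff_eps dg e0.
exists (Num.min d r); first by rewrite lt_min d0.
move=> u; rewrite lt_min => /andP[ud ur].
rewrite !H ?subrr ?nrm0 //; first exact: Hd.
by rewrite addrC addrA addNr add0r.
Qed.

Lemma near_df (f g : V -> C) p : (\forall z \near p, f z = g z) ->
  differentiable g p -> differentiable f p.
Proof. by move=> fg /(near_eq_diff fg)[]. Qed.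

Lemma diff_near (f : V -> C) p (eps : R) : differentiable f p -> 0 < eps ->
  exists2 d : R, 0 < d & forall z, nrm (z - p) < d -> nrm (f z - f p) < eps.
Proof.
move=> /differentiable_continuous/cvgr_dist_lt cf e0.
have /cf /nearP[d d0 Hd] : 0 < ((eps%:C)%C : C) by rewrite ltcR.
by exists d => // z /Hd; rewrite -normrN opprB normE ltcR.
Qed.

End EpsDiff.

Lemma df_id (R : realType) (z : cplx R) : differentiable (fun z : cplx R => z) z.
Proof. exact: ex_diff. Qed.

Lemma df_comp (R : realType) (U V : normedModType (cplx R)) (f : U -> V)
    (g : V -> cplx R) z :
  differentiable f z -> differentiable g (f z) -> differentiable (fun z => g (f z)) z.
Proof. exact: differentiable_comp. Qed.

(** * Integrals of complex functions over real segments *)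

Section Cint.
Variable R : realType.
Local Notation C := (cplx R).
Local Notation mu := (@lebesgue_measure R).

Definition ccont (h : R -> C) (x : R) : Prop :=
  forall e : R, 0 < e -> exists2 d : R, 0 < d &
    forall y, `|y - x| < d -> nrm (h y - h x) < e.

Lemma ccontP (h : R -> C) (x : R) : h @ x --> h x <-> ccont h x.
Proof.
split=> [/cvgr_dist_lt ch e e0|H].
  have /ch /nbhs_ballP[d d0 Hd] : 0 < ((e%:C)%C : C) by rewrite ltcR.
  exists d => // y yd; have := Hd y; rewrite /ball /= distrC => /(_ yd).
  by rewrite normE ltcR nrm_sub.
apply/cvgrPdist_lt => e /cRe_gt0[e0 ee]; have [d d0 Hd] := H _ e0.
apply/nbhs_ballP; exists d => // y; rewrite /ball /= distrC => /Hd.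
by rewrite ee normE ltcR nrm_sub.
Qed.

Definition ccont_on (a b : R) (h : R -> C) := forall x, a <= x <= b -> ccont h x.

Definition cint (a b : R) (h : R -> C) : C :=
  (\int[mu]_(t in `[a, b]) complex.Re (h t) +i*
   \int[mu]_(t in `[a, b]) complex.Im (h t))%C.

Lemma ReD (x y : C) : complex.Re (x + y) = complex.Re x + complex.Re y.
Proof. by case: x y => ? ? []. Qed.
Lemma ImD (x y : C) : complex.Im (x + y) = complex.Im x + complex.Im y.
Proof. by case: x y => ? ? []. Qed.
Lemma ReN (x : C) : complex.Re (- x) = - complex.Re x.
Proof. by case: x. Qed.
Lemma ImN (x : C) : complex.Im (- x) = - complex.Im x.
Proof. by case: x. Qed.
Lemma ReM (x y : C) : complex.Re (x * y) =
  complex.Re x * complex.Re y - complex.Im x * complex.Im y.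
Proof. by case: x y => ? ? []. Qed.
Lemma ImM (x y : C) : complex.Im (x * y) =
  complex.Re x * complex.Im y + complex.Im x * complex.Re y.
Proof. by case: x y => ? ? []. Qed.
Lemma cplx_eq (x y : C) : complex.Re x = complex.Re y ->
  complex.Im x = complex.Im y -> x = y.
Proof. by case: x y => ? ? [? ?] /= -> ->. Qed.

Lemma integrable_part (p : C -> R) a b h :
  (forall x y, `|p x - p y| <= nrm (x - y)) ->
  ccont_on a b h -> mu.-integrable `[a, b] (EFin \o (p \o h)).
Proof.
move=> Hp Hh; apply: continuous_compact_integrable; first exact: segment_compact.
apply: continuous_in_subspaceT => x; rewrite inE /= in_itv /= => /Hh Hx.
apply/cvgrPdist_lt => e /Hx[d d0 Hd]; apply/nbhs_ballP; exists d => // y.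
rewrite /ball /= distrC => /Hd H; rewrite distrC; exact: le_lt_trans (Hp _ _) H.
Qed.

Lemma Re_lip (x y : C) : `|complex.Re x - complex.Re y| <= nrm (x - y).
Proof. by rewrite -ReN -ReD Re_le_nrm. Qed.
Lemma Im_lip (x y : C) : `|complex.Im x - complex.Im y| <= nrm (x - y).
Proof. by rewrite -ImN -ImD Im_le_nrm. Qed.

Lemma ccontD a b f g : ccont_on a b f -> ccont_on a b g ->
  ccont_on a b (fun t => f t + g t).
Proof.
move=> cf cg x xab; have /ccontP hf := cf x xab; have /ccontP hg := cg x xab.
exact: (proj1 (ccontP _ x) (cvgD hf hg)).
Qed.

Lemma ccontZ a b c f : ccont_on a b f -> ccont_on a b (fun t => c * f t).
Proof.
move=> cf x xab; have /ccontP hf := cf x xab.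
exact: (proj1 (ccontP _ x) (cvgM (cvg_cst c) hf)).
Qed.

Lemma ccontN a b f : ccont_on a b f -> ccont_on a b (fun t => - f t).
Proof.
by move=> cf x xab; have /ccontP hf := cf x xab; exact: (proj1 (ccontP _ x) (cvgN hf)).
Qed.

Lemma ccontB a b f g : ccont_on a b f -> ccont_on a b g ->
  ccont_on a b (fun t => f t - g t).
Proof. by move=> cf cg; apply: ccontD => //; apply: ccontN. Qed.

Lemma cintD a b f g : ccont_on a b f -> ccont_on a b g ->
  cint a b (fun t => f t + g t) = cint a b f + cint a b g.
Proof.
move=> cf cg; apply: cplx_eq; rewrite ?ReD ?ImD /=.
  under eq_Rintegral do rewrite ReD.
  by apply: RintegralD => //; apply: integrable_part => // x y; exact: Re_lip.
under eq_Rintegral do rewrite ImD.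
by apply: RintegralD => //; apply: integrable_part => // x y; exact: Im_lip.
Qed.

Lemma cintZ a b c f : ccont_on a b f ->
  cint a b (fun t => c * f t) = c * cint a b f.
Proof.
move=> cf.
have iR : mu.-integrable `[a, b] (EFin \o (@complex.Re R \o f)).
  by apply: integrable_part => // x y; exact: Re_lip.
have iI : mu.-integrable `[a, b] (EFin \o (@complex.Im R \o f)).
  by apply: integrable_part => // x y; exact: Im_lip.
have iZ (p : R) g : mu.-integrable `[a, b] (EFin \o g) ->
    mu.-integrable `[a, b] (EFin \o (fun t => p * g t)).
  by move=> ig; apply: (integrableZl _ p ig).
apply: cplx_eq; rewrite ?ReM ?ImM /=.
  under eq_Rintegral do rewrite ReM.
  by rewrite RintegralB// ?RintegralZl//; apply: iZ.
under eq_Rintegral do rewrite ImM.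
by rewrite RintegralD// ?RintegralZl//; apply: iZ.
Qed.

Lemma cintN a b f : ccont_on a b f -> cint a b (fun t => - f t) = - cint a b f.
Proof.
move=> cf; rewrite -mulN1r -cintZ//; congr cint.
by apply/funext => t; rewrite mulN1r.
Qed.

Lemma cintB a b f g : ccont_on a b f -> ccont_on a b g ->
  cint a b (fun t => f t - g t) = cint a b f - cint a b g.
Proof. by move=> cf cg; rewrite cintD ?cintN//; apply: ccontN. Qed.

Lemma eq_cint a b f g : (forall t, a <= t <= b -> f t = g t) ->
  cint a b f = cint a b g.
Proof.
move=> fg; rewrite /cint; congr Complex; apply: eq_Rintegral => t;
  by rewrite inE /= in_itv /= => /fg ->.
Qed.

Lemma Rint_cst a b (r : R) : a <= b -> \int[mu]_(t in `[a, b]) r = r * (b - a).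
Proof.
move=> ab; rewrite Rintegral_cst; last exact: measurable_itv.
congr (_ * _); have := @lebesgue_measure_itv R `[a, b]; rewrite /= lte_fin => ->.
case: ltgtP ab => [ab _|ba|-> _]; last by rewrite subrr.
  by [].
by [].
Qed.

Lemma cint_cst a b c : a <= b -> cint a b (fun=> c) = ((b - a)%:C)%C * c.
Proof.
move=> ab.
by apply: cplx_eq; rewrite ?ReM ?ImM /= Rint_cst// mul0r ?subr0 ?addr0 mulrC.
Qed.

Lemma cint_split a m b f : a <= m -> m <= b -> ccont_on a b f ->
  cint a b f = cint a m f + cint m b f.
Proof.
move=> am mb cf.
have key (p : C -> R) : (forall x y, `|p x - p y| <= nrm (x - y)) ->
    \int[mu]_(t in `[a, b]) p (f t) =
    \int[mu]_(t in `[a, m]) p (f t) + \int[mu]_(t in `[m, b]) p (f t).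
  move=> Hp.
  have ii : mu.-integrable `[a, b] (EFin \o (p \o f)) by exact: integrable_part.
  have := @Rintegral_itvB R (p \o f) (BLeft a) (BRight b) m ii.
  rewrite !bnd_simp => /(_ am mb) /= /eqP; rewrite subr_eq => /eqP ->.
  rewrite addrC; congr (_ + _); apply: Rintegral_itv_obnd_cbnd.
  by apply: (integrableS _ _ _ ii) => //; apply: subset_itv; rewrite bnd_simp.
apply: cplx_eq; rewrite ?ReD ?ImD /=; apply: key; [exact: Re_lip|exact: Im_lip].
Qed.

(** The factor 2 comes from estimating real and imaginary parts separately. *)
Lemma cint_bound a b f M : a <= b -> ccont_on a b f ->
  (forall t, a <= t <= b -> nrm (f t) <= M) ->
  nrm (cint a b f) <= 2 * M * (b - a).
Proof.
move=> ab cf fM.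
have key (p : C -> R) : (forall x y, `|p x - p y| <= nrm (x - y)) ->
    (forall x, `|p x| <= nrm x) ->
    `|\int[mu]_(t in `[a, b]) p (f t)| <= M * (b - a).
  move=> Hp Hp'.
  have ii : mu.-integrable `[a, b] (EFin \o (p \o f)) by exact: integrable_part.
  have h (r : R) := Rint_cst r ab.
  have ic (r : R) : mu.-integrable `[a, b] (EFin \o (fun=> r : R)).
    apply: continuous_compact_integrable; first exact: segment_compact.
    by apply: continuous_subspaceT => x; exact: cvg_cst.
  have b1 t : `[a, b]%classic t -> p (f t) <= M.
    rewrite /= in_itv /= => /fM; have := Hp' (f t); have := ler_norm (p (f t)); lra.
  have b2 t : `[a, b]%classic t -> - M <= p (f t).
    rewrite /= in_itv /= => /fM; have := Hp' (f t).
    have := ler_norm (- p (f t)); rewrite normrN; lra.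
  have := @le_Rintegral _ _ _ mu _ (p \o f) (fun=> M) _ ii (ic _) b1; rewrite h.
  have := @le_Rintegral _ _ _ mu _ (fun=> - M) (p \o f) _ (ic _) ii b2; rewrite h.
  move=> /(_ (measurable_itv _)) h1 /(_ (measurable_itv _)) h2.
  by rewrite ler_norml -mulNr h1 h2.
apply: le_trans (nrm_le_ReIm _) _ => /=.
have := key _ Re_lip (@Re_le_nrm R); have := key _ Im_lip (@Im_le_nrm R); lra.
Qed.

Lemma cint_Re_ge a b f m : a <= b -> ccont_on a b f ->
  (forall t, a <= t <= b -> m <= complex.Re (f t)) ->
  m * (b - a) <= complex.Re (cint a b f).
Proof.
move=> ab cf fm; rewrite /= -Rint_cst//.
have ic : mu.-integrable `[a, b] (EFin \o (fun=> m : R)).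
  apply: continuous_compact_integrable; first exact: segment_compact.
  by apply: continuous_subspaceT => x; exact: cvg_cst.
have ii : mu.-integrable `[a, b] (EFin \o (@complex.Re R \o f)).
  exact: (integrable_part Re_lip cf).
apply: (@le_Rintegral _ _ _ mu _ (fun=> m) (@complex.Re R \o f) _ ic ii).
  exact: measurable_itv.
by move=> t; rewrite /= in_itv /=; exact: fm.
Qed.

End Cint.

(** * Integrals over the boundary of a rectangle *)

Section Goursat.
Variable R : realType.
Local Notation C := (cplx R).
Local Notation "x +i* y" := ((Complex x y) : C).
Local Notation I := (('i%C) : C).

Definition contC (f : C -> C) (z : C) := forall e : R, 0 < e ->
  exists2 d : R, 0 < d & forall w, nrm (w - z) < d -> nrm (f w - f z) < e.

Definition on_rect (x1 x2 y1 y2 : R) (P : C -> Prop) :=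
  forall x y, x1 <= x <= x2 -> y1 <= y <= y2 -> P (x +i* y).

(** The counterclockwise integral of f dz over the boundary of [x1, x2] x [y1, y2]. *)
Definition oint (x1 x2 y1 y2 : R) (f : C -> C) : C :=
  cint x1 x2 (fun x => f (x +i* y1) - f (x +i* y2)) +
  I * cint y1 y2 (fun y => f (x2 +i* y) - f (x1 +i* y)).

Lemma nrmI : nrm I = 1.
Proof. by rewrite /nrm normc_def /= expr0n expr1n add0r sqrtr1. Qed.

Lemma contCP (f : C -> C) (z : C) : f @ z --> f z <-> contC f z.
Proof.
split=> [/cvgr_dist_lt cf e e0|H].
  have /cf /nearP[d d0 Hd] : 0 < ((e%:C)%C : C) by rewrite ltcR.
  by exists d => // w /Hd; rewrite normE ltcR nrm_sub.
apply/(@cvgrPdist_lt _ _ _ (nbhs z)) => e /cRe_gt0[e0 ee]; have [d d0 Hd] := H _ e0.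
by apply: (proj2 (@nearP R C z _)); exists d => // w /Hd; rewrite ee normE ltcR nrm_sub.
Qed.

Lemma diff_contC f z : differentiable f z -> contC f z.
Proof. by move=> df; exact: (proj1 (contCP f z) (differentiable_continuous df)). Qed.

Lemma ccont_h f x y : contC f (x +i* y) -> ccont (fun t => f (t +i* y)) x.
Proof.
move=> cf e /cf[d d0 Hd]; exists d => // t td; apply: Hd.
have -> : t +i* y - (x +i* y) = ((t - x)%:C)%C by apply: cplx_eq; rewrite ?ReD ?ImD ?ReN ?ImN /= ?subrr.
by rewrite nrm_real.
Qed.

Lemma ccont_v f x y : contC f (x +i* y) -> ccont (fun t => f (x +i* t)) y.
Proof.
move=> cf e /cf[d d0 Hd]; exists d => // t td; apply: Hd.
have -> : x +i* t - (x +i* y) = I * ((t - y)%:C)%C.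
  by apply: cplx_eq; rewrite ?ReM ?ImM ?ReD ?ImD ?ReN ?ImN /= ?subrr; ring.
by rewrite nrmM nrmI mul1r nrm_real.
Qed.

Lemma on_rect_sub x1 x2 y1 y2 x1' x2' y1' y2' P :
  x1 <= x1' -> x2' <= x2 -> y1 <= y1' -> y2' <= y2 ->
  on_rect x1 x2 y1 y2 P -> on_rect x1' x2' y1' y2' P.
Proof.
move=> a b c d H x y /andP[? ?] /andP[? ?]; apply: H; apply/andP; split; lra.
Qed.

Lemma contCN f z : contC f z -> contC (fun w => - f w) z.
Proof. by move=> /contCP cf; exact: (proj1 (contCP _ z) (cvgN cf)). Qed.

Lemma contCD f g z : contC f z -> contC g z -> contC (fun w => f w + g w) z.
Proof. by move=> /contCP cf /contCP cg; exact: (proj1 (contCP _ z) (cvgD cf cg)). Qed.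

Lemma contCB f g z : contC f z -> contC g z -> contC (fun w => f w - g w) z.
Proof. by move=> /contCP cf /contCP cg; exact: (proj1 (contCP _ z) (cvgB cf cg)). Qed.

Lemma contCM f g z : contC f z -> contC g z -> contC (fun w => f w * g w) z.
Proof. by move=> /contCP cf /contCP cg; exact: (proj1 (contCP _ z) (cvgM cf cg)). Qed.

Lemma contCZ c f z : contC f z -> contC (fun w => c * f w) z.
Proof. by apply: contCM; exact: diff_contC (dfc c z). Qed.

(** The four closed sides: estimates and equalities of integrands are only needed there. *)
Definition on_bdry (x1 x2 y1 y2 : R) (P : C -> Prop) :=
  (forall x, x1 <= x <= x2 -> P (x +i* y1) /\ P (x +i* y2)) /\
  (forall y, y1 <= y <= y2 -> P (x1 +i* y) /\ P (x2 +i* y)).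

Lemma rect_bdry x1 x2 y1 y2 P : x1 <= x2 -> y1 <= y2 ->
  on_rect x1 x2 y1 y2 P -> on_bdry x1 x2 y1 y2 P.
Proof.
move=> x12 y12 H; split=> t tt; split; apply: H => //; by rewrite ?lexx ?x12 ?y12.
Qed.

Lemma bdry_ccont x1 x2 y1 y2 f : on_bdry x1 x2 y1 y2 (contC f) ->
  [/\ ccont_on x1 x2 (fun x => f (x +i* y1)), ccont_on x1 x2 (fun x => f (x +i* y2)),
      ccont_on y1 y2 (fun y => f (x1 +i* y)) & ccont_on y1 y2 (fun y => f (x2 +i* y))].
Proof.
move=> [fh fv]; split=> t.
- by move=> /fh[? _]; exact: ccont_h.
- by move=> /fh[_ ?]; exact: ccont_h.
- by move=> /fv[? _]; exact: ccont_v.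
- by move=> /fv[_ ?]; exact: ccont_v.
Qed.

Lemma ccont_on_cat a m b (h : R -> C) : ccont_on a m h -> ccont_on m b h ->
  ccont_on a b h.
Proof.
move=> h1 h2 x /andP[ax xb]; case: (leP x m) => xm.
  by apply: h1; rewrite ax xm.
by apply: h2; rewrite ltW.
Qed.

Lemma oint_splitx x1 m x2 y1 y2 f : x1 <= m -> m <= x2 ->
  on_bdry x1 m y1 y2 (contC f) -> on_bdry m x2 y1 y2 (contC f) ->
  oint x1 x2 y1 y2 f = oint x1 m y1 y2 f + oint m x2 y1 y2 f.
Proof.
move=> m1 m2 /bdry_ccont[a1 a2 a3 a4] /bdry_ccont[b1 b2 b3 b4].
rewrite /oint (@cint_split R x1 m x2)//; last first.
  by apply: ccontB; [exact: ccont_on_cat a1 b1|exact: ccont_on_cat a2 b2].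
by rewrite !(cintB (a := y1))//; ring.
Qed.

Lemma oint_splity x1 x2 y1 m y2 f : y1 <= m -> m <= y2 ->
  on_bdry x1 x2 y1 m (contC f) -> on_bdry x1 x2 m y2 (contC f) ->
  oint x1 x2 y1 y2 f = oint x1 x2 y1 m f + oint x1 x2 m y2 f.
Proof.
move=> m1 m2 /bdry_ccont[a1 a2 a3 a4] /bdry_ccont[b1 b2 b3 b4].
rewrite /oint (@cint_split R y1 m y2)//; last first.
  by apply: ccontB; [exact: ccont_on_cat a4 b4|exact: ccont_on_cat a3 b3].
by rewrite !(cintB (a := x1))//; ring.
Qed.

Lemma ointD x1 x2 y1 y2 f g : x1 <= x2 -> y1 <= y2 ->
  on_bdry x1 x2 y1 y2 (contC f) -> on_bdry x1 x2 y1 y2 (contC g) ->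
  oint x1 x2 y1 y2 (fun z => f z + g z) =
  oint x1 x2 y1 y2 f + oint x1 x2 y1 y2 g.
Proof.
move=> x12 y12 /bdry_ccont[f1 f2 f3 f4] /bdry_ccont[g1 g2 g3 g4].
rewrite /oint !cintB//; [|exact: ccontD..].
by rewrite !cintD//; ring.
Qed.

Lemma ointZ x1 x2 y1 y2 c f : x1 <= x2 -> y1 <= y2 ->
  on_bdry x1 x2 y1 y2 (contC f) ->
  oint x1 x2 y1 y2 (fun z => c * f z) = c * oint x1 x2 y1 y2 f.
Proof.
move=> x12 y12 /bdry_ccont[f1 f2 f3 f4].
rewrite /oint !cintB//; [|exact: ccontZ..].
by rewrite !cintZ//; ring.
Qed.

Lemma on_bdry_imp x1 x2 y1 y2 (P Q : C -> Prop) :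
  (forall z, P z -> Q z) -> on_bdry x1 x2 y1 y2 P -> on_bdry x1 x2 y1 y2 Q.
Proof.
by move=> PQ [h v]; split=> t; [move=> /h[]|move=> /v[]] => ? ?; split; exact: PQ.
Qed.

Lemma ointB x1 x2 y1 y2 f g : x1 <= x2 -> y1 <= y2 ->
  on_bdry x1 x2 y1 y2 (contC f) -> on_bdry x1 x2 y1 y2 (contC g) ->
  oint x1 x2 y1 y2 (fun z => f z - g z) =
  oint x1 x2 y1 y2 f - oint x1 x2 y1 y2 g.
Proof.
move=> x12 y12 cf cg; rewrite ointD//; last first.
  by apply: on_bdry_imp cg => z; exact: contCN.
congr (_ + _); rewrite -mulN1r -ointZ//; congr oint.
by apply/funext => z; rewrite mulN1r.
Qed.

Lemma oint_bound x1 x2 y1 y2 f M : x1 <= x2 -> y1 <= y2 ->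
  on_bdry x1 x2 y1 y2 (contC f) ->
  on_bdry x1 x2 y1 y2 (fun z => nrm (f z) <= M) ->
  nrm (oint x1 x2 y1 y2 f) <= 4 * M * ((x2 - x1) + (y2 - y1)).
Proof.
move=> x12 y12 /bdry_ccont[f1 f2 f3 f4] [Mh Mv].
apply: le_trans (nrmD _ _) _; rewrite nrmM nrmI mul1r.
have h1 : nrm (cint x1 x2 (fun x => f (x +i* y1) - f (x +i* y2))) <=
    2 * (2 * M) * (x2 - x1).
  apply: cint_bound => //; first exact: ccontB.
  by move=> t /Mh[? ?]; apply: le_trans (nrmB _ _) _; lra.
have h2 : nrm (cint y1 y2 (fun y => f (x2 +i* y) - f (x1 +i* y))) <=
    2 * (2 * M) * (y2 - y1).
  apply: cint_bound => //; first exact: ccontB.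
  by move=> t /Mv[? ?]; apply: le_trans (nrmB _ _) _; lra.
lra.
Qed.

Lemma eq_oint x1 x2 y1 y2 f g : x1 <= x2 -> y1 <= y2 ->
  on_bdry x1 x2 y1 y2 (fun z => f z = g z) ->
  oint x1 x2 y1 y2 f = oint x1 x2 y1 y2 g.
Proof.
move=> x12 y12 [h v]; rewrite /oint; congr (_ + _ * _); apply: eq_cint => t.
  by move=> /h[-> ->].
by move=> /v[-> ->].
Qed.

(** The start of the proof of Goursat's theorem: affine functions have primitives. *)
Lemma oint_affine x1 x2 y1 y2 c d : x1 <= x2 -> y1 <= y2 ->
  oint x1 x2 y1 y2 (fun z => c + d * z) = 0.
Proof.
move=> x12 y12; rewrite /oint.
rewrite (@eq_cint R x1 x2 _ (fun=> d * (0 +i* (y1 - y2)))); last first.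
  move=> t _; have -> : 0 +i* (y1 - y2) = (t +i* y1) - (t +i* y2).
    by apply: cplx_eq; rewrite ?ReD ?ImD ?ReN ?ImN /= ?subrr.
  by ring.
rewrite (@eq_cint R y1 y2 _ (fun=> d * ((x2 - x1) +i* 0))); last first.
  move=> t _; have -> : (x2 - x1) +i* 0 = (x2 +i* t) - (x1 +i* t).
    by apply: cplx_eq; rewrite ?ReD ?ImD ?ReN ?ImN /= ?subrr.
  by ring.
rewrite !cint_cst//.
have -> : ((x2 - x1)%:C)%C * (d * (0 +i* (y1 - y2))) +
  I * (((y2 - y1)%:C)%C * (d * ((x2 - x1) +i* 0))) = d *
  (((x2 - x1)%:C)%C * (0 +i* (y1 - y2)) + I * (((y2 - y1)%:C)%C * ((x2 - x1) +i* 0))) by ring.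
rewrite [X in d * X](_ : _ = 0) ?mulr0//.
by apply: cplx_eq; rewrite ?ReD ?ImD ?ReM ?ImM ?ReM ?ImM /=; ring.
Qed.

End Goursat.

(** * Goursat's theorem *)

Section GoursatThm.
Variable R : realType.
Local Notation C := (cplx R).
Local Notation "x +i* y" := ((Complex x y) : C).

Lemma half_pow (w : R) n : w / 2 ^+ n = w / 2 ^+ n.+1 + w / 2 ^+ n.+1.
Proof.
have h : (2 : R) ^+ n != 0 by rewrite expf_neq0// pnatr_eq0.
by rewrite exprS; field.
Qed.

Lemma pow2_gt0 n : 0 < (2 : R) ^+ n.
Proof. by rewrite exprn_gt0. Qed.

Lemma inv_pow2_lt (w e : R) : 0 < e -> exists n, w / 2 ^+ n < e.
Proof.
move=> e0; pose n := (Num.Def.trunc (`|w| / e)).+1; exists n.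
have h1 : `|w| / e < n%:R by exact: truncnS_gt.
have h2 : (n%:R : R) < 2 ^+ n by rewrite -natrX ltr_nat ltn_expl.
rewrite ltr_pdivrMr ?pow2_gt0//.
move: h1; rewrite ltr_pdivrMr// => h1.
apply: le_lt_trans (ler_norm w) _; nra.
Qed.

Section Nested.
Variables (a : nat -> R) (w A B : R).
Hypotheses (w0 : 0 <= w).
Hypothesis aB : forall n, A <= a n /\ a n + w / 2 ^+ n <= B.
Hypothesis aS : forall n, a n <= a n.+1 /\ a n.+1 + w / 2 ^+ n.+1 <= a n + w / 2 ^+ n.

(** Lower ends increase and upper ends decrease, so the supremum of the lower ends lies in all
    the intervals. *)
Lemma nested : exists s, forall n, a n <= s <= a n + w / 2 ^+ n.
Proof.
have wn n : 0 <= w / 2 ^+ n by rewrite divr_ge0// ltW// pow2_gt0.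
have mono m n : (m <= n)%N -> a m <= a n /\ a n + w / 2 ^+ n <= a m + w / 2 ^+ m.
  elim: n => [|n IH]; first by rewrite leqn0 => /eqP->.
  rewrite leq_eqVlt => /predU1P[->//|]; rewrite ltnS => /IH [h1 h2].
  have [h3 h4] := aS n; lra.
have up m n : a m <= a n + w / 2 ^+ n.
  case: (leqP m n) => [/mono[h _]|/ltnW/mono[_ h]]; first by have := wn n; lra.
  by have := wn m; lra.
exists (sup (range a)) => n; apply/andP; split.
  apply: ub_le_sup; last by exists n.
  by exists B => _ [m _ <-]; have := aB m; have := wn m; lra.
by apply: ge_sup; [exists (a n), n|move=> _ [m _ <-]; exact: up].
Qed.

End Nested.

(** Bisect in both directions and keep a quarter on whose boundary the integral is at least a
    quarter of the previous one. The quarters shrink to a point, at which the difference of the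
    function and its affine approximation is too small for that. *)
Lemma goursat (x1 x2 y1 y2 : R) (f : C -> C) : x1 <= x2 -> y1 <= y2 ->
  on_rect x1 x2 y1 y2 (fun z => differentiable f z) ->
  oint x1 x2 y1 y2 f = 0.
Proof.
move=> x12 y12 df.
have cf : on_rect x1 x2 y1 y2 (contC f).
  by move=> x y xx yy; apply: diff_contC; exact: df.
apply: nrm_eq0; apply/eqP; rewrite eq_le nrm_ge0 andbT leNgt; apply/negP.
set E := nrm _ => E0.
pose w := x2 - x1; pose h := y2 - y1.
have w0 : 0 <= w by rewrite /w; lra.
have h0 : 0 <= h by rewrite /h; lra.
pose P n (p : R * R) := [/\ x1 <= p.1, p.1 + w / 2 ^+ n <= x2, y1 <= p.2,
  p.2 + h / 2 ^+ n <= y2 &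
  E / 4 ^+ n <= nrm (oint p.1 (p.1 + w / 2 ^+ n) p.2 (p.2 + h / 2 ^+ n) f)].
have wn n : 0 <= w / 2 ^+ n by rewrite divr_ge0// ltW// pow2_gt0.
have hn n : 0 <= h / 2 ^+ n by rewrite divr_ge0// ltW// pow2_gt0.
have step n p : exists q, P n p -> [/\ P n.+1 q,
    p.1 <= q.1, q.1 + w / 2 ^+ n.+1 <= p.1 + w / 2 ^+ n,
    p.2 <= q.2 & q.2 + h / 2 ^+ n.+1 <= p.2 + h / 2 ^+ n].
  have [|nP] := pselect (P n p); last by exists p.
  move=> [p1 p2 p3 p4]; rewrite (half_pow w) (half_pow h).
  set w' := w / 2 ^+ n.+1; set h' := h / 2 ^+ n.+1.
  have ww : 0 <= w' by exact: wn.
  have hh : 0 <= h' by exact: hn.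
  rewrite (half_pow w) -/w' in p2; rewrite (half_pow h) -/h' in p4.
  have sub a b c e : x1 <= a -> a <= b -> b <= x2 -> y1 <= c -> c <= e -> e <= y2 ->
      on_bdry a b c e (contC f).
    by move=> *; apply: rect_bdry => //; exact: on_rect_sub cf.
  rewrite (@oint_splitx R p.1 (p.1 + w')); try apply: sub; try by clear -p1 p2 p3 p4 ww hh; lra.
  rewrite (@oint_splity R p.1 (p.1 + w') p.2 (p.2 + h'));
    try apply: sub; try by clear -p1 p2 p3 p4 ww hh; lra.
  rewrite (@oint_splity R (p.1 + w') (p.1 + (w' + w')) p.2 (p.2 + h'));
    try apply: sub; try by clear -p1 p2 p3 p4 ww hh; lra.
  have aw : p.1 + w' + w' = p.1 + (w' + w') by ring.
  have ah : p.2 + h' + h' = p.2 + (h' + h') by ring.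
  set o1 := oint _ _ _ _ _; set o2 := oint _ _ _ _ _.
  set o3 := oint _ _ _ _ _; set o4 := oint _ _ _ _ _ => HE.
  have HE' : E / 4 ^+ n <= nrm o1 + nrm o2 + nrm o3 + nrm o4.
    apply: (le_trans HE); apply: (le_trans (nrmD _ _)).
    by rewrite -[leRHS]addrA; apply: lerD; exact: nrmD.
  have E4 : E / 4 ^+ n = 4 * (E / 4 ^+ n.+1).
    have nz : (4 : R) ^+ n != 0 by rewrite expf_neq0// pnatr_eq0.
    by rewrite exprS; field.
  rewrite E4 in HE'.
  have fin q : p.1 <= q.1 -> q.1 + w' <= p.1 + (w' + w') ->
      p.2 <= q.2 -> q.2 + h' <= p.2 + (h' + h') ->
      E / 4 ^+ n.+1 <= nrm (oint q.1 (q.1 + w') q.2 (q.2 + h') f) ->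
      exists q, P n p -> [/\ P n.+1 q,
        p.1 <= q.1, q.1 + w' <= p.1 + (w' + w'),
        p.2 <= q.2 & q.2 + h' <= p.2 + (h' + h')].
    move=> q1 q2 q3 q4 q5; exists q => _; split => //; split => //.
    - exact: le_trans q1.
    - exact: le_trans p2.
    - exact: le_trans q3.
    - exact: le_trans p4.
  have [b1|b1] := leP (E / 4 ^+ n.+1) (nrm o1).
    by apply: (fin p) => //; clear -ww hh; lra.
  have [b2|b2] := leP (E / 4 ^+ n.+1) (nrm o2).
    apply: (fin (p.1, p.2 + h')); rewrite /= ?ah ?aw//; clear -ww hh; lra.
  have [b3|b3] := leP (E / 4 ^+ n.+1) (nrm o3).
    apply: (fin (p.1 + w', p.2)); rewrite /= ?ah ?aw//; clear -ww hh; lra.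
  have [b4|b4] := leP (E / 4 ^+ n.+1) (nrm o4).
    apply: (fin (p.1 + w', p.2 + h')); rewrite /= ?ah ?aw//; clear -ww hh; lra.
  move: HE' b1 b2 b3 b4; clear.
  move: (nrm o1) (nrm o2) (nrm o3) (nrm o4) (E / 4 ^+ n.+1); clear.
  by move=> c1 c2 c3 c4 c; lra.
have /choice[nx Hnx] : forall np : nat * (R * R), exists q, P np.1 np.2 ->
    [/\ P np.1.+1 q,
    np.2.1 <= q.1, q.1 + w / 2 ^+ np.1.+1 <= np.2.1 + w / 2 ^+ np.1,
    np.2.2 <= q.2 & q.2 + h / 2 ^+ np.1.+1 <= np.2.2 + h / 2 ^+ np.1].
  by move=> [n p]; exact: step.
pose s := fix s n := if n is m.+1 then nx (m, s m) else (x1, y1).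
have Ps n : P n (s n).
  elim: n => [|n /(Hnx (n, s n))[]//].
  split; rewrite /= ?expr0 ?divr1 ?lexx ?/w ?/h ?subrKC//.
have Pn n := Hnx (n, s n) (Ps n).
have [zx Hx] : exists zx, forall n, (s n).1 <= zx <= (s n).1 + w / 2 ^+ n.
  apply: (@nested _ _ x1 x2) => // n; first by have [] := Ps n.
  by have [] := Pn n.
have [zy Hy] : exists zy, forall n, (s n).2 <= zy <= (s n).2 + h / 2 ^+ n.
  apply: (@nested _ _ y1 y2) => // n; first by have [] := Ps n.
  by have [] := Pn n.
pose z := zx +i* zy.
have dz : differentiable f z.
  apply: df.
    by have := Hx 0%N; have [] := Ps 0%N; rewrite /= expr0 divr1 => *; lra.
  by have := Hy 0%N; have [] := Ps 0%N; rewrite /= expr0 divr1 => *; lra.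
pose S := (w + h) ^+ 2 + 1.
have S0 : 0 < S by rewrite /S; have := sqr_ge0 (w + h); lra.
(* With this constant the final estimate is less than half of E / 4 ^ n. *)
have e0 : 0 < E / (8 * S) by rewrite divr_gt0// mulr_gt0.
have [d d0 Hd] := diff_eps dz e0.
have [n Hn] := inv_pow2_lt (w + h) d0.
have [p1 p2 p3 p4 HE] := Ps n.
pose L := 'd f z 1; pose g u := f u - (f z - L * z + L * u).
have Lg u : f u = f z + 'd f z (u - z) + g u.
  have -> : 'd f z (u - z) = L * (u - z).
    have -> : u - z = (u - z) *: (1 : C) by rewrite /GRing.scale /= mulr1.
    by rewrite linearZ /= /L mulrC /GRing.scale /= mulr1 mulrC.
  by rewrite /g; ring.
have xn : (s n).1 <= (s n).1 + w / 2 ^+ n by rewrite lerDl.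
have yn : (s n).2 <= (s n).2 + h / 2 ^+ n by rewrite lerDl.
have rn : on_rect (s n).1 ((s n).1 + w / 2 ^+ n) (s n).2 ((s n).2 + h / 2 ^+ n) (contC f).
  by apply: on_rect_sub cf.
have bn := rect_bdry xn yn rn.
have caff (u : C) : contC (fun u => f z - L * z + L * u) u.
  by apply: contCD; [|apply: contCZ]; apply: diff_contC; [exact: dfc|exact: df_id].
have e1 : oint (s n).1 ((s n).1 + w / 2 ^+ n) (s n).2 ((s n).2 + h / 2 ^+ n) f =
          oint (s n).1 ((s n).1 + w / 2 ^+ n) (s n).2 ((s n).2 + h / 2 ^+ n) g.
  rewrite /g ointB//.
  by rewrite oint_affine// subr0.
pose D := (w + h) / 2 ^+ n.
have DE : D = w / 2 ^+ n + h / 2 ^+ n by rewrite /D mulrDl.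
have gb : on_rect (s n).1 ((s n).1 + w / 2 ^+ n) (s n).2 ((s n).2 + h / 2 ^+ n)
    (fun u => nrm (g u) <= E / (8 * S) * D).
  move=> x y /andP[xa xb] /andP[ya yb].
  have nD : nrm ((x +i* y) - z) <= D.
    apply: le_trans (nrm_le_ReIm _) _.
    rewrite ReD ImD ReN ImN /= DE; apply: lerD.
      by have := Hx n; rewrite ler_norml; clear -xa xb => /andP[? ?]; apply/andP; split; lra.
    by have := Hy n; rewrite ler_norml; clear -ya yb => /andP[? ?]; apply/andP; split; lra.
  have := Hd _ (le_lt_trans nD Hn); rewrite subrKC.
  have -> : f (x +i* y) - f z - 'd f z ((x +i* y) - z) = g (x +i* y).
    by rewrite {1}Lg; ring.
  move=> /le_trans; apply; apply: ler_wpM2l => //; exact: ltW.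
have := oint_bound xn yn (f := g) (M := E / (8 * S) * D).
have bg : on_bdry (s n).1 ((s n).1 + w / 2 ^+ n) (s n).2 ((s n).2 + h / 2 ^+ n)
    (contC g).
  apply: rect_bdry => // x y xx yy; apply: contCB; last exact: caff.
  exact: rn.
rewrite -e1 => /(_ bg (rect_bdry xn yn gb)).
have -> : (s n).1 + w / 2 ^+ n - (s n).1 + ((s n).2 + h / 2 ^+ n - (s n).2) = D.
  by rewrite DE; ring.
move=> /(le_trans HE).
have -> : 4 * (E / (8 * S) * D) * D = E / 4 ^+ n * ((w + h) ^+ 2 / (2 * S)).
  have -> : (4 : R) ^+ n = 2 ^+ n * 2 ^+ n by rewrite -exprMn; congr (_ ^+ _); ring.
  have nz : (2 : R) ^+ n != 0 by rewrite expf_neq0// pnatr_eq0.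
  by rewrite /D; field; rewrite nz gt_eqF.
have E4 : 0 < E / 4 ^+ n by rewrite divr_gt0// exprn_gt0.
apply/negP; rewrite -ltNge -[ltRHS]mulr1 ltr_pM2l//.
rewrite ltr_pdivrMr ?mulr_gt0// /S; have := sqr_ge0 (w + h); lra.
Qed.

End GoursatThm.

(** * Shrinking the contour *)

Section Cauchy.
Variable R : realType.
Local Notation C := (cplx R).
Local Notation "x +i* y" := ((Complex x y) : C).
Local Notation I := (('i%C) : C).

(** The region between the two rectangles consists of four rectangles, to each of which Goursat's
    theorem applies. *)
Lemma oint_shrink x1 u1 u2 x2 y1 v1 v2 y2 (f : C -> C) :
  x1 <= u1 -> u1 <= u2 -> u2 <= x2 -> y1 <= v1 -> v1 <= v2 -> v2 <= y2 ->
  (forall x y, x1 <= x <= x2 -> y1 <= y <= y2 ->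
     [\/ x <= u1, u2 <= x, y <= v1 | v2 <= y] -> differentiable f (x +i* y)) ->
  oint x1 x2 y1 y2 f = oint u1 u2 v1 v2 f.
Proof.
move=> xu uu ux yv vv vy H.
have xu2 := le_trans xu uu; have uxx := le_trans uu ux; have xx := le_trans xu uxx.
have yv2 := le_trans yv vv; have vyy := le_trans vv vy; have yy := le_trans yv vyy.
have le2 (a b c d t : R) : a <= b -> c <= d -> b <= t <= c -> a <= t <= d.
  by move=> ab cd /andP[/(le_trans ab) -> /le_trans ->].
have dl : on_rect x1 u1 y1 y2 (fun z => differentiable f z).
  move=> x y hx hy; apply: H => //; first exact: le2 hx.
  by apply: Or41; case/andP: hx.
have dr : on_rect u2 x2 y1 y2 (fun z => differentiable f z).
  move=> x y hx hy; apply: H => //; first exact: le2 hx.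
  by apply: Or42; case/andP: hx.
have db : on_rect u1 u2 y1 v1 (fun z => differentiable f z).
  move=> x y hx hy; apply: H => //; [exact: le2 hx|exact: le2 hy|].
  by apply: Or43; case/andP: hy.
have dt : on_rect u1 u2 v2 y2 (fun z => differentiable f z).
  move=> x y hx hy; apply: H => //; [exact: le2 hx|exact: le2 hy|].
  by apply: Or44; case/andP: hy.
have dc (a b c d : R) : a <= b -> c <= d ->
    on_rect a b c d (fun z => differentiable f z) -> on_bdry a b c d (contC f).
  by move=> ab cd D; apply: rect_bdry => // x y hx hy; apply: diff_contC; exact: D.
have bd (a b c d : R) : x1 <= a -> a <= u1 -> u2 <= b -> b <= x2 ->
    y1 <= c -> c <= v1 -> v2 <= d -> d <= y2 -> on_bdry a b c d (contC f).
  move=> xa au ub bx yc cv vd dy.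
  have ax := le_trans (le_trans au uu) ux; have xb := le_trans (le_trans xu uu) ub.
  have cy := le_trans (le_trans cv vv) vy; have yd := le_trans (le_trans yv vv) vd.
  split=> t ht; split; apply: diff_contC; apply: H; rewrite ?xa ?yc ?xb ?yd//;
    try exact: (le2 _ _ _ _ _ _ _ ht); by [apply: Or41|apply: Or42|apply: Or43|apply: Or44].
rewrite (@oint_splitx R x1 u1)//; [|exact: dc|exact: bd].
rewrite (goursat _ _ dl)// add0r.
rewrite (@oint_splitx R u1 u2)//; [|exact: bd|exact: dc].
rewrite (goursat _ _ dr)// addr0.
rewrite (@oint_splity R u1 u2 y1 v1)//; [|exact: dc|exact: bd].
rewrite (goursat _ _ db)// add0r.
rewrite (@oint_splity R u1 u2 v1 v2)//; [|exact: bd|exact: dc].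
by rewrite (goursat _ _ dt)// addr0.
Qed.

End Cauchy.

(** * Squares around the origin *)

Section Square.
Variable R : realType.
Local Notation C := (cplx R).
Local Notation "x +i* y" := ((Complex x y) : C).
Local Notation I := (('i%C) : C).

Definition sq (s : R) (f : C -> C) : C := oint (- s) s (- s) s f.

(** A neighbourhood of the sides of the square: s <= |z| on the sides, and |z| <= 2 s. *)
Definition ring_at (s : R) (P : C -> Prop) :=
  forall z, s <= nrm z <= 2 * s -> P z.

Lemma ring_bdry s P : 0 < s -> ring_at s P -> on_bdry (- s) s (- s) s P.
Proof.
move=> s0 H.
have key x y : `|x| <= s -> `|y| <= s -> (`|x| = s \/ `|y| = s) -> P (x +i* y).
  move=> xs ys e; apply: H.
  have := Re_le_nrm (x +i* y); have := Im_le_nrm (x +i* y).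
  have := nrm_le_ReIm (x +i* y) => /= ? ? ?; case: e => ?; apply/andP; split; lra.
have ns : `|- s| = s by rewrite normrN gtr0_norm.
have ps : `|s| = s by rewrite gtr0_norm.
split=> t; rewrite -ler_norml => ts; split; apply: key; rewrite ?ns ?ps//;
  by [left|right].
Qed.

Section SqLin.
Variable s : R.
Hypothesis s0 : 0 < s.
Let ss : - s <= s. Proof. by rewrite -subr_ge0 opprK addr_ge0 ?ltW. Qed.

Lemma sqD f g : ring_at s (contC f) -> ring_at s (contC g) ->
  sq s (fun z => f z + g z) = sq s f + sq s g.
Proof. by move=> /(ring_bdry s0) cf /(ring_bdry s0) cg; exact: ointD. Qed.

Lemma sqB f g : ring_at s (contC f) -> ring_at s (contC g) ->
  sq s (fun z => f z - g z) = sq s f - sq s g.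
Proof. by move=> /(ring_bdry s0) cf /(ring_bdry s0) cg; exact: ointB. Qed.

Lemma sqZ c f : ring_at s (contC f) -> sq s (fun z => c * f z) = c * sq s f.
Proof. by move=> /(ring_bdry s0) cf; exact: ointZ. Qed.

Lemma eq_sq f g : ring_at s (fun z => f z = g z) -> sq s f = sq s g.
Proof. by move=> /(ring_bdry s0) cf; exact: eq_oint. Qed.

Lemma sq_bound f M : ring_at s (contC f) -> ring_at s (fun z => nrm (f z) <= M) ->
  nrm (sq s f) <= 16 * M * s.
Proof.
move=> /(ring_bdry s0) cf /(ring_bdry s0) fM.
apply: le_trans (oint_bound ss ss cf fM) _; clear; lra.
Qed.

End SqLin.

(** The function is differentiable between the two squares, so [oint_shrink] applies. *)
Lemma sq_grow s T f : 0 < s -> s <= T ->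
  (forall z, s <= nrm z -> differentiable f z) -> sq T f = sq s f.
Proof.
move=> s0 sT H; apply: oint_shrink; try (clear -s0 sT; lra).
move=> x y _ _ h; apply: H.
have := Re_le_nrm (x +i* y); have := Im_le_nrm (x +i* y) => /=.
have := ler_norm x; have := ler_norm (- x); have := ler_norm y.
have := ler_norm (- y); rewrite !normrN; case: h => ? ? ? ? ? ? ?; lra.
Qed.

Lemma diff_div (f : C -> C) a z : differentiable f z -> z != a ->
  differentiable (fun z => f z / (z - a)) z.
Proof.
move=> df za; apply: df_div; [exact: df| |by rewrite subr_eq0].
by apply: dfB; [exact: df_id|exact: dfc].
Qed.

(** The number 2 pi i, as an integral. *)
Definition Jc : C := sq 1 (fun z => 1 / (z - 0)).

Lemma ring_div s (f : C -> C) a : nrm a < s ->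
  ring_at s (fun z => differentiable f z) ->
  ring_at s (fun z => differentiable (fun z => f z / (z - a)) z).
Proof.
move=> as_ H z zs; apply: diff_div; first exact: H.
by apply: contraTneq zs => ->; rewrite leNgt as_.
Qed.

Lemma ring_diff_cont s (f : C -> C) :
  ring_at s (fun z => differentiable f z) -> ring_at s (contC f).
Proof. by move=> H z zs; apply: diff_contC; exact: H. Qed.

(** The difference of the integrals for two centers does not depend on the size T of the square,
    and is O(1/T). *)
Lemma J_any s a : nrm a < s -> sq s (fun z => 1 / (z - a)) = Jc.
Proof.
move=> as_; have s0 : 0 < s by exact: le_lt_trans (nrm_ge0 a) as_.
have far (b z : C) : nrm b < nrm z -> z != b by move=> h; apply: contraTneq h => ->; rewrite ltxx.
have -> : Jc = sq s (fun z => 1 / (z - 0)).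
  have D t : 0 < t -> forall z, t <= nrm z -> differentiable (fun z : C => 1 / (z - 0)) z.
    by move=> t0 z tz; apply: diff_div; [exact: dfc|apply: far; rewrite nrm0 (lt_le_trans t0)].
  case: (leP s 1) => s1.
    exact: (sq_grow s0 s1 (D s s0)).
  symmetry; exact: (sq_grow ltr01 (ltW s1) (D 1 ltr01)).
apply/eqP; rewrite -subr_eq0; apply/eqP/nrm_eq0.
set v := _ - _.
have bound T : s <= T -> nrm v * (T - nrm a) <= 16 * nrm a.
  move=> sT; have T0 : 0 < T by exact: lt_le_trans s0 sT.
  have aT : nrm a < T by exact: lt_le_trans as_ sT.
  have D (b : C) : nrm b < s -> forall z, s <= nrm z -> differentiable (fun z : C => 1 / (z - b)) z.
    by move=> bs z zs; apply: diff_div; [exact: dfc|apply: far; exact: lt_le_trans bs zs].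
  have n0s : nrm (0 : C) < s by rewrite nrm0.
  rewrite /v -(sq_grow s0 sT (D _ as_)) -(sq_grow s0 sT (D _ n0s)).
  have Dr (b : C) : nrm b < s -> ring_at T (fun z => differentiable (fun z : C => 1 / (z - b)) z).
    by move=> bs; apply: ring_div; [exact: lt_le_trans bs sT|move=> z _; exact: dfc].
  rewrite -sqB//; try exact: ring_diff_cont (Dr _ _).
  set g := fun z : C => _.
  have Dg : ring_at T (contC g).
    by move=> z zT; apply: contCB; exact: ring_diff_cont (Dr _ _) z zT.
  have gM : ring_at T (fun z => nrm (g z) <= nrm a / (T * (T - nrm a))).
    move=> z /andP[Tz _]; rewrite /g.
    have z0 : z != 0 by apply: far; rewrite nrm0 (lt_le_trans T0).
    have za : z - a != 0 by rewrite subr_eq0; apply: far; exact: lt_le_trans aT Tz.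
    have -> : 1 / (z - a) - 1 / (z - 0) = a / (z * (z - a)).
      by rewrite subr0; field; rewrite z0 za.
    rewrite nrmM nrmV nrmM; apply: ler_wpM2l; first exact: nrm_ge0.
    have h1 : T - nrm a <= nrm (z - a).
      have := nrmD (z - a) a; rewrite subrK; clear -Tz; lra.
    have Ta : 0 < T - nrm a by clear -aT; lra.
    rewrite lef_pV2; last 2 first.
    - by rewrite posrE mulr_gt0 //; [exact: nrm_gt0|exact: nrm_gt0].
    - by rewrite posrE mulr_gt0.
    by apply: ler_pM => //; exact: ltW.
  have := sq_bound T0 Dg gM.
  have Ta : 0 < T - nrm a by clear -aT; lra.
  rewrite -ler_pdivlMr// => /le_trans; apply.
  rewrite le_eqVlt; apply/orP; left; apply/eqP; field.
  by rewrite !gt_eqF.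
apply/eqP; rewrite eq_le nrm_ge0 andbT leNgt; apply/negP => v0.
(* A size T of the square that contradicts the bound. *)
have sT : s <= s + (16 * nrm a + 1) / nrm v.
  rewrite lerDl divr_ge0//; last exact: ltW.
  have := nrm_ge0 a; clear; lra.
have := bound _ sT.
have -> : nrm v * (s + (16 * nrm a + 1) / nrm v - nrm a) =
  nrm v * (s - nrm a) + (16 * nrm a + 1) by field; rewrite gt_eqF.
have : 0 <= nrm v * (s - nrm a) by rewrite mulr_ge0 ?nrm_ge0 // subr_ge0 ltW.
clear; lra.
Qed.

(** The two horizontal sides together give the integral of 2i/(t^2+1), and so do the vertical
    ones. *)
Lemma J_neq0 : Jc != 0.
Proof.
pose h (t : R) : C := ((2 / (t ^+ 2 + 1))%:C)%C.
have ch : ccont_on (- 1) 1 h.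
  have ct t : (t ^+ 2 + 1 : R) != 0.
    by rewrite gt_eqF// ltr_wpDl// sqr_ge0.
  move=> x _ e e0.
  have cR : {for x, continuous (fun t : R => 2 / (t ^+ 2 + 1))}.
    apply: continuousM; first exact: cvg_cst.
    apply: continuousV; first exact: ct.
    by apply: continuousD; [exact: exprn_continuous|exact: cvg_cst].
  have /cvgrPdist_lt /(_ e e0) /nbhs_ballP[d /= d0 Hd] := cR.
  exists d => // y yd; rewrite /h -rmorphB nrm_real distrC.
  by apply: Hd; rewrite /ball /= distrC.
have quot (z1 z2 : C) (n : R) : z1 * z2 = (n%:C)%C -> n != 0 ->
    1 / (z1 - 0) - 1 / (z2 - 0) = (z2 - z1) / ((n%:C)%C).
  move=> E n0; rewrite -E; have : z1 * z2 != 0.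
    by rewrite E; apply: contra_neq n0 => -[].
  by rewrite mulf_eq0 negb_or !subr0 => /andP[? ?]; field; apply/andP.
have nz t : (t ^+ 2 + 1 : R) != 0 by rewrite gt_eqF// ltr_wpDl// sqr_ge0.
have e1 t : 1 / ((t +i* (-1)) - 0) - 1 / ((t +i* 1) - 0) = I * h t.
  rewrite (@quot _ _ (t ^+ 2 + 1))//; last first.
    by apply: cplx_eq; rewrite ?ReM ?ImM /=; ring.
  rewrite /h rmorphM fmorphV /= mulrA; congr (_ / _).
  by apply: cplx_eq; rewrite ?ReM ?ImM ?ReD ?ImD ?ReN ?ImN /=; ring.
have e2 t : 1 / ((1 +i* t) - 0) - 1 / (((-1) +i* t) - 0) = h t.
  rewrite (@quot _ _ (- (t ^+ 2 + 1)))//; last 2 first.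
  - by apply: cplx_eq; rewrite ?ReM ?ImM /=; ring.
  - by rewrite oppr_eq0.
  rewrite /h rmorphM fmorphV /= rmorphN invrN mulrN -mulNr; congr (_ / _).
  by apply: cplx_eq; rewrite ?ReM ?ImM ?ReD ?ImD ?ReN ?ImN /=; ring.
have JE : Jc = 2 * I * cint (-1) 1 h.
  have -> : Jc = I * cint (-1) 1 h + I * cint (-1) 1 h; last by ring.
  rewrite /Jc /sq /oint; congr (_ + _ * _); last by apply: eq_cint => t _; exact: e2.
  by rewrite -cintZ//; apply: eq_cint => t _; exact: e1.
have Re1 : 2 <= complex.Re (cint (-1) 1 h).
  have -> : (2 : R) = 1 * (1 - (- 1)) by ring.
  apply: cint_Re_ge => //.
  move=> t t1; rewrite /h /= ler_pdivlMr ?ltr_wpDl ?sqr_ge0// mul1r.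
  by move: t1; clear => /andP[? ?]; nra.
rewrite JE !mulf_neq0//.
- by apply/negP => /eqP[] /eqP; rewrite oner_eq0.
- by apply/negP => /eqP E; move: Re1; rewrite E /= leNgt ltr0n.
Qed.

End Square.

(** * Cauchy's formula and its estimates *)

Section CauchyFormula.
Variable R : realType.
Local Notation C := (cplx R).
Local Notation "x +i* y" := ((Complex x y) : C).
Local Notation I := (('i%C) : C).

Lemma le0_small (N K t0 : R) : 0 < t0 -> 0 <= K ->
  (forall t, 0 < t -> t < t0 -> N <= K * t) -> N <= 0.
Proof.
move=> t00 K0 H; rewrite leNgt; apply/negP => N0.
pose t := Num.min (t0 / 2) (N / (2 * (K + 1))).
have t1 : 0 < t.
  by rewrite lt_min !divr_gt0//; have : 0 < 2 * (K + 1); rewrite ?mulr_gt0 ?ltr_wpDl.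
have t2 : t < t0.
  apply: (@le_lt_trans _ _ (t0 / 2)); first by rewrite ge_min lexx.
  by rewrite ltr_pdivrMr// mulr_natr mulr2n ltrDl.
have t3 : t * (2 * (K + 1)) <= N.
  rewrite -ler_pdivlMr; last by rewrite mulr_gt0 ?ltr_wpDl.
  by rewrite ge_min lexx orbT.
have := H t t1 t2; move: K0 t1 t3 N0; clear; nra.
Qed.

Section Disc.
Variables (s : R) (f : C -> C).
Hypothesis s0 : 0 < s.
Hypothesis df : forall z, nrm z <= 2 * s -> differentiable f z.

(** Shrink the square to one of side 2 t around a: the difference quotient is bounded near a, so
    the integral is O(t). *)
Lemma cauchy_quot a : nrm a < s -> sq s (fun z => (f z - f a) / (z - a)) = 0.
Proof.
move=> as_; set q := fun z => _.
have a2s : nrm a <= 2 * s by move: as_ (s0); clear -s0 df; lra.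
have dq z : nrm z <= 2 * s -> z != a -> differentiable q z.
  move=> zs za; apply: diff_div => //; apply: dfB; first exact: df.
  exact: dfc.
have [K K0 HK] := diff_bnd (df a2s).
have [d d0 Hd] := diff_eps (df a2s) ltr01.
pose t0 := Num.min (s - nrm a) (d / 2).
have t00 : 0 < t0 by rewrite lt_min subr_gt0 as_ divr_gt0.
apply/nrm_eq0/eqP; rewrite eq_le nrm_ge0 andbT.
apply: (@le0_small _ (16 * (K + 1)) t0) => //.
  by rewrite mulr_ge0// addr_ge0// ltW.
move=> t tpos; rewrite lt_min => /andP[tsa td].
have [a1s a2s'] := (Re_le_nrm a, Im_le_nrm a).
pose a1 := complex.Re a; pose a2 := complex.Im a.
have aE : a = a1 +i* a2 by rewrite /a1 /a2; case: (a).
rewrite -/a1 in a1s; rewrite -/a2 in a2s'.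
have [ba1 ba1'] : - s <= a1 - t /\ a1 + t <= s.
  by move: a1s tsa; rewrite ler_norml; clear -s0 df => /andP[? ?] ?; split; lra.
have [ba2 ba2'] : - s <= a2 - t /\ a2 + t <= s.
  by move: a2s' tsa; rewrite ler_norml; clear -s0 df => /andP[? ?] ?; split; lra.
have tt (x : R) : x - t <= x + t by move: tpos; clear -s0 df; lra.
have -> : sq s q = oint (a1 - t) (a1 + t) (a2 - t) (a2 + t) q.
  apply: oint_shrink => // x y hx hy h; apply: dq.
    apply: le_trans (nrm_le_ReIm _) _ => /=.
    by move: hx hy; rewrite -!ler_norml; clear -s0 df; lra.
  rewrite aE; apply/eqP => -[ex ey]; move: h; rewrite ex ey; move: tpos; clear -s0 df.
  by move=> ? []; lra.
have near_a x y : `|x - a1| <= t -> `|y - a2| <= t -> (`|x - a1| = t \/ `|y - a2| = t) ->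
    contC q (x +i* y) /\ nrm (q (x +i* y)) <= K + 1.
  move=> hx hy hxy; set z := x +i* y.
  have zaE : z - a = (x - a1) +i* (y - a2).
    by rewrite aE; apply: cplx_eq; rewrite ?ReD ?ImD ?ReN ?ImN.
  have zat : nrm (z - a) <= t + t.
    by apply: le_trans (nrm_le_ReIm _) _; rewrite zaE /= lerD.
  have zat' : t <= nrm (z - a).
    have := Re_le_nrm (z - a); have := Im_le_nrm (z - a); rewrite zaE /=.
    by move=> ? ?; case: hxy => [<-|<-].
  have za0 : 0 < nrm (z - a) by exact: lt_le_trans tpos zat'.
  have za : z != a by apply: contraTneq za0 => ->; rewrite subrr nrm0 ltxx.
  split.
    apply: diff_contC; apply: dq => //.
    have := nrm_ge0 a; have := nrmD (z - a) a; rewrite subrK; move: zat tsa as_ tpos; clear -s0 df; lra.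
  have zad : nrm (z - a) < d by move: zat td; clear -s0 df; lra.
  rewrite /q nrmM nrmV ler_pdivrMr//.
  have := HK (z - a); have := Hd _ zad; rewrite subrKC.
  have -> : f z - f a = (f z - f a - 'd f a (z - a)) + 'd f a (z - a) by ring.
  have := nrmD (f z - f a - 'd f a (z - a)) ('d f a (z - a)).
  rewrite mulrDl !mul1r addrK => h1 h2 h3; apply: (le_trans h1).
  by rewrite addrC; apply: lerD.
have bd P : (forall x y, `|x - a1| <= t -> `|y - a2| <= t ->
    (`|x - a1| = t \/ `|y - a2| = t) -> P (x +i* y)) ->
    on_bdry (a1 - t) (a1 + t) (a2 - t) (a2 + t) P.
  move=> H.
  have n1 b : `|b - t - b| = t by rewrite addrAC subrr add0r normrN gtr0_norm.
  have n2 b : `|b + t - b| = t by rewrite addrAC subrr add0r gtr0_norm.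
  have n3 (u b : R) : b - t <= u <= b + t -> `|u - b| <= t.
    by rewrite ler_norml => /andP[? ?]; apply/andP; split; lra.
  by split=> u /n3 hu; split; apply: H; rewrite ?n1 ?n2//; [right|right|left|left].
apply: le_trans (oint_bound _ _ _ (M := K + 1) _) _ => //.
- by apply: bd => x y h1 h2 h3; case: (near_a x y h1 h2 h3).
- by apply: bd => x y h1 h2 h3; case: (near_a x y h1 h2 h3).
by rewrite le_eqVlt; apply/orP; left; apply/eqP; ring.
Qed.

Lemma cauchy a : nrm a < s -> sq s (fun z => f z / (z - a)) = f a * Jc R.
Proof.
move=> as_.
have dd (g : C -> C) : (forall z, nrm z <= 2 * s -> differentiable g z) ->
    ring_at s (contC (fun z => g z / (z - a))).
  by move=> dg; apply/ring_diff_cont/ring_div => // z /andP[_ /dg].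
have e1 : sq s (fun z => f z / (z - a)) =
    sq s (fun z => (f z - f a) / (z - a) + f a * (1 / (z - a))).
  by congr sq; apply/funext => z; ring.
rewrite e1 sqD//; last 2 first.
- by apply: dd => z zs; apply: dfB; [exact: df|exact: dfc].
- by move=> z zs; apply: contCZ; apply: (dd (fun=> 1)) => // w _; exact: dfc.
rewrite cauchy_quot// add0r sqZ//; last first.
  by apply: (dd (fun=> 1)) => // w _; exact: dfc.
by rewrite J_any.
Qed.

(** A constant, independent of the function, good for all the estimates below. *)
Definition KJ : R := 32 / nrm (Jc R).

Lemma J_gt0 : 0 < nrm (Jc R).
Proof. exact/nrm_gt0/J_neq0. Qed.

Lemma KJ_gt0 : 0 < KJ.
Proof. by rewrite /KJ divr_gt0 ?J_gt0. Qed.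

Variable M : R.
Hypothesis fM : forall z, nrm z <= 2 * s -> nrm (f z) <= M.

Let dring g : (forall z, s <= nrm z <= 2 * s -> differentiable g z) ->
  ring_at s (contC g).
Proof. by move=> H; apply: ring_diff_cont. Qed.

Let nz0 (z : C) : s <= nrm z -> z != 0.
Proof. by move=> sz; apply: contraTneq sz => ->; rewrite nrm0 -ltNge. Qed.

(** The derivative at 0 as an integral: this is [cderivE], for functions differentiable on a
    larger disc. *)
Definition cderiv : C := (Jc R)^-1 * sq s (fun z => f z / z ^+ 2).

Let d2 z : s <= nrm z <= 2 * s -> differentiable (fun z => f z / z ^+ 2) z.
Proof.
move=> /andP[sz zs]; apply: df_div; [exact: df| |by rewrite expf_neq0 ?nz0].
by apply: (dfM (df_id z) (df_id z)).
Qed.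

Lemma cderiv_bound : nrm cderiv <= KJ * M / s.
Proof.
rewrite /cderiv nrmM nrmV /KJ.
have b := @sq_bound R s s0 _ (M / s ^+ 2) (dring d2).
have M0 : 0 <= M.
  by apply: le_trans (nrm_ge0 (f 0)) (fM _); rewrite nrm0 mulr_ge0// ltW.
have /b b' : ring_at s (fun z => nrm (f z / z ^+ 2) <= M / s ^+ 2).
  move=> z /andP[sz zs]; rewrite nrmM nrmV nrmX; apply: ler_pM; rewrite ?nrm_ge0//.
  - by rewrite invr_ge0 exprn_ge0 // nrm_ge0.
  - exact: fM.
  - rewrite lef_pV2 ?posrE ?exprn_gt0//; first by rewrite ler_pXn2r// nnegrE ?nrm_ge0// ltW.
    exact: lt_le_trans s0 sz.
rewrite mulrC; apply: (@le_trans _ _ (16 * (M / s ^+ 2) * s / nrm (Jc R))).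
  by rewrite ler_pM2r ?invr_gt0 ?J_gt0.
have -> : 16 * (M / s ^+ 2) * s / nrm (Jc R) = 16 * (M / s / nrm (Jc R)).
  by field; rewrite !gt_eqF// J_gt0.
have -> : 32 / nrm (Jc R) * M / s = 32 * (M / s / nrm (Jc R)).
  by field; rewrite !gt_eqF// J_gt0.
have : 0 <= M / s / nrm (Jc R) by rewrite !divr_ge0// ltW// J_gt0.
clear -s0 df fM dring nz0 d2; lra.
Qed.

(** Cauchy's formula and 1/(z-a) = 1/z + a/z^2 + a^2/(z^2 (z-a)). *)
Lemma cauchy_taylor a : nrm a <= s / 2 ->
  nrm (f a - f 0 - a * cderiv) <= KJ * M * nrm a ^+ 2 / s ^+ 2.
Proof.
move=> as_.
have as' : nrm a < s by move: as_ (s0); clear -s0 df fM dring nz0 d2; lra.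
have n0 : nrm (0 : C) < s by rewrite nrm0.
have M0 : 0 <= M.
  by apply: le_trans (nrm_ge0 (f 0)) (fM _); rewrite nrm0 mulr_ge0// ltW.
pose g z := f z / (z ^+ 2 * (z - a)).
have za z : s <= nrm z -> z - a != 0.
  move=> sz; rewrite subr_eq0; apply: contraTneq sz => ->.
  by rewrite -ltNge.
have dg : ring_at s (fun z => differentiable g z).
  move=> z /andP[sz zs]; apply: df_div; first exact: df.
    apply: dfM; first by apply: (dfM (df_id z) (df_id z)).
    by apply: dfB; [exact: df_id|exact: dfc].
  by rewrite mulf_neq0 ?za ?expf_neq0 ?nz0.
have cg := dring dg.
have da : ring_at s (contC (fun z => f z / (z - a))).
  by apply/ring_diff_cont/ring_div => // z /andP[_ /df].
have d0 : ring_at s (contC (fun z => f z / (z - 0))).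
  by apply/ring_diff_cont/ring_div => // z /andP[_ /df].
have e : (f a - f 0 - a * cderiv) * Jc R = a ^+ 2 * sq s g.
  rewrite mulrBl mulrBl -(cauchy as') -(cauchy n0) /cderiv.
  have -> : a * ((Jc R)^-1 * sq s (fun z => f z / z ^+ 2)) * Jc R =
     a * sq s (fun z => f z / z ^+ 2) by field; exact: J_neq0.
  rewrite -!sqZ//; last exact: dring.
  rewrite -sqB// -sqB//; last 2 first.
  - by move=> z zs; apply: contCB; [exact: da|exact: d0].
  - by move=> z zs; apply: contCZ; exact: (dring d2).
  apply: eq_sq => // z /andP[sz zs]; rewrite /g subr0; field.
  by rewrite za// nz0.
have gM : ring_at s (fun z => nrm (g z) <= M / (s ^+ 2 * (s / 2))).
  move=> z /andP[sz zs]; rewrite /g nrmM nrmV nrmM nrmX.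
  have za2 : s / 2 <= nrm (z - a).
    have := nrmD (z - a) a; rewrite subrK; move: as_ sz; clear -s0 df fM dring nz0 d2; lra.
  have z0 := lt_le_trans s0 sz.
  have s2 : 0 < s / 2 by rewrite divr_gt0.
  apply: ler_pM; rewrite ?nrm_ge0//.
  - by rewrite invr_ge0 mulr_ge0 ?exprn_ge0 ?nrm_ge0.
  - exact: fM.
  - rewrite lef_pV2 ?posrE ?mulr_gt0 ?exprn_gt0//; last exact: lt_le_trans za2.
    apply: ler_pM => //; first by rewrite exprn_ge0// ltW.
      exact: ltW.
    by rewrite ler_pXn2r// nnegrE ?nrm_ge0// ltW.
have b := sq_bound s0 cg gM.
rewrite -(ler_pM2r J_gt0) -nrmM e nrmM nrmX.
apply: (@le_trans _ _ (nrm a ^+ 2 * (16 * (M / (s ^+ 2 * (s / 2))) * s))).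
  by rewrite ler_wpM2l// exprn_ge0// nrm_ge0.
rewrite le_eqVlt; apply/orP; left; apply/eqP; rewrite /KJ; field.
by rewrite !gt_eqF// J_gt0.
Qed.

Lemma cderivE : 'd f 0 1 = cderiv.
Proof.
have := @eps_diff R C f (fun u => u * cderiv) 0 (nrm cderiv).
case.
- by move=> a u v; rewrite /GRing.scale /=; ring.
- by move=> u; rewrite nrmM mulrC.
- move=> e e0.
  have M0 : 0 <= M.
    by apply: le_trans (nrm_ge0 (f 0)) (fM _); rewrite nrm0 mulr_ge0// ltW.
  pose k := KJ * M / s ^+ 2.
  have k0 : 0 <= k.
    apply: divr_ge0; first by apply: mulr_ge0 => //; exact/ltW/KJ_gt0.
    by apply: exprn_ge0; exact: ltW.
  exists (Num.min (s / 2) (e / (k + 1))).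
    by rewrite lt_min !divr_gt0// ltr_wpDl.
  move=> u; rewrite lt_min => /andP[/ltW u1 u2].
  rewrite add0r; apply: le_trans (cauchy_taylor u1) _.
  have -> : KJ * M * nrm u ^+ 2 / s ^+ 2 = k * nrm u * nrm u.
    by rewrite /k; field; rewrite gt_eqF.
  apply: ler_wpM2r; first exact: nrm_ge0.
  move: u2; rewrite ltr_pdivlMr ?ltr_wpDl// => u2.
  have := nrm_ge0 u; move: u2 k0; clear -s0 df fM dring nz0 d2; nra.
by move=> _ ->; rewrite mul1r.
Qed.

End Disc.
End CauchyFormula.

(** * Integrals depending on a point of a normed space *)

Section SeveralVariables.
Variable R : realType.
Local Notation C := (cplx R).

Section OneSpace.
Variable V : normedModType C.
Implicit Types (f H : V -> C) (p u e z : V).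

Lemma df_line p u (xi : C) : differentiable (fun xi : C => p + xi *: u) xi.
Proof.
apply: (@differentiableD _ _ _ (cst p) (fun xi : C => xi *: u)).
  exact: differentiable_cst.
by apply: (@differentiableZl _ _ _ id u); exact: ex_diff.
Qed.

Lemma diff_line f p u : differentiable f p ->
  'd (fun xi : C => f (p + xi *: u)) 0 1 = 'd f p u.
Proof.
move=> df.
have dphi : differentiable (fun xi : C => f (p + xi *: u)) 0.
  apply: (@df_comp R C V (fun xi : C => p + xi *: u)); first exact: df_line.
  by rewrite scale0r addr0.
rewrite -(deriveE _ dphi) -(deriveE _ df) /derive.
apply: (congr1 (fun g : C -> C => lim (g @ 0^'))); apply/funext => h /=; rewrite scale0r !addr0.
have hh : h *: (1 : C) = h by rewrite /GRing.scale /= mulr1.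
by rewrite hh [p + _]addrC.
Qed.

Lemma loc_bounded f p : (\forall z \near p, differentiable f z) ->
  exists r : R, exists M : R, 0 < r /\
    forall z, nrm (z - p) <= 2 * r -> differentiable f z /\ nrm (f z) <= M.
Proof.
move=> /nearP[r r0 Hr].
have dp : differentiable f p by apply: Hr; rewrite subrr nrm0.
have [K K0 HK] := diff_bnd dp; have [d d0 Hd] := diff_eps dp ltr01.
pose t := Num.min r d / 4.
have t0 : 0 < t by rewrite divr_gt0// lt_min r0.
exists t, (nrm (f p) + (K + 1) * (2 * t)); split => // z zt.
have : 2 * t < Num.min r d.
  have : 0 < Num.min r d by rewrite lt_min r0.
  by rewrite /t; clear; lra.
rewrite lt_min => /andP[tr td].
split; first by apply: Hr; exact: le_lt_trans zt tr.
have zd := le_lt_trans zt td.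
have := Hd _ zd; rewrite subrKC; have := HK (z - p).
have := nrmD (f z - f p - 'd f p (z - p)) ('d f p (z - p) + f p).
have := nrmD ('d f p (z - p)) (f p).
have -> : f z - f p - 'd f p (z - p) + ('d f p (z - p) + f p) = f z by ring.
have p1 : nrm (z - p) * (K + 1) <= 2 * t * (K + 1).
  by apply: ler_wpM2r => //; rewrite addr_ge0// ltW.
move: p1; rewrite (mulrC _ (K + 1)) (mulrC _ (K + 1)) [X in X <= _ -> _]mulrDl !mul1r.
by move=> *; lra.
Qed.

Section Quad.
Variables (f : V -> C) (p : V) (r M : R).
Hypothesis r0 : 0 < r.
Hypothesis Hf : forall z, nrm (z - p) <= 2 * r -> differentiable f z /\ nrm (f z) <= M.

Let dp : differentiable f p.
Proof. by apply Hf; rewrite subrr nrm0 mulr_ge0// ltW. Qed.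

Let line u (u0 : u != 0) (xi : C) : nrm xi <= 2 * (r / nrm u) ->
  nrm (p + xi *: u - p) <= 2 * r.
Proof.
move=> hx; rewrite addrAC subrr add0r nrmZ -ler_pdivlMr ?nrm_gt0//.
by rewrite -mulrA.
Qed.

Let dline u (u0 : u != 0) (xi : C) : nrm xi <= 2 * (r / nrm u) ->
  differentiable (fun xi : C => f (p + xi *: u)) xi.
Proof.
move=> hx; apply: (@df_comp R C V (fun xi : C => p + xi *: u)).
  exact: df_line.
by apply Hf; exact: line.
Qed.

Lemma quad_d u : nrm ('d f p u) <= KJ R * M / r * nrm u.
Proof.
have [->|u0] := eqVneq u 0; first by rewrite linear0 !nrm0 mulr0.
have n0 := nrm_gt0 u0.
have s0 : 0 < r / nrm u by rewrite divr_gt0.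
rewrite -(diff_line u dp).
have fM (xi : C) : nrm xi <= 2 * (r / nrm u) -> nrm (f (p + xi *: u)) <= M.
  by move=> hx; apply Hf; exact: line.
rewrite (cderivE s0 (dline u0) fM).
apply: le_trans (cderiv_bound s0 (dline u0) fM) _.
by rewrite invf_div mulrA le_eqVlt; apply/orP; left; apply/eqP; field; rewrite !gt_eqF.
Qed.

(** The one-variable estimate on the complex line through p and p + u. The constant depends only
    on the bound M, not on u; with [quad_d] this makes differentiation under the integral sign
    possible. *)
Lemma quad u : nrm u <= r / 2 ->
  nrm (f (p + u) - f p - 'd f p u) <= KJ R * M / r ^+ 2 * nrm u ^+ 2.
Proof.
move=> ur.
have [->|u0] := eqVneq u 0.
  by rewrite addr0 linear0 subrr subr0 !nrm0 expr0n mulr0.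
have n0 := nrm_gt0 u0.
have s0 : 0 < r / nrm u by rewrite divr_gt0.
have fM (xi : C) : nrm xi <= 2 * (r / nrm u) -> nrm (f (p + xi *: u)) <= M.
  by move=> hx; apply Hf; exact: line.
have a1 : nrm (1 : C) <= r / nrm u / 2.
  by rewrite nrm1 mulrAC ler_pdivlMr// mul1r.
have := cauchy_taylor s0 (dline u0) fM a1.
rewrite -(cderivE s0 (dline u0) fM) (diff_line u dp) scale1r scale0r addr0 mul1r.
move=> /le_trans; apply.
rewrite nrm1 le_eqVlt; apply/orP; left; apply/eqP; field.
by rewrite !gt_eqF.
Qed.

End Quad.

Section ParamInt.
Variables (H : V -> C) (p e : V) (w : C -> C) (s r M W : R).
Hypotheses (s0 : 0 < s) (r0 : 0 < r).
Hypothesis Hw : forall xi : C, s <= nrm xi <= 2 * s -> contC w xi /\ nrm (w xi) <= W.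
Hypothesis HH : forall (xi : C) y, s <= nrm xi <= 2 * s ->
  nrm (y - (p + xi *: e)) <= 2 * r -> differentiable H y /\ nrm (H y) <= M.

Let ctr (xi : C) : nrm (p + xi *: e - (p + xi *: e)) <= 2 * r.
Proof. by rewrite subrr nrm0 mulr_ge0// ltW. Qed.

Let W0 : 0 <= W.
Proof.
have h : s <= nrm ((s%:C)%C : C) <= 2 * s.
  by rewrite nrm_real ger0_norm ?(ltW s0)// lexx /= mulr_natl mulr2n lerDl ltW.
by apply: le_trans (nrm_ge0 _) (proj2 (Hw h)).
Qed.

Lemma ring_H z : nrm (z - p) <= 2 * r ->
  ring_at s (contC (fun xi : C => H (z + xi *: e) * w xi)).
Proof.
move=> zp xi hx; apply: contCM; last exact: (proj1 (Hw hx)).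
apply: diff_contC; apply: (@df_comp R C V (fun xi : C => z + xi *: e)).
  exact: df_line.
apply: (proj1 (HH hx _)).
by have -> : z + xi *: e - (p + xi *: e) = z - p by rewrite opprD addrACA subrr addr0.
Qed.

(** The derivative is the limit of difference quotients with step tau, at the uniform rate given
    by [quad], and each difference quotient is continuous. *)
Lemma cont_dH u (xi : C) : s <= nrm xi <= 2 * s -> contC (fun xi : C => 'd H (p + xi *: e) u) xi.
Proof.
move=> hx eps eps0; set q0 := p + xi *: e.
pose A := KJ R * M / (r / 2) ^+ 2 * nrm u ^+ 2.
(* The step of the difference quotients: the points stay in the domain, and the error tau A
   of a quotient is less than eps / 8. *)
pose tau := Num.min (r / 4 / (nrm u + 1)) (eps / 8 / (`|A| + 1)).
have nu1 : 0 < nrm u + 1 by rewrite ltr_wpDl ?nrm_ge0.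
have A1 : 0 < `|A| + 1 by rewrite ltr_wpDl.
have tau0 : 0 < tau by rewrite lt_min !divr_gt0.
have tau1 : tau * (nrm u + 1) <= r / 4.
  by rewrite -ler_pdivlMr// /tau ge_min lexx.
have tau2 : tau * (`|A| + 1) <= eps / 8.
  by rewrite -ler_pdivlMr// /tau ge_min lexx orbT.
have tu : nrm (((tau%:C)%C : C) *: u) <= r / 4.
  rewrite nrmZ nrm_real gtr0_norm//; apply: le_trans tau1.
  by rewrite ler_pM2l// lerDl.
have Dq q : nrm (q - q0) <= r / 2 ->
    nrm (H (q + ((tau%:C)%C : C) *: u) - H q - ((tau%:C)%C : C) * 'd H q u) <= tau ^+ 2 * A.
  move=> hq.
  have Hq z : nrm (z - q) <= 2 * (r / 2) -> differentiable H z /\ nrm (H z) <= M.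
    move=> hz; apply: (HH hx); rewrite -/q0.
    have := nrmD (z - q) (q - q0); rewrite subrKA => /le_trans; apply.
    by move: hz hq (r0); clear -r0 Hw HH ctr W0 s0; lra.
  have r2 : 0 < r / 2 by rewrite divr_gt0.
  have tu' : nrm (((tau%:C)%C : C) *: u) <= r / 2 / 2 by apply: le_trans tu _; clear -r0 Hw HH ctr W0 s0; lra.
  have := quad r2 Hq tu'; rewrite linearZ /=.
  move=> /le_trans; apply; rewrite nrmZ nrm_real gtr0_norm// /A.
  by rewrite le_eqVlt; apply/orP; left; apply/eqP; ring.
have cH q : nrm (q - q0) <= r / 4 -> exists2 d : R, 0 < d &
    forall q', nrm (q' - q) < d -> nrm (H q' - H q) < tau * (eps / 4).
  move=> hq.
  have dq : differentiable H q by apply: (proj1 (HH hx _)); apply: le_trans hq _; move: (r0); clear -r0 Hw HH ctr W0 s0; lra.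
  have te : 0 < tau * (eps / 4) by rewrite mulr_gt0 ?divr_gt0.
  exact: diff_near.
have hq0 : nrm (q0 - q0) <= r / 4 by rewrite subrr nrm0 divr_ge0// ltW.
have [d1 d10 Hd1] := cH q0 hq0.
have [d2 d20 Hd2] : exists2 d : R, 0 < d & forall q', nrm (q' - (q0 + ((tau%:C)%C : C) *: u)) < d ->
    nrm (H q' - H (q0 + ((tau%:C)%C : C) *: u)) < tau * (eps / 4).
  by apply: cH; rewrite addrAC subrr add0r.
pose d := Num.min (Num.min d1 d2) (r / 2) / (nrm e + 1).
have ne1 : 0 < nrm e + 1 by rewrite ltr_wpDl ?nrm_ge0.
exists d; first by rewrite divr_gt0// !lt_min d10 d20 divr_gt0.
move=> xi' hx'; set q := p + xi' *: e.
have qq : q - q0 = (xi' - xi) *: e.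
  by rewrite /q /q0 opprD addrACA subrr add0r scalerBl.
have : nrm (q - q0) < Num.min (Num.min d1 d2) (r / 2).
  rewrite qq nrmZ; move: hx'; rewrite /d ltr_pdivlMr//; apply: le_lt_trans.
  by apply: ler_wpM2l; rewrite ?nrm_ge0// lerDl.
rewrite !lt_min => /andP[/andP[q1 q2] /ltW q3].
have h1 := Dq _ q3; have h2 : nrm (q0 - q0) <= r / 2 by rewrite subrr nrm0 divr_ge0// ltW.
have {h2} h2 := Dq _ h2; have h3 := Hd1 _ q1.
have {q2} h4 : nrm (H (q + ((tau%:C)%C : C) *: u) - H (q0 + ((tau%:C)%C : C) *: u)) < tau * (eps / 4).
  by apply: Hd2; rewrite opprD addrACA subrr addr0.
rewrite -(ltr_pM2l tau0).
have <- : nrm (((tau%:C)%C : C) * ('d H q u - 'd H q0 u)) = tau * nrm ('d H q u - 'd H q0 u).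
  by rewrite nrmM nrm_real gtr0_norm.
move: h1 h2 h3 h4.
set T := (tau%:C)%C; set a1 := H (q + _); set a2 := H q; set a3 := H (q0 + _).
set a4 := H q0 => h1 h2 h3 h4.
have -> : T * ('d H q u - 'd H q0 u) = ((a1 - a3) - (a2 - a4)) +
   ((a3 - a4 - T * 'd H q0 u) - (a1 - a2 - T * 'd H q u)) by ring.
have n1 := nrmD ((a1 - a3) - (a2 - a4)) ((a3 - a4 - T * 'd H q0 u) - (a1 - a2 - T * 'd H q u)).
have n2 := nrmB (a1 - a3) (a2 - a4).
have n3 := nrmB (a3 - a4 - T * 'd H q0 u) (a1 - a2 - T * 'd H q u).
have t3 : tau ^+ 2 * A <= tau * (eps / 8).
  rewrite expr2 -mulrA ler_pM2l//; apply: le_trans tau2; rewrite ler_pM2l//.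
  by apply: le_trans (ler_norm _) _; rewrite lerDl.
apply: (le_lt_trans n1); apply: (@lt_le_trans _ _ (tau * (eps / 4) + tau * (eps / 4) +
  (tau * (eps / 8) + tau * (eps / 8)))).
  apply: ltr_leD.
    by apply: (le_lt_trans n2); exact: ltrD.
  by apply: (le_trans n3); apply: lerD; apply: le_trans t3.
rewrite -!mulrDr ler_pM2l//; lra.
Qed.

(** The candidate for the differential is the integral of the differentials; [quad] bounds the
    remainder uniformly on the contour. *)
Lemma param_int : differentiable (fun z => sq s (fun xi : C => H (z + xi *: e) * w xi)) p.
Proof.
pose L u := sq s (fun xi : C => 'd H (p + xi *: e) u * w xi).
have cL u : ring_at s (contC (fun xi : C => 'd H (p + xi *: e) u * w xi)).
  by move=> xi hx; apply: contCM; [exact: cont_dH|exact: (proj1 (Hw hx))].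
have wM (xi : C) : s <= nrm xi <= 2 * s -> nrm (w xi) <= W by move=> /Hw[].
have M0 : 0 <= M.
  have h : s <= nrm ((s%:C)%C : C) <= 2 * s.
    by rewrite nrm_real ger0_norm ?(ltW s0)// lexx /= mulr_natl mulr2n lerDl ltW.
  by apply: le_trans (nrm_ge0 _) (proj2 (HH h (ctr _))).
apply: (proj1 (@eps_diff R V _ L p (16 * (KJ R * M / r * W) * s) _ _ _)).
- move=> a u v; rewrite /L -sqZ// -sqD//; last by move=> xi hx; apply: contCZ; exact: cL.
  congr sq; apply/funext => xi; rewrite linearD linearZ /= /GRing.scale /=; ring.
- move=> u; have b := @sq_bound R s s0 _ (KJ R * M / r * nrm u * W) (cL u).
  apply: le_trans (b _) _.
    move=> xi hx; rewrite nrmM; apply: ler_pM; rewrite ?nrm_ge0 ?wM//.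
    exact: (quad_d r0 (fun y => @HH xi y hx)).
  by rewrite le_eqVlt; apply/orP; left; apply/eqP; ring.
move=> eps eps0.
pose A := 16 * (KJ R * M / r ^+ 2 * W) * s.
have A0 : 0 <= A.
  have K0 := ltW (KJ_gt0 R); have s0' := ltW s0; rewrite /A.
  apply: mulr_ge0 => //; apply: mulr_ge0 => //; apply: mulr_ge0 => //.
  by apply: divr_ge0; [exact: mulr_ge0|apply: exprn_ge0; exact: ltW].
exists (Num.min (r / 2) (eps / (A + 1))).
  by rewrite lt_min !divr_gt0// ltr_wpDl.
move=> u; rewrite lt_min => /andP[/ltW u1 u2].
have pu : nrm (p + u - p) <= 2 * r.
  rewrite addrAC subrr add0r; apply: le_trans u1 _.
  by move: (r0); clear -r0 Hw HH ctr W0 s0; lra.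
have pp : nrm (p - p) <= 2 * r by rewrite subrr nrm0 mulr_ge0// ltW.
rewrite /L -(sqB s0 (ring_H pu) (ring_H pp)) -(sqB s0 _ (cL u)); last first.
  by move=> xi hx; apply: contCB; exact: ring_H.
set g := fun xi : C => _.
have cg : ring_at s (contC g).
  move=> xi hx; apply: contCB; last exact: cL.
  by apply: contCB; exact: ring_H.
have gb : ring_at s (fun xi : C => nrm (g xi) <= KJ R * M / r ^+ 2 * nrm u ^+ 2 * W).
  move=> xi hx; rewrite /g -mulrBl -mulrBl nrmM.
  apply: ler_pM; rewrite ?nrm_ge0 ?wM//.
  by rewrite [p + u + _]addrAC; exact: (quad r0 (fun y => @HH xi y hx)).
apply: le_trans (sq_bound s0 cg gb) _.
have -> : 16 * (KJ R * M / r ^+ 2 * nrm u ^+ 2 * W) * s = A * nrm u * nrm u.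
  by rewrite /A; ring.
apply: ler_wpM2r; first exact: nrm_ge0.
move: u2; rewrite ltr_pdivlMr ?ltr_wpDl// => u2.
by apply: le_trans (ltW u2); rewrite mulrC ler_wpM2l ?nrm_ge0// lerDl.
Qed.

End ParamInt.
End OneSpace.
End SeveralVariables.

(** * Derivatives and quotients of holomorphic functions *)

Lemma dfX (R : realType) (V : normedModType (cplx R)) (f : V -> cplx R) n z :
  differentiable f z -> differentiable (fun z => f z ^+ n) z.
Proof.
move=> df; elim: n => [|n IH].
  by under eq_fun do rewrite expr0; exact: dfc.
by under eq_fun do rewrite exprS; exact: dfM.
Qed.

Section Division.
Variable R : realType.
Local Notation C := (cplx R).
Variable V : normedModType C.
Implicit Types (f : V -> C) (p v e z : V).

Lemma inv_pow_ring (s : R) n : 0 < s -> forall xi : C, s <= nrm xi <= 2 * s ->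
  contC (fun xi => (xi ^+ n)^-1) xi /\ nrm (xi ^+ n)^-1 <= (s ^+ n)^-1.
Proof.
move=> s0 xi /andP[h1 h2].
have x0 : xi != 0 by apply: contraTneq h1 => ->; rewrite nrm0 -ltNge.
split.
  apply: diff_contC; apply: dfV; last by rewrite expf_neq0.
  by apply: dfX; exact: df_id.
rewrite nrmV nrmX lef_pV2 ?posrE ?exprn_gt0 ?nrm_gt0//.
by apply: lerXn2r; rewrite // nnegrE ?nrm_ge0// ltW.
Qed.

Lemma small_scale (v : V) (r : R) : 0 < r -> exists2 s : R, 0 < s &
  forall xi : C, nrm xi <= 2 * s -> nrm (xi *: v) <= r.
Proof.
move=> r0; have v1 : 0 < nrm v + 1 by rewrite ltr_wpDl ?nrm_ge0.
exists (r / (nrm v + 1) / 2); first by rewrite !divr_gt0.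
move=> xi; rewrite mulrCA divff ?mulr1// ler_pdivlMr// nrmZ; apply: le_trans.
by apply: ler_wpM2l; rewrite ?nrm_ge0// lerDl.
Qed.

(** Cauchy's formula for the derivative at the center of a disc in the line of direction v,
    with z as parameter. *)
Lemma hol_diff f p v : (\forall z \near p, differentiable f z) ->
  differentiable (fun z => 'd f z v) p.
Proof.
move=> /loc_bounded[r [M [r0 Hr]]].
have r4 : 0 < r / 2 by rewrite divr_gt0.
have [s s0 Hs] := small_scale v r4.
have near_line z (xi : C) : nrm (z - p) <= r / 2 -> nrm xi <= 2 * s ->
    nrm (z + xi *: v - p) <= 2 * r.
  move=> h1 /Hs h2; rewrite addrAC; apply: le_trans (nrmD _ _) _.
  by move: h1 h2 r0; clear; lra.
apply: (@near_df R V _ (fun z => (Jc R)^-1 *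
   sq s (fun xi => f (z + xi *: v) * (xi ^+ 2)^-1))).
  apply/nearP; exists (r / 2) => // z /ltW zp.
  have dz : differentiable f z.
    by apply: (proj1 (Hr _ _)); apply: le_trans zp _; move: r0; clear; lra.
  have dphi (xi : C) : nrm xi <= 2 * s -> differentiable (fun xi : C => f (z + xi *: v)) xi.
    move=> hx; apply: (@df_comp R C V (fun xi : C => z + xi *: v)); first exact: df_line.
    by apply: (proj1 (Hr _ _)); exact: near_line.
  have bphi (xi : C) : nrm xi <= 2 * s -> nrm (f (z + xi *: v)) <= M.
    by move=> hx; apply: (proj2 (Hr _ _)); exact: near_line.
  by rewrite -(diff_line v dz) (cderivE s0 dphi bphi).
apply: dfM; first exact: dfc.
apply: (@param_int R V f p v _ s (r / 4) M (s ^+ 2)^-1) => //.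
- by rewrite divr_gt0.
- exact: inv_pow_ring.
move=> xi y /andP[_ hx] hy; apply: Hr.
have -> : y - p = (y - (p + xi *: v)) + xi *: v by rewrite opprD addrA subrK.
apply: le_trans (nrmD _ _) _; have := Hs _ hx.
by move: hy r0; clear; lra.
Qed.

Variables (l : V -> C) (e : V).
Hypothesis ld : forall z, differentiable l z.
Hypothesis lE : forall z (xi : C), l (z + xi *: e) = l z + xi.

(** The quotient f / l, extended to the zeros of l by l'Hopital's rule in the direction e, along
    which l has slope 1. *)
Definition quo (f : V -> C) (z : V) : C := if l z == 0 then 'd f z e else f z / l z.

Lemma quoM f z : (l z = 0 -> f z = 0) -> f z = l z * quo f z.
Proof.
move=> f0; rewrite /quo; case: eqP => [/[dup] /f0 -> ->|/eqP lz].
  by rewrite mul0r.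
by rewrite mulrC divfK.
Qed.

(** Near a zero of l, Cauchy's formula on the line of direction e expresses the quotient at z
    through its values where |l| is bounded below, even at the zeros of l. *)
Lemma quo_diff f p :
  (\forall z \near p, differentiable f z /\ (l z = 0 -> f z = 0)) ->
  differentiable (quo f) p.
Proof.
move=> Hn.
have dn : \forall z \near p, differentiable f z by apply: filterS Hn => z [].
have dp : differentiable f p by exact: nbhs_singleton dn.
have [lp|lp] := eqVneq (l p) 0; last first.
  apply: (@near_df R V _ (fun z => f z / l z)); last exact: df_div.
  have [d d0 Hd] := diff_near (ld p) (nrm_gt0 lp).
  apply/nearP; exists d => // z /Hd; rewrite /quo; case: eqP => // ->.
  by rewrite sub0r nrmN ltxx.
have [r0' [M [r00 Hr0]]] := loc_bounded dn.
have /nearP[r1 r10 Hr1] := Hn.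
pose r := Num.min (r0' / 2) (r1 / 4).
have r0 : 0 < r by rewrite lt_min !divr_gt0.
have Hr z : nrm (z - p) <= 2 * r ->
    [/\ differentiable f z, nrm (f z) <= M & (l z = 0 -> f z = 0)].
  move=> hz; have [a b] : 2 * r <= 2 * r0' /\ 2 * r < r1.
    have : r <= r0' / 2 by rewrite /r ge_min lexx.
    have : r <= r1 / 4 by rewrite /r ge_min lexx orbT.
    by move: r00 r10; clear -ld lE; lra.
  have [h1 h2] := Hr0 z (le_trans hz a).
  by split => //; apply: (proj2 (Hr1 _ _)); exact: le_lt_trans b.
have r4 : 0 < r / 2 by rewrite divr_gt0.
have [s s0 Hs] := small_scale e r4.
have near_line z (xi : C) : nrm (z - p) <= r / 2 -> nrm xi <= 2 * s ->
    nrm (z + xi *: e - p) <= 2 * r.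
  move=> h1 /Hs h2; rewrite addrAC; apply: le_trans (nrmD _ _) _.
  by move: h1 h2 r0; clear -ld lE; lra.
have s2 : 0 < s / 2 by rewrite divr_gt0.
have [d d0 Hd] := diff_near (ld p) s2.
pose H z := f z / l z.
apply: (@near_df R V _ (fun z => (Jc R)^-1 *
   sq s (fun xi => H (z + xi *: e) * (xi ^+ 1)^-1))).
  apply/nearP; exists (Num.min d (r / 2)); first by rewrite lt_min d0.
  move=> z; rewrite lt_min => /andP[/Hd]; rewrite lp subr0 => lz /ltW zp.
  have lzs : nrm (l z) < s by move: lz s0; clear -ld lE; lra.
  have dphi (xi : C) : nrm xi <= 2 * s -> differentiable (fun xi : C => f (z + xi *: e)) xi.
    move=> hx; apply: (@df_comp R C V (fun xi : C => z + xi *: e)); first exact: df_line.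
    by case: (Hr _ (near_line _ _ zp hx)).
  have bphi (xi : C) : nrm xi <= 2 * s -> nrm (f (z + xi *: e)) <= M.
    by move=> hx; case: (Hr _ (near_line _ _ zp hx)).
  have dz : differentiable f z.
    have h0 : nrm (0 : C) <= 2 * s by rewrite nrm0 mulr_ge0// ltW.
    by have [] := Hr _ (near_line _ _ zp h0); rewrite scale0r addr0.
  have ring0 (xi : C) : s <= nrm xi -> xi != 0.
    by move=> hx; apply: contraTneq hx => ->; rewrite nrm0 -ltNge.
  rewrite /quo; case: eqP => [lz0|/eqP lz0].
    rewrite -(diff_line e dz) (cderivE s0 dphi bphi) /cderiv; congr (_ * _).
    apply: eq_sq => // xi /andP[hx _]; rewrite /H lE lz0 add0r expr1.
    by field; exact: ring0.
  have n0 : nrm (0 : C) < s by rewrite nrm0.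
  have nl : nrm (- l z) < s by rewrite nrmN.
  have c0 := cauchy s0 dphi n0; have c1 := cauchy s0 dphi nl.
  have f0 : f (z + (- l z) *: e) = 0.
    have hl : nrm (- l z) <= 2 * s by rewrite nrmN; move: lzs s0; clear -ld lE; lra.
    by have [_ _] := Hr _ (near_line _ _ zp hl); apply; rewrite lE subrr.
  rewrite f0 mul0r in c1; rewrite scale0r addr0 in c0.
  have cr (a : C) : nrm a < s ->
      ring_at s (contC (fun xi => f (z + xi *: e) / (xi - a))).
    by move=> as_; apply/ring_diff_cont/ring_div => // xi /andP[_ /dphi].
  have -> : sq s (fun xi => H (z + xi *: e) * (xi ^+ 1)^-1) =
     (l z)^-1 * (f z * Jc R).
    rewrite -[f z * _]subr0 -[X in _ * (_ - X)]c1 -c0 -sqB//; last 2 first.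
    - exact: cr.
    - exact: cr.
    rewrite -sqZ//; last by move=> xi hx; apply: contCB; [exact: cr|exact: cr].
    apply: eq_sq => // xi /andP[hx _]; rewrite /H lE expr1 subr0 opprK.
    have xl : l z + xi != 0.
      rewrite addrC addr_eq0; apply: contraTneq hx => ->; rewrite -ltNge.
      by rewrite nrmN.
    have xl' : xi + l z != 0 by rewrite addrC.
    by field; rewrite ?lz0 ?xl ?xl' ?ring0.
  by field; rewrite lz0 J_neq0.
apply: dfM; first exact: dfc.
pose r' := Num.min (r / 4) (d / 4).
have r'0 : 0 < r' by rewrite lt_min !divr_gt0.
apply: (@param_int R V H p e _ s r' (M / (s / 2)) (s ^+ 1)^-1) => //.
- exact: inv_pow_ring.
move=> xi y /andP[sx hx] hy.
have [hy1 hy2] : 2 * r' <= r / 2 /\ 2 * r' < d.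
  have : r' <= r / 4 by rewrite /r' ge_min lexx.
  have : r' <= d / 4 by rewrite /r' ge_min lexx orbT.
  by move: r0 d0; clear -ld lE; lra.
have yp : nrm (y - p) <= 2 * r.
  have -> : y - p = (y - (p + xi *: e)) + xi *: e by rewrite opprD addrA subrK.
  apply: le_trans (nrmD _ _) _; have := Hs _ hx.
  by move: hy hy1 r0; clear -ld lE; lra.
have [dy My _] := Hr _ yp.
have ly : s / 2 <= nrm (l y).
  have : nrm (l (y + (- xi) *: e) - l p) < s / 2.
    apply: Hd; rewrite scaleNr -addrA -opprD [_ + p]addrC.
    exact: le_lt_trans hy hy2.
  rewrite lE lp subr0 => h.
  have := nrmB (l y) (l y + - xi); rewrite opprD addrA subrr add0r opprK.
  by move: h sx; clear -ld lE; lra.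
have ly0 : l y != 0.
  by apply: contraTneq ly => ->; rewrite nrm0 -ltNge.
split; first exact: df_div.
rewrite nrmM nrmV; apply: ler_pM; rewrite ?nrm_ge0 ?invr_ge0 ?nrm_ge0//.
by rewrite lef_pV2// posrE// nrm_gt0.
Qed.

End Division.

(** * Zeros of entire functions of one variable *)

Section ZeroOrder.
Variable R : realType.
Local Notation C := (cplx R).

Lemma ccont_bounded (a b : R) (h : R -> C) : a <= b -> ccont_on a b h ->
  exists M, forall t, a <= t <= b -> nrm (h t) <= M.
Proof.
move=> ab ch.
have cn : {within `[a, b], continuous (fun t => nrm (h t))}.
  apply: continuous_in_subspaceT => x; rewrite inE /= in_itv /= => /ch Hx.
  apply/cvgrPdist_lt => e /Hx[d d0 Hd]; apply/nbhs_ballP; exists d => // y.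
  rewrite /ball /= distrC => /Hd H; apply: le_lt_trans H.
  have h1 := nrmD (h x - h y) (h y); have h2 := nrmD (h y - h x) (h x).
  rewrite !subrK in h1 h2; rewrite (nrm_sub (h x)) in h1.
  by rewrite ler_norml; apply/andP; split; lra.
have [c _ Hc] := EVT_max ab cn.
by exists (nrm (h c)) => t tab; apply: Hc; rewrite in_itv.
Qed.

Lemma bdry_and x1 x2 y1 y2 (P Q : C -> Prop) : on_bdry x1 x2 y1 y2 P ->
  on_bdry x1 x2 y1 y2 Q -> on_bdry x1 x2 y1 y2 (fun z => P z /\ Q z).
Proof.
move=> [p1 p2] [q1 q2]; split=> t ht.
  by have [? ?] := p1 t ht; have [? ?] := q1 t ht.
by have [? ?] := p2 t ht; have [? ?] := q2 t ht.
Qed.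

Lemma bdry_bounded (s : R) (f : C -> C) : 0 < s ->
  (forall z, differentiable f z) ->
  exists M, on_bdry (- s) s (- s) s (fun z => nrm (f z) <= M).
Proof.
move=> s0 df.
have cf : on_bdry (- s) s (- s) s (contC f).
  by split=> t _; split; apply: diff_contC.
have ss : - s <= s by rewrite -subr_ge0 opprK addr_ge0 ?ltW.
have [/(ccont_bounded ss)[M1 H1] /(ccont_bounded ss)[M2 H2]
      /(ccont_bounded ss)[M3 H3] /(ccont_bounded ss)[M4 H4]] := bdry_ccont cf.
exists (Num.max (Num.max M1 M2) (Num.max M3 M4)).
split=> t ht; rewrite !le_max.
  by rewrite H1// H2// !orbT.
by rewrite H3// H4// !orbT.
Qed.

Lemma sub_affine (s0 z xi : C) : z + xi *: (1 : C) - s0 = z - s0 + xi.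
Proof. by rewrite /GRing.scale /= mulr1 addrAC. Qed.

Lemma df_sub (s0 z : C) : differentiable (fun z : C => z - s0) z.
Proof. by apply: dfB; [exact: df_id|exact: dfc]. Qed.

(** On a square of size s around s0 the cofactor q is bounded by M / s^m, and by Cauchy's
    formula so it is inside; with |w0 - s0| <= s / 2 this bounds f w0 by a multiple of 1 / 2^m. *)
Lemma infinite_order_zero (f : C -> C) (s0 : C) (w0 : C) :
  (forall z, differentiable f z) ->
  (forall m, exists2 q : C -> C, (forall z, differentiable q z) &
     forall z, f z = (z - s0) ^+ m * q z) ->
  f w0 = 0.
Proof.
move=> df Hq; set a := w0 - s0; pose s := 2 * nrm a + 1.
have na := nrm_ge0 a.
have sp : 0 < s by rewrite ltr_wpDl ?mulr_ge0.
have as2 : nrm a <= s / 2 by rewrite /s; clear -na; lra.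
have as1 : nrm a < s by rewrite /s; clear -na; lra.
have dfs : forall z, differentiable (fun z => f (s0 + z)) z.
  move=> z; apply: (@df_comp R C C (fun z => s0 + z)) => //.
have [M HM] := bdry_bounded sp dfs.
have rb := ring_bdry sp (fun z h => h : s <= nrm z <= 2 * s).
have fb m : nrm (f w0) <= KJ R * M / 2 ^+ m.
  have [q dq Hfq] := Hq m.
  have dqs z : differentiable (fun z => q (s0 + z)) z.
    apply: (@df_comp R C C (fun z => s0 + z)) => //.
  have c := cauchy sp (fun z _ => dqs z) as1.
  have sm : 0 < s ^+ m by rewrite exprn_gt0.
  have s2 : 0 < s / 2 by rewrite divr_gt0.
  have cont : on_bdry (- s) s (- s) s (contC (fun z => q (s0 + z) / (z - a))).
    by apply: ring_bdry => //; apply/ring_diff_cont/ring_div.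
  have ss : - s <= s by rewrite -subr_ge0 opprK addr_ge0 ?ltW.
  have bnd : on_bdry (- s) s (- s) s (fun z => nrm (q (s0 + z) / (z - a)) <= M / s ^+ m / (s / 2)).
    apply: on_bdry_imp (bdry_and HM rb) => z [fz /andP[sz _]].
    have z0 : 0 < nrm z by exact: lt_le_trans sz.
    rewrite nrmM nrmV; apply: ler_pM; rewrite ?invr_ge0 ?nrm_ge0//.
      rewrite ler_pdivlMr//; apply: le_trans fz; rewrite Hfq addrAC subrr add0r.
      rewrite nrmM nrmX mulrC; apply: ler_wpM2r; rewrite ?nrm_ge0//.
      by apply: lerXn2r; rewrite // nnegrE ltW.
    have h : s / 2 <= nrm (z - a).
      by have := nrmD (z - a) a; rewrite subrK; move: sz as2; clear; lra.
    by rewrite lef_pV2// posrE //; exact: lt_le_trans h.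
  have := oint_bound ss ss cont bnd; rewrite -/(sq _ _) c nrmM.
  have -> : s0 + a = w0 by rewrite /a addrC subrK.
  have J0 := J_gt0 R; rewrite -ler_pdivlMr// => h.
  have M0 : 0 <= M.
    have [h1 _] : nrm (f (s0 + Complex (- s) (- s))) <= M /\ True.
      by split => //; have [+ _] := HM => /(_ (- s)) []//; rewrite lexx.
    exact: le_trans (nrm_ge0 _) h1.
  rewrite Hfq nrmM nrmX -/a.
  apply: (@le_trans _ _ (nrm a ^+ m * (KJ R * M / s ^+ m))).
    apply: ler_wpM2l; first by rewrite exprn_ge0.
    apply: le_trans h _; rewrite /KJ le_eqVlt; apply/orP; left; apply/eqP.
    by field; rewrite !gt_eqF.
  have -> : nrm a ^+ m * (KJ R * M / s ^+ m) = KJ R * M * (nrm a / s) ^+ m.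
    by rewrite expr_div_n; ring.
  apply: ler_wpM2l; first by apply: mulr_ge0 => //; exact/ltW/KJ_gt0.
  rewrite -exprVn; apply: lerXn2r; rewrite ?nnegrE ?divr_ge0 ?invr_ge0 ?(ltW sp)//.
  by rewrite ler_pdivrMr// mulrC.
apply: nrm_eq0; apply/eqP; rewrite eq_le nrm_ge0 andbT leNgt; apply/negP => f0.
have [m Hm] := inv_pow2_lt (KJ R * M) f0.
by have := le_lt_trans (fb m) Hm; rewrite ltxx.
Qed.

(** Divide by z - s0 as long as the cofactor vanishes at s0; this ends by [infinite_order_zero]. *)
Lemma zero_order (f : C -> C) (s0 w0 : C) : (forall z, differentiable f z) ->
  f w0 != 0 -> exists m, exists g : C -> C, [/\ forall z, differentiable g z, g s0 != 0 &
    forall z, f z = (z - s0) ^+ m * g z].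
Proof.
move=> df fw; apply: contrapT => Hn.
suff Hq m : exists2 q : C -> C, (forall z, differentiable q z) &
    forall z, f z = (z - s0) ^+ m * q z.
  by move: fw; rewrite (infinite_order_zero w0 df Hq) eqxx.
elim: m => [|m [q dq Hfq]]; first by exists f => // z; rewrite expr0 mul1r.
have qs : q s0 = 0.
  by apply: contrapT => /eqP q0; apply: Hn; exists m, q.
have q0 z : z - s0 = 0 -> q z = 0 by move=> /subr0_eq ->.
exists (quo (fun z => z - s0) 1 q).
  move=> z; apply: quo_diff; [exact: df_sub|exact: sub_affine|].
  by apply/nearP; exists 1 => // w _; split => //; exact: q0.
move=> z; rewrite Hfq [in LHS](@quoM R C (fun z => z - s0) 1 q z (q0 z)).
by rewrite exprS mulrA [in RHS](mulrC (z - s0)).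
Qed.

Lemma isolated_zeros (f : C -> C) (s0 w0 : C) : (forall z, differentiable f z) ->
  f w0 != 0 -> \forall z \near s0^', f z != 0.
Proof.
move=> df /(zero_order s0 df)[m [g [dg g0 Hf]]].
have [d d0 Hd] := diff_near (dg s0) (nrm_gt0 g0).
apply/dnearP; exists d => // z /Hd gz zs; rewrite Hf mulf_neq0//.
  by rewrite expf_neq0// subr_eq0.
by apply: contraTneq gz => ->; rewrite sub0r nrmN ltxx.
Qed.

End ZeroOrder.

(** * The roots of E_8 as coefficient lists *)

(** The entries of the Cartan matrix, in a form that evaluates. *)
Definition ce (i j : nat) : int :=
  if i == j then 2 else if E8_edge i.+1 j.+1 || E8_edge j.+1 i.+1 then -1 else 0.

Definition sum8 (F : nat -> int) : int := foldr (fun l s => F l + s) 0 (iota 0 8).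

(** The value of the simple coroot j on the vector with coefficients k. *)
Definition dotC (j : nat) (k : seq int) : int := sum8 (fun l => ce j l * k`_l).

Definition sr (j : nat) (k : seq int) : seq int :=
  [seq (if i == j then k`_i - dotC j k else k`_i) | i <- iota 0 8].

Definition simp (j : nat) : seq int := [seq (i == j)%:R | i <- iota 0 8].

Definition oppk (k : seq int) : seq int := [seq - x | x <- k].

(** Each positive root that is not simple arises from a positive root of smaller height by adding
    a simple root alpha_j, and then the coroot of alpha_j has value -1 on the smaller root. *)
Fixpoint grow (n : nat) (layer : seq (seq int)) : seq (seq int) :=
  if n is n'.+1 then
    layer ++ grow n' (undup [seq sr p.2 p.1 | p <- allpairs pair layer (iota 0 8)
                                 & dotC p.2 p.1 == -1])
  else [::].

(** The argument 29 is the height of the highest root. *)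
Definition poslist : seq (seq int) :=
  Eval vm_compute in grow 29 [seq simp j | j <- iota 0 8].

(** Locked, for otherwise unification would unfold the list of 120 roots. *)
HB.lock Definition posl : seq (seq int) := poslist.

Definition rootl : seq (seq int) := posl ++ [seq oppk k | k <- posl].

(** The inverse of the Cartan matrix. *)
Definition cinv : seq (seq int) :=
  [:: [:: 4; 5; 7; 10; 8; 6; 4; 2]; [:: 5; 8; 10; 15; 12; 9; 6; 3];
      [:: 7; 10; 14; 20; 16; 12; 8; 4]; [:: 10; 15; 20; 30; 24; 18; 12; 6];
      [:: 8; 12; 16; 24; 20; 15; 10; 5]; [:: 6; 9; 12; 18; 15; 12; 8; 4];
      [:: 4; 6; 8; 12; 10; 8; 6; 3]; [:: 2; 3; 4; 6; 5; 4; 3; 2]].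

Definition ci (i j : nat) : int := (nth [::] cinv i)`_j.

Definition ht (k : seq int) : int := sum8 (fun l => k`_l).

Lemma cinvP : all (fun i => all (fun j => sum8 (fun l => ce i l * ci l j) == (i == j)%:R)
  (iota 0 8)) (iota 0 8).
Proof. by vm_compute. Qed.

Lemma size_posl : all (fun k : seq int => size k == 8%N) posl.
Proof. by rewrite posl.unlock; vm_compute. Qed.

Lemma norm_posl : all (fun k => sum8 (fun j => k`_j * dotC j k) == 2) posl.
Proof. by rewrite posl.unlock; vm_compute. Qed.

Lemma posl_pos : all (fun k => all (fun x => 0 <= x) k && (0 < ht k)) posl.
Proof. by rewrite posl.unlock; vm_compute. Qed.

Lemma uniq_rootl : uniq rootl.
Proof. by rewrite /rootl posl.unlock; vm_compute. Qed.

Lemma simp_posl : all (fun j => simp j \in posl) (iota 0 8).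
Proof. by rewrite posl.unlock; vm_compute. Qed.

Lemma sr_posl : all (fun j => perm_eq [seq sr j k | k <- posl]
  (oppk (simp j) :: rem (simp j) posl)) (iota 0 8).
Proof. by rewrite posl.unlock; vm_compute. Qed.

(** Witnesses, by 2 x 2 minors, that distinct positive roots are not proportional. *)
Lemma posl_indep : all (fun k => all (fun k' => (k == k') ||
  has (fun i => has (fun j => k`_i * k'`_j != k`_j * k'`_i) (iota 0 8)) (iota 0 8)) posl) posl.
Proof. by rewrite posl.unlock; vm_compute. Qed.

(** A certificate that each listed root is conjugate to a simple one. *)
Lemma posl_reach : all (fun k => (k \in [seq simp j | j <- iota 0 8]) ||
   has (fun j => (sr j k \in posl) && (ht (sr j k) < ht k)) (iota 0 8)) posl.
Proof. by rewrite posl.unlock; vm_compute. Qed.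

Lemma sr_closed : all (fun j => all (fun k =>
  if k == simp j then sr j k == oppk k else sr j k \in posl) posl) (iota 0 8).
Proof. by rewrite posl.unlock; vm_compute. Qed.

Lemma mem_rootl k : (k \in rootl) = (k \in posl) || (k \in [seq oppk k | k <- posl]).
Proof. exact: mem_cat. Qed.

(** * Words in the simple reflections *)

Lemma sum8E (F : nat -> int) : sum8 F = \sum_(l < 8) F l.
Proof. by rewrite -(big_mkord xpredT F) unlock. Qed.

Lemma cartanE (i j : 'I_8) : E8_cartan i j = ce i j.
Proof. by rewrite mxE. Qed.

Lemma ceC i j : ce i j = ce j i.
Proof. by rewrite /ce eq_sym orbC. Qed.

Lemma all8P (P : pred nat) : all P (iota 0 8) -> forall i : 'I_8, P i.
Proof. by move=> /allP H i; apply: H; rewrite mem_iota ltn_ord. Qed.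

Definition CI : 'M[int]_8 := \matrix_(i, j) ci i j.

Lemma cartan_CI : E8_cartan *m CI = 1%:M.
Proof.
apply/matrixP => i j; rewrite !mxE.
have /eqP <- := all8P (all8P cinvP i) j.
by rewrite sum8E; apply: eq_bigr => l _; rewrite cartanE mxE.
Qed.

Lemma CI_cartan : CI *m E8_cartan = 1%:M.
Proof. exact: mulmx1C cartan_CI. Qed.

Definition colk (k : seq int) : 'cV[int]_8 := \col_j k`_j.

Definition vec (k : seq int) : 'cV[int]_8 := E8_cartan *m colk k.

Lemma vecE k (i : 'I_8) : vec k i 0 = dotC i k.
Proof.
by rewrite mxE /dotC sum8E; apply: eq_bigr => l _; rewrite cartanE mxE.
Qed.

Lemma vec_sum k : vec k = \sum_j simple_root j *~ k`_j.
Proof.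
apply/matrixP => i j; rewrite ord1 {j} mxE summxE; apply: eq_bigr => l _.
have -> x : (simple_root l *~ x) i 0 = (simple_root l i 0) * x.
  by rewrite -scaler_int mxE intz mulrC.
by rewrite !mxE.
Qed.

Lemma colk_inj k k' : size k = 8%N -> size k' = 8%N -> colk k = colk k' -> k = k'.
Proof.
move=> s s' /matrixP E; apply: (@eq_from_nth _ 0); first by rewrite s.
by move=> i; rewrite s => i8; have := E (Ordinal i8) 0; rewrite !mxE.
Qed.

Lemma vec_inj k k' : size k = 8%N -> size k' = 8%N -> vec k = vec k' -> k = k'.
Proof.
move=> s s' E; apply: colk_inj => //.
by rewrite -[colk k]mul1mx -[colk k']mul1mx -CI_cartan -!mulmxA -/(vec k) E.
Qed.

Lemma size_sr j k : size (sr j k) = 8%N.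
Proof. by rewrite size_map size_iota. Qed.

Lemma nth_sr j k i : (i < 8)%N ->
  (sr j k)`_i = if i == j then k`_i - dotC j k else k`_i.
Proof. by move=> i8; rewrite (nth_map 0%N) ?size_iota// nth_iota. Qed.

Lemma size_simp j : size (simp j) = 8%N.
Proof. by rewrite size_map size_iota. Qed.

Lemma nth_simp j i : (i < 8)%N -> (simp j)`_i = (i == j)%:R.
Proof. by move=> i8; rewrite (nth_map 0%N) ?size_iota// nth_iota. Qed.

Lemma size_rootl k : k \in rootl -> size k = 8%N.
Proof.
have H := allP size_posl.
rewrite mem_rootl => /orP[/H/eqP//|/mapP[k' /H/eqP <- ->]].
by rewrite size_map.
Qed.

Lemma nth_oppk k i : (oppk k)`_i = - k`_i.
Proof.
have [ik|ki] := ltnP i (size k); first by rewrite (nth_map 0).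
by rewrite !nth_default ?size_map// oppr0.
Qed.

Lemma oppkK k : oppk (oppk k) = k.
Proof. by rewrite /oppk -map_comp -[RHS]map_id; apply: eq_map => x /=; rewrite opprK. Qed.

Lemma vec_simp (j : 'I_8) : vec (simp j) = simple_root j.
Proof.
apply/matrixP => i z; rewrite ord1 {z} vecE !mxE /dotC sum8E (bigD1 j)//=.
rewrite nth_simp// eqxx mulr1 big1 ?addr0 => [|l lj].
  by rewrite /ce; case: (i =P j) => [->|/eqP ij]; rewrite ?eqxx// (inj_eq val_inj) (negbTE ij).
by rewrite nth_simp// (inj_eq val_inj) (negbTE lj) mulr0.
Qed.

Lemma colk_sr (j : 'I_8) k : colk (sr j k) = colk k - dotC j k *: delta_mx j 0.
Proof.
apply/matrixP => i z; rewrite ord1 {z} !mxE nth_sr// (inj_eq val_inj) eqxx andbT.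
by case: (i =P j) => _; rewrite ?mulr1// mulr0 subr0.
Qed.

Lemma rank1_mul (A : comPzRingType) n (a : 'cV[A]_n) (j : 'I_n) (v : 'cV[A]_n) :
  a *m delta_mx 0 j *m v = v j 0 *: a.
Proof.
rewrite -mulmxA -rowE; apply/matrixP => i z; rewrite ord1 {z} !mxE big_ord1.
by rewrite !mxE mulrC.
Qed.

Lemma refl_vec (j : 'I_8) k : simple_refl j *m vec k = vec (sr j k).
Proof.
rewrite /simple_refl mulmxBl mul1mx /vec colk_sr mulmxBr -scalemxAr.
congr (_ - _); rewrite -/(vec k).
have -> : E8_cartan *m delta_mx j 0 = simple_root j by rewrite -colE.
by rewrite rank1_mul vecE.
Qed.

Lemma dotC_opp j k : dotC j (oppk k) = - dotC j k.
Proof. by rewrite /dotC !sum8E -sumrN; apply: eq_bigr => l _; rewrite nth_oppk mulrN. Qed.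

Lemma ht_opp k : ht (oppk k) = - ht k.
Proof. by rewrite /ht !sum8E -sumrN; apply: eq_bigr => l _; rewrite nth_oppk. Qed.

Lemma oppk_sr j k : size k = 8%N -> sr j (oppk k) = oppk (sr j k).
Proof.
move=> s; apply: (@eq_from_nth _ 0); first by rewrite size_sr [RHS]size_map size_sr.
move=> i; rewrite size_sr => i8; rewrite nth_oppk !nth_sr// nth_oppk dotC_opp.
by case: ifP => _; rewrite ?opprD.
Qed.

Lemma oppk_rootl k : (oppk k \in rootl) = (k \in rootl).
Proof.
have h k' : k' \in rootl -> oppk k' \in rootl.
  rewrite !mem_rootl => /orP[kp|/mapP[k'' kp ->]].
    by rewrite map_f ?orbT.
  by rewrite oppkK kp.
by apply/idP/idP => /h //; rewrite oppkK.
Qed.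

Lemma simp_pos (j : 'I_8) : simp j \in posl.
Proof. exact: all8P simp_posl j. Qed.

Lemma sr_simp (j : 'I_8) : sr j (simp j) = oppk (simp j).
Proof. by have /allP/(_ _ (simp_pos j)) := all8P sr_closed j; rewrite eqxx => /eqP. Qed.

Lemma sr_pos (j : 'I_8) k : k \in posl -> k != simp j -> sr j k \in posl.
Proof. by move=> kp /negbTE kj; have /allP/(_ _ kp) := all8P sr_closed j; rewrite kj. Qed.

Lemma sr_root (j : 'I_8) k : k \in rootl -> sr j k \in rootl.
Proof.
have h k' : k' \in posl -> sr j k' \in rootl.
  move=> kp; have [->|kj] := eqVneq k' (simp j).
    by rewrite sr_simp oppk_rootl mem_rootl simp_pos.
  by rewrite mem_rootl sr_pos.
move=> kr; have sk := size_rootl kr; move: kr.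
rewrite mem_rootl => /orP[/h//|/mapP[k' kp e]]; rewrite e oppk_sr.
  by rewrite oppk_rootl h.
by apply: size_rootl; rewrite mem_rootl kp.
Qed.

(** The transpose of the matrix [wmx s] of a word, acting on linear forms; see [ev_word]. *)
Definition wd (s : seq 'I_8) (k : seq int) : seq int := foldl (fun k (j : 'I_8) => sr j k) k s.

Definition wmx (s : seq 'I_8) : 'M[int]_8 := \prod_(j <- s) simple_refl j.

Lemma wmx_cons j s : wmx (j :: s) = simple_refl j *m wmx s.
Proof. by rewrite /wmx big_cons. Qed.

Lemma wmx_cat s t : wmx (s ++ t) = wmx s *m wmx t.
Proof. by rewrite /wmx big_cat. Qed.

Lemma wd_cat s t k : wd (s ++ t) k = wd t (wd s k).
Proof. by rewrite /wd foldl_cat. Qed.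

Lemma wd_root s k : k \in rootl -> wd s k \in rootl.
Proof. by elim: s k => //= j s IH k kr; apply: IH; exact: sr_root. Qed.

Lemma cart_sym (i j : 'I_8) : E8_cartan i j = E8_cartan j i.
Proof. by rewrite !cartanE ceC. Qed.

Lemma root_diag (j : 'I_8) : simple_root j j 0 = 2.
Proof. by rewrite !mxE eqxx. Qed.

Lemma reflK (j : 'I_8) : simple_refl j *m simple_refl j = 1%:M.
Proof.
rewrite /simple_refl mulmxBl mul1mx mulmxBr mulmx1 -mulmxA.
have -> : delta_mx 0 j *m (simple_root j *m delta_mx 0 j) = (2 : int) *: delta_mx 0 j :> 'rV_8.
  rewrite mulmxA -rowE; apply/matrixP => i z; rewrite (ord1 i) {i}.
  by rewrite mxE big_ord1 [row _ _ _ _]mxE root_diag [RHS]mxE.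
rewrite -scalemxAr scaler_nat mulr2n; set a := simple_root j *m _.
have -> : a - (a + a) = - a by rewrite opprD addrA subrr add0r.
by rewrite opprK subrK.
Qed.

Section Eval.
Variable K : numFieldType.
Implicit Types (v : 'cV[K]_8).

(** The linear form with coefficients k in the simple coroots. On roots this is the coroot; see
    [coroot_vec]. *)
Definition ev (k : seq int) v : K := \sum_(j < 8) (k`_j)%:~R * v j 0.

Lemma evD k v v' : ev k (v + v') = ev k v + ev k v'.
Proof. by rewrite /ev -big_split; apply: eq_bigr => j _; rewrite mxE mulrDr. Qed.

Lemma evZ k (a : K) v : ev k (a *: v) = a * ev k v.
Proof. by rewrite /ev mulr_sumr; apply: eq_bigr => j _; rewrite mxE mulrCA. Qed.

Lemma evN k v : ev k (- v) = - ev k v.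
Proof. by rewrite -scaleN1r evZ mulN1r. Qed.

Lemma ev_opp k v : ev (oppk k) v = - ev k v.
Proof. by rewrite /ev -sumrN; apply: eq_bigr => j _; rewrite nth_oppk mulrNz mulNr. Qed.

Lemma act_refl (j : 'I_8) v :
  act (simple_refl j) v = v - v j 0 *: of_int_mx K (simple_root j).
Proof.
rewrite /act /simple_refl /of_int_mx map_mxB map_mx1 map_mxM mulmxBl mul1mx.
by rewrite map_delta_mx rank1_mul.
Qed.

Lemma actM (w w' : 'M[int]_8) v : act (w *m w') v = act w (act w' v).
Proof. by rewrite /act /of_int_mx map_mxM mulmxA. Qed.

Lemma act1 v : act 1%:M v = v.
Proof. by rewrite /act /of_int_mx map_mx1 mul1mx. Qed.

Lemma ev_root k (j : 'I_8) : ev k (of_int_mx K (simple_root j)) = (dotC j k)%:~R.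
Proof.
rewrite /ev /dotC sum8E rmorph_sum /=; apply: eq_bigr => l _.
by rewrite !mxE -[if _ then _ else _]/(ce l j) rmorphM /= mulrC ceC.
Qed.

Lemma ev_refl k (j : 'I_8) v : ev k (act (simple_refl j) v) = ev (sr j k) v.
Proof.
rewrite act_refl evD evN evZ ev_root /ev [in RHS](bigD1 j)//= (bigD1 j)//=.
rewrite nth_sr// eqxx rmorphB /= mulrBl.
rewrite (eq_bigr (fun i : 'I_8 => ((sr j k)`_i)%:~R * v i 0)).
  by rewrite addrAC [v j 0 * _]mulrC.
by move=> i ij; rewrite nth_sr// (inj_eq val_inj) (negbTE ij).
Qed.

Lemma ev_word k s v : ev k (act (wmx s) v) = ev (wd s k) v.
Proof.
elim: s k => [|j s IH] k; first by rewrite /wmx big_nil act1.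
by rewrite wmx_cons actM ev_refl IH.
Qed.

Lemma ev_simp (j : 'I_8) v : ev (simp j) v = v j 0.
Proof.
rewrite /ev (bigD1 j)//= nth_simp// eqxx mul1r big1 ?addr0// => i ij.
by rewrite nth_simp// (inj_eq val_inj) (negbTE ij) mul0r.
Qed.

Lemma ev_one k : ev k (const_mx 1) = (ht k)%:~R.
Proof.
rewrite /ev /ht sum8E rmorph_sum; apply: eq_bigr => j _ /=.
by rewrite mxE mulr1.
Qed.

Lemma of_int_vec k : of_int_mx K (vec k) =
  of_int_mx K E8_cartan *m (\col_j (k`_j)%:~R).
Proof.
rewrite /vec /of_int_mx map_mxM; congr (_ *m _).
by apply/matrixP => i z; rewrite !mxE.
Qed.

Lemma cartan_inv : invmx (of_int_mx K E8_cartan) = of_int_mx K CI.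
Proof.
have e : of_int_mx K E8_cartan *m of_int_mx K CI = 1%:M.
  by rewrite -map_mxM cartan_CI map_mx1.
have [u _] := mulmx1_unit e.
by rewrite -[RHS]mul1mx -(mulVmx u) -mulmxA e mulmx1.
Qed.

Lemma bform_vec k v : bform (of_int_mx K (vec k)) v = ev k v.
Proof.
rewrite /bform cartan_inv of_int_vec trmx_mul -mulmxA -mulmxA (mulmxA _ _ v).
have -> : (of_int_mx K E8_cartan)^T = of_int_mx K E8_cartan.
  by apply/matrixP => i j; rewrite mxE [LHS]mxE [RHS]mxE cart_sym.
rewrite -map_mxM cartan_CI map_mx1 mul1mx mxE; apply: eq_bigr => j _.
by rewrite !mxE.
Qed.

Lemma norm_root k : k \in rootl -> ev k (of_int_mx K (vec k)) = 2.
Proof.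
have h k' : k' \in posl -> ev k' (of_int_mx K (vec k')) = 2.
  move=> kp; have /eqP := allP norm_posl _ kp => e.
  rewrite /ev (eq_bigr (fun j : 'I_8 => (k'`_j * dotC j k')%:~R)).
    by rewrite -rmorph_sum -(sum8E (fun j => k'`_j * dotC j k')) e.
  by move=> j _; rewrite [of_int_mx _ _ _ _]mxE vecE rmorphM.
rewrite mem_rootl => /orP[/h//|/mapP[k' kp ->]].
have -> : of_int_mx K (vec (oppk k')) = - of_int_mx K (vec k').
  apply/matrixP => i z; rewrite ord1 {z} [LHS]mxE vecE [RHS]mxE [X in - X]mxE vecE.
  by rewrite dotC_opp rmorphN.
by rewrite evN ev_opp opprK h.
Qed.

Lemma coroot_vec k v : k \in rootl -> coroot (vec k) v = ev k v.
Proof.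
move=> kr; rewrite /coroot !bform_vec norm_root// mulrC mulKf// pnatr_eq0.
Qed.

End Eval.

(** * The root systems and their positive systems *)

Lemma srK (j : 'I_8) k : size k = 8%N -> sr j (sr j k) = k.
Proof.
move=> sk; apply: vec_inj; rewrite ?size_sr//.
by rewrite -!refl_vec mulmxA reflK mul1mx.
Qed.

Lemma size_wd s k : size k = 8%N -> size (wd s k) = 8%N.
Proof. by elim: s k => //= j s IH k sk; apply: IH; rewrite size_sr. Qed.

Lemma wdK s k : size k = 8%N -> wd (rev s) (wd s k) = k.
Proof.
elim: s k => //= j s IH k sk; rewrite rev_cons -cats1 wd_cat IH ?size_sr//=.
exact: srK.
Qed.

Lemma wdKr s k : size k = 8%N -> wd s (wd (rev s) k) = k.
Proof. by move=> sk; rewrite -{1}(revK s) wdK. Qed.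

Lemma wd_inj s : {in rootl &, injective (wd s)}.
Proof.
move=> k k' /size_rootl sk /size_rootl sk' e.
by rewrite -(wdK s sk) e wdK.
Qed.

Lemma wd_opp s k : size k = 8%N -> wd s (oppk k) = oppk (wd s k).
Proof.
elim: s k => //= j s IH k sk; rewrite oppk_sr// IH//.
Qed.

Lemma posl_root k : k \in posl -> k \in rootl.
Proof. by rewrite mem_rootl => ->. Qed.

Lemma wmx_rev s : wmx s *m wmx (rev s) = 1%:M.
Proof.
elim: s => [|j s IH]; first by rewrite /wmx !big_nil mulmx1.
rewrite wmx_cons rev_cons -cats1 wmx_cat mulmxA -(mulmxA (simple_refl j)) IH.
by rewrite mulmx1 wmx_cons /wmx big_nil mulmx1 reflK.
Qed.

Lemma wmx_vec s k : wmx s *m vec k = vec (wd (rev s) k).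
Proof.
elim: s k => [|j s IH] k; first by rewrite /wmx big_nil mul1mx.
by rewrite wmx_cons -mulmxA IH refl_vec rev_cons -cats1 wd_cat.
Qed.

(** Descent on the height; [m] is 8 for E_8 and 7 for E_7. *)
Lemma reach_word (L : seq (seq int)) m : (m <= 8)%N -> {subset L <= posl} ->
  all (fun k => (k \in [seq simp j | j <- iota 0 m]) ||
    has (fun j => (sr j k \in L) && (ht (sr j k) < ht k)) (iota 0 m)) L ->
  forall k, k \in L -> exists (s : seq 'I_8) (j : 'I_8),
    [/\ forall i, i \in s -> (i < m)%N, (j < m)%N & k = wd s (simp j)].
Proof.
move=> m8 Lp /allP HL k kL; have [n] := ubnP `|ht k|%N; elim: n k kL => // n IH k kL hk.
have /orP[/mapP[j]|/hasP[j]] := HL _ kL; rewrite mem_iota /= => jm.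
  by move=> ->; exists [::], (Ordinal (leq_trans jm m8)).
move=> /andP[kL' hlt]; have /andP[_ h0] := allP posl_pos _ (Lp _ kL').
have [s [i [sm im e]]] : exists (s : seq 'I_8) (i : 'I_8),
    [/\ forall i, i \in s -> (i < m)%N, (i < m)%N & sr j k = wd s (simp i)].
  apply: IH => //; rewrite -ltnS; apply: leq_trans hk; rewrite ltnS.
  by move: h0 hlt; case: (ht (sr j k)) => // a _; case: (ht k).
pose j' := Ordinal (leq_trans jm m8); exists (s ++ [:: j']), i; split=> //.
  by move=> l; rewrite mem_cat inE => /orP[/sm//|/eqP ->].
by rewrite wd_cat -e /= (srK j') //; apply/size_rootl/posl_root/Lp.
Qed.

Lemma root_word k : k \in rootl -> exists s (j : 'I_8), k = wd s (simp j).
Proof.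
have key k' : k' \in posl -> exists s (j : 'I_8), k' = wd s (simp j).
  by move=> /(reach_word _ _ posl_reach)[]// s [j [_ _ ->]]; exists s, j.
rewrite mem_rootl => /orP[/key//|/mapP[k' /key[s [j ->]] ->]].
exists (j :: s), j; rewrite /= sr_simp wd_opp//; exact: size_simp.
Qed.

Lemma E8_rootsP a : E8_roots a <-> exists2 k, k \in rootl & a = vec k.
Proof.
split=> [[w [j [[s _ ->] ->]]]|[k /root_word[s [j ->]] ->]].
  exists (wd (rev s) (simp j)); first exact/wd_root/posl_root/simp_pos.
  by rewrite -vec_simp -wmx_vec.
exists (wmx (rev s)), j; split; first by exists (rev s) => // i; rewrite inE.
by rewrite -vec_simp wmx_vec revK.
Qed.

Lemma vec_coef (k : seq int) (c : 'I_8 -> int) : vec k = \sum_j simple_root j *~ c j ->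
  forall j : 'I_8, k`_j = c j.
Proof.
pose k' := [seq c (inord i) | i <- iota 0 8].
have k'E (j : 'I_8) : k'`_j = c j.
  by rewrite (nth_map 0%N) ?size_iota// nth_iota//= inord_val.
have -> : \sum_j simple_root j *~ c j = vec k'.
  by rewrite vec_sum; apply: eq_bigr => j _; rewrite k'E.
move=> e j; rewrite -k'E.
suff /matrixP/(_ j 0) : colk k = colk k' by rewrite !mxE.
by rewrite -[colk k]mul1mx -[colk k']mul1mx -CI_cartan -!mulmxA -/(vec k) e.
Qed.

Lemma posP k : k \in rootl -> (k \in posl) = (0 < ht k).
Proof.
move=> kr; apply/idP/idP => [kp|h0].
  by have /andP[_] := allP posl_pos _ kp.
move: kr; rewrite mem_rootl => /orP[//|/mapP[k' kp e]].
have /andP[_ h1] := allP posl_pos _ kp.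
by move: h0; rewrite e ht_opp oppr_gt0 ltNge (ltW h1).
Qed.

Lemma E8_posE : E8_pos_roots = [set` [seq vec k | k <- posl]].
Proof.
apply/seteqP; split=> a /=.
  move=> [/E8_rootsP[k kr ->] [c]].
  have -> : \sum_j simple_root j *+ c j = \sum_j simple_root j *~ (c j)%:Z by [].
  move=> /vec_coef kc; apply/mapP; exists k => //.
  have h0 : 0 <= ht k by rewrite /ht sum8E; apply: sumr_ge0 => j _; rewrite kc.
  rewrite posP// lt_neqAle h0 andbT; apply/eqP => e.
  move: kr; rewrite mem_rootl => /orP[kp|/mapP[k' kp ek]].
    by have /andP[_] := allP posl_pos _ kp; rewrite -e ltxx.
  by have /andP[_] := allP posl_pos _ kp; rewrite -[k']oppkK -ek ht_opp -e oppr0 ltxx.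
move=> /mapP[k kp ->]; split; first by apply/E8_rootsP; exists k => //; exact: posl_root.
have /andP[/allP k0 _] := allP posl_pos _ kp.
have sk := size_rootl (posl_root kp).
exists (fun j : 'I_8 => absz (nth 0 k j)); rewrite vec_sum; apply: eq_bigr => j _.
have : 0 <= k`_j by apply: k0; rewrite mem_nth// sk.
by case: (k`_j).
Qed.

Definition posl7 : seq (seq int) := [seq k <- posl | k`_7 == 0].

Lemma E7_posE : E7_roots `&` E8_pos_roots = [set` [seq vec k | k <- posl7]].
Proof.
rewrite E8_posE; apply/seteqP; split=> a /=.
  move=> [[_ [c [c0 e]]] /mapP[k kp ea]]; apply/mapP; exists k => //.
  rewrite mem_filter kp andbT; apply/eqP.
  by rewrite ea in e; have := vec_coef e ord_max; rewrite c0.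
move=> /mapP[k]; rewrite mem_filter => /andP[/eqP k7 kp] ->; split.
  split; first by apply/E8_rootsP; exists k => //; exact: posl_root.
  by exists (fun j : 'I_8 => k`_j); split => //; rewrite -vec_sum.
by apply/mapP; exists k.
Qed.

Lemma uniq_posl : uniq posl.
Proof. by have := uniq_rootl; rewrite /rootl cat_uniq => /andP[]. Qed.

Lemma uniq_vec (l : seq (seq int)) : {subset l <= rootl} -> uniq l ->
  uniq [seq vec k | k <- l].
Proof.
move=> lr ul; rewrite map_inj_in_uniq// => k k' /lr/size_rootl sk /lr/size_rootl sk'.
exact: vec_inj.
Qed.

Lemma weyl_sub J : weyl J `<=` W_E8.
Proof. by move=> w [s _ ->]; exists s => // i; rewrite inE. Qed.

(** An element of the group is determined by the images of the simple roots, which are among the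
    240 roots. *)
Lemma finite_W : finite_set W_E8.
Proof.
pose F (f : {ffun 'I_8 -> 'I_240}) : 'M[int]_8 :=
  (\matrix_(i, j) vec (nth [::] rootl (f j)) i 0) *m CI.
apply: (@sub_finite_set _ _ (F @` [set: {ffun 'I_8 -> 'I_240}])); last first.
  apply: finite_image; exact: finite_finset.
move=> w [s _ ->].
have sz : size rootl = 240%N by rewrite /rootl posl.unlock; vm_compute.
have ir (j : 'I_8) : (index (wd (rev s) (simp j)) rootl < 240)%N.
  by rewrite -sz index_mem; apply/wd_root/posl_root/simp_pos.
exists [ffun j => Ordinal (ir j)] => //.
rewrite /F -[RHS]mulmx1 -cartan_CI mulmxA; congr (_ *m _).
apply/matrixP => i j; rewrite [LHS]mxE ffunE /= nth_index.
  rewrite -wmx_vec vec_simp.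
  by rewrite [LHS]mxE [RHS]mxE; apply: eq_bigr => l _; rewrite [simple_root _ _ _]mxE.
exact/wd_root/posl_root/simp_pos.
Qed.

Lemma weyl_mul J w w' : weyl J w -> weyl J w' -> weyl J (w *m w').
Proof.
move=> [s sJ ->] [t tJ ->]; exists (s ++ t).
  by move=> i; rewrite mem_cat => /orP[/sJ|/tJ].
by rewrite big_cat.
Qed.

Lemma weyl_refl (J : {set 'I_8}) (j : 'I_8) : j \in J -> weyl J (simple_refl j).
Proof.
move=> jJ; exists [:: j]; first by move=> i; rewrite inE => /eqP ->.
by rewrite big_seq1.
Qed.

Lemma reindex_weyl (A : zmodType) (J : {set 'I_8}) (j : 'I_8) (F : 'M[int]_8 -> A) : j \in J ->
  \sum_(w \in weyl J) F (w *m simple_refl j) = \sum_(w \in weyl J) F w.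
Proof.
move=> jJ; rewrite [RHS](@reindex_fsbig _ _ _ _ _ (fun w => w *m simple_refl j) (weyl J) (weyl J))//.
split.
- by move=> w Jw; apply: weyl_mul => //; exact: weyl_refl.
- by move=> w w' _ _ e; rewrite -[w]mulmx1 -[w']mulmx1 -(reflK j) !mulmxA e.
- move=> w Jw; exists (w *m simple_refl j).
    by apply: weyl_mul => //; exact: weyl_refl.
  by rewrite -mulmxA reflK mulmx1.
Qed.

Definition uvec (s : seq 'I_8) : 'cV[rat]_8 := act (wmx (rev s)) (const_mx 1).

(** The rational form of a positive system: [k] is positive for the word [s] if and only if this is
    positive, by [hwP]. Being linear in [k], it shows that a sum of positive roots which is a root
    is positive. *)
Definition hw (s : seq 'I_8) (k : seq int) : rat := ev k (uvec s).

Lemma hw_wd s k : hw s (wd s k) = (ht k)%:~R.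
Proof. by rewrite /hw -ev_word /uvec -actM wmx_rev act1 ev_one. Qed.

Lemma hwP s k : k \in rootl -> (wd (rev s) k \in posl) = (0 < hw s k).
Proof.
move=> kr; have kr' := wd_root (rev s) kr.
by rewrite -{2}(wdKr s (size_rootl kr)) hw_wd posP// ltr0z.
Qed.

Lemma hw_neq0 s k : k \in rootl -> hw s k != 0.
Proof.
move=> kr; have kr' := wd_root (rev s) kr.
rewrite -(wdKr s (size_rootl kr)) hw_wd intr_eq0.
move: kr'; rewrite mem_rootl => /orP[kp|/mapP[k' kp ->]].
  by have /andP[_ h] := allP posl_pos _ kp; rewrite gt_eqF.
have /andP[_ h] := allP posl_pos _ kp.
by rewrite ht_opp oppr_eq0 gt_eqF.
Qed.

Lemma pos_perm s : perm_eq [seq wd s k | k <- posl] [seq k <- rootl | 0 < hw s k].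
Proof.
apply: uniq_perm.
- rewrite map_inj_in_uniq ?uniq_posl// => k k' /posl_root kr /posl_root kr'.
  exact: wd_inj.
- exact/filter_uniq/uniq_rootl.
move=> x; rewrite mem_filter; apply/mapP/andP => [[k kp ->]|[h xr]].
  have kr := posl_root kp; split; last exact: wd_root.
  by rewrite -hwP ?wd_root// wdK ?size_rootl.
exists (wd (rev s) x); first by rewrite hwP.
by rewrite wdKr ?size_rootl.
Qed.

Lemma nth_wd_E7 s k : size k = 8%N -> {subset s <= (~: [set ord_max])%SET} ->
  (wd s k)`_7 = k`_7.
Proof.
elim: s k => //= j s IH k sk sJ; rewrite IH ?size_sr//; last first.
  by move=> i si; apply: sJ; rewrite inE si orbT.
rewrite nth_sr//; have : j \in (~: [set ord_max])%SET by apply: sJ; rewrite inE eqxx.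
by rewrite !inE -(inj_eq val_inj) /= eq_sym => /negbTE ->.
Qed.

Definition o6 : 'I_8 := inord 6.
Definition o7 : 'I_8 := inord 7.

(** The image of the root [x] under d: its value at v is that of [x] at the image of v under the
    inverse of d. *)
Definition d_root (x : seq int) : seq int := wd [:: o6; o7] x.

Lemma dmxE : d_mx = wmx [:: o7; o6].
Proof. by rewrite /d_mx !wmx_cons /wmx big_nil mulmx1. Qed.

Lemma rev_E7 (s : seq 'I_8) : {subset s <= (~: [set ord_max])%SET} ->
  {subset rev s <= (~: [set ord_max])%SET}.
Proof. by move=> sJ i; rewrite mem_rev; exact: sJ. Qed.

(** The positive roots of R' pulled back by an element of W' d: the condition on [d_root] says that
    d maps the root into R', and does not depend on [s]. *)
Lemma pos_perm7 s : {subset s <= (~: [set ord_max])%SET} ->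
  perm_eq [seq wd (s ++ [:: o7; o6]) k | k <- posl7]
   [seq x <- rootl | ((d_root x)`_7 == 0) && (0 < hw (s ++ [:: o7; o6]) x)].
Proof.
move=> sJ; set t := s ++ _.
have d7 k : k \in rootl -> (d_root (wd t k))`_7 = k`_7.
  move=> kr; have sk := size_rootl kr.
  rewrite /t wd_cat /d_root (wdK [:: o7; o6]) ?size_wd//.
  by rewrite nth_wd_E7.
have sub k : k \in posl7 -> k \in posl by rewrite mem_filter => /andP[].
apply: uniq_perm.
- rewrite map_inj_in_uniq ?filter_uniq ?uniq_posl// => k k'.
  by move=> /sub/posl_root kr /sub/posl_root kr'; exact: wd_inj.
- exact/filter_uniq/uniq_rootl.
move=> x; rewrite mem_filter; apply/mapP/andP => [[k]|[/andP[x7 h] xr]].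
  rewrite mem_filter => /andP[k7 kp] ->.
  have kr := posl_root kp; split; last exact: wd_root.
  by rewrite d7// k7 -hwP ?wd_root// wdK ?size_rootl.
exists (wd (rev t) x); last by rewrite wdKr ?size_rootl.
rewrite mem_filter hwP// h andbT.
by rewrite -d7 ?wd_root// wdKr ?size_rootl.
Qed.

(** Elements of W' do not change the last coefficient, so a root that d makes positive outside R'
    stays positive. *)
Lemma out_pos s x : {subset s <= (~: [set ord_max])%SET} ->
  x \in rootl -> 0 < (d_root x)`_7 -> 0 < hw (s ++ [:: o7; o6]) x.
Proof.
move=> sJ xr x7; rewrite -hwP// rev_cat wd_cat -/(d_root x).
set z := wd _ _; have zr : z \in rootl by apply/wd_root/wd_root.
have z7 : z`_7 = (d_root x)`_7.
  by rewrite nth_wd_E7// ?size_wd ?size_rootl//; exact: rev_E7.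
move: zr; rewrite mem_rootl => /orP[//|/mapP[k kp ez]].
have /andP[/allP k0 _] := allP posl_pos _ kp.
have : 0 <= k`_7 by apply: k0; rewrite mem_nth// (size_rootl (posl_root kp)).
by move: x7; rewrite -z7 ez nth_oppk oppr_gt0 ltNge => /negP.
Qed.

(** * Parabolic subgroups, and the Weyl group acting on the tube *)

Definition Jall : {set 'I_8} := [set: 'I_8]%SET.
Definition J7 : {set 'I_8} := (~: [set ord_max])%SET.

Lemma sr_posl7 : all (fun j => perm_eq [seq sr j k | k <- posl7]
  (oppk (simp j) :: rem (simp j) posl7)) (iota 0 7).
Proof. by rewrite /posl7 posl.unlock; vm_compute. Qed.

Lemma simp_posl7 : all (fun j => simp j \in posl7) (iota 0 7).
Proof. by rewrite /posl7 posl.unlock; vm_compute. Qed.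

Lemma posl7_reach : all (fun k => (k \in [seq simp j | j <- iota 0 7]) ||
   has (fun j => (sr j k \in posl7) && (ht (sr j k) < ht k)) (iota 0 7)) posl7.
Proof. by rewrite /posl7 posl.unlock; vm_compute. Qed.

(** A parabolic subgroup, with the properties of its positive roots that make alternating sums
    divisible by them. *)
Record parab (J : {set 'I_8}) (L : seq (seq int)) : Prop := Parab {
  parab_sub : {subset L <= posl};
  parab_uniq : uniq L;
  parab_simp : forall j, j \in J -> simp j \in L;
  parab_perm : forall j, j \in J ->
    perm_eq [seq sr j k | k <- L] (oppk (simp j) :: rem (simp j) L);
  parab_word : forall k, k \in L -> exists s j,
    [/\ {subset s <= J}, j \in J & k = wd s (simp j)] }.

Lemma parab_all : parab Jall posl.
Proof.
split=> //.
- exact: uniq_posl.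
- by move=> j _; exact: simp_pos.
- by move=> j _; exact: all8P sr_posl j.
by move=> k /posl_root/root_word[s [j ->]]; exists s, j; split => // [i _|]; rewrite inE.
Qed.

Lemma J7P (j : 'I_8) : (j \in J7) = (j < 7)%N.
Proof. by rewrite !inE -(inj_eq val_inj) /= ltn_neqAle -ltnS ltn_ord andbT. Qed.

Lemma posl7_sub : {subset posl7 <= posl}.
Proof. by move=> k; rewrite mem_filter => /andP[]. Qed.

Lemma parab_E7 : parab J7 posl7.
Proof.
split.
- exact: posl7_sub.
- exact/filter_uniq/uniq_posl.
- by move=> j; rewrite J7P => j7; apply: (allP simp_posl7); rewrite mem_iota.
- by move=> j; rewrite J7P => j7; apply: (allP sr_posl7); rewrite mem_iota.
move=> k kL; have [|s [j [sJ jJ ->]]] := @reach_word posl7 7 isT posl7_sub _ k kL.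
  exact: posl7_reach.
by exists s, j; split; rewrite ?J7P// => i /sJ; rewrite J7P.
Qed.

Section Tube.
Variable R : realType.
Local Notation C := (cplx R).
Local Notation VC := ('cV[cplx R]_8).

Lemma bformC (K : numFieldType) (u v : 'cV[K]_8) : bform u v = bform v u.
Proof.
have E (x y : 'cV[K]_8) : bform x y = \sum_i \sum_j (x i 0 * (CI i j)%:~R * y j 0).
  rewrite /bform cartan_inv mxE exchange_big /=; apply: eq_bigr => j _.
  rewrite mxE mulr_suml; apply: eq_bigr => i _.
  by rewrite mxE [of_int_mx _ _ _ _]mxE.
have sym : all (fun i => all (fun j => ci i j == ci j i) (iota 0 8)) (iota 0 8) by vm_compute.
rewrite !E exchange_big; apply: eq_bigr => i _; apply: eq_bigr => j _.
have /eqP e := all8P (all8P sym i) j; rewrite !mxE e; ring.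
Qed.

Lemma bformBl (K : numFieldType) (u u' v : 'cV[K]_8) :
  bform (u - u') v = bform u v - bform u' v.
Proof. by rewrite /bform linearB /= !mulmxBl mxE [X in _ + X]mxE. Qed.

Lemma bformZl (K : numFieldType) a (u v : 'cV[K]_8) : bform (a *: u) v = a * bform u v.
Proof. by rewrite /bform linearZ /= -!scalemxAl mxE. Qed.

Lemma bformBr (K : numFieldType) (u u' v : 'cV[K]_8) :
  bform v (u - u') = bform v u - bform v u'.
Proof. by rewrite bformC bformBl !(bformC _ v). Qed.

Lemma bformZr (K : numFieldType) a (u v : 'cV[K]_8) : bform v (a *: u) = a * bform v u.
Proof. by rewrite bformC bformZl (bformC u). Qed.

Lemma bform_refl (K : numFieldType) (j : 'I_8) (v : 'cV[K]_8) :
  bform (act (simple_refl j) v) (act (simple_refl j) v) = bform v v.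
Proof.
have rj : simp j \in rootl by exact/posl_root/simp_pos.
rewrite act_refl -vec_simp !(bformBl, bformBr, bformZl, bformZr).
rewrite (bformC v) !bform_vec norm_root// ev_simp.
by ring.
Qed.

Lemma bform_word (K : numFieldType) s (v : 'cV[K]_8) :
  bform (act (wmx s) v) (act (wmx s) v) = bform v v.
Proof.
elim: s => [|j s IH]; first by rewrite /wmx big_nil act1.
by rewrite wmx_cons actM bform_refl IH.
Qed.

Lemma Re_act (w : 'M[int]_8) (z : VC) : Re_vec (act w z) = act w (Re_vec z).
Proof.
apply/matrixP => i j; rewrite mxE [act w z i j]mxE [RHS]mxE.
have ReS (F : 'I_8 -> C) : complex.Re (\sum_l F l) = \sum_l complex.Re (F l).
  by apply: (big_morph (@complex.Re R) (@ReD R)).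
rewrite ReS; apply: eq_bigr => l _; rewrite !mxE.
have -> : ((w i l)%:~R : C) = (((w i l)%:~R : R)%:C)%C by rewrite rmorph_int.
by case: (z l j) => a b /=; rewrite mul0r subr0.
Qed.

Lemma Re_opp (z : VC) : Re_vec (- z) = - Re_vec z.
Proof. by apply/matrixP => i j; rewrite !mxE ReN. Qed.

(** The Euclidean norm is W-invariant. *)
Lemma tube_word (rad : R) s z : tube rad (act (wmx s) z) <-> tube rad z.
Proof. by rewrite /tube /= /enorm Re_act bform_word. Qed.

Lemma tube_opp (rad : R) z : tube rad (- z) <-> tube rad z.
Proof.
rewrite /tube /= /enorm Re_opp -scaleN1r bformZl bformZr.
by rewrite mulrA mulrNN !mul1r.
Qed.

Lemma df_coord (i : 'I_8) (z : VC) : differentiable (fun z : VC => z i 0 : C) z.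
Proof. exact: differentiable_coord. Qed.

Lemma cvg_quadratic (T : Type) (F : set_system T) (FF : Filter F)
    (x : 'I_8 -> T -> R) (l : 'I_8 -> R) (c : 'I_8 -> 'I_8 -> R) :
  (forall i, x i @ F --> l i) ->
  (fun w => \sum_i \sum_j (x i w * c i j * x j w)) @ F -->
    \sum_i \sum_j (l i * c i j * l j).
Proof.
move=> cq.
apply: cvg_big => [|i _]; first exact: add_continuous.
apply: cvg_big => [|j _]; first exact: add_continuous.
by apply: cvgM; [apply: cvgM; [exact: cq|exact: cvg_cst]|exact: cq].
Qed.

Lemma tube_open (rad : R) (z : VC) : 0 < rad -> tube rad z ->
  \forall w \near z, tube rad w.
Proof.
move=> r0 zt.
pose q (w : VC) : R := \sum_i \sum_j
  (complex.Re (w i 0) * (CI i j)%:~R * complex.Re (w j 0)).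
have tq w : tube rad w <-> q w < rad ^+ 2.
  have -> : q w = bform (Re_vec w) (Re_vec w).
    rewrite /q /bform cartan_inv mxE exchange_big; apply: eq_bigr => j _ /=.
    rewrite mxE mulr_suml; apply: eq_bigr => i _.
    by rewrite !mxE.
  have rr : rad = Num.sqrt (rad ^+ 2) by rewrite sqrtr_sqr gtr0_norm.
  by rewrite /tube /= /enorm {1}rr ltr_sqrt ?exprn_gt0.
have cq (i : 'I_8) : (fun w : VC => complex.Re (w i 0)) @ z --> complex.Re (z i 0).
  apply/(@cvgrPdist_lt _ _ _ (nbhs z)) => e e0; have [d d0 Hd] := diff_near (df_coord i z) e0.
  apply/(@nearP R ('cV[cplx R]_8 : normedModType (cplx R)) z); exists d => // w /Hd h; rewrite distrC.
  exact: le_lt_trans (Re_lip _ _) h.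
have cqq : q @ z --> q z by 
  exact: (@cvg_quadratic VC (nbhs z) (@nbhs_filter _ z) (fun i w => complex.Re (w i 0))
    _ (fun i j => (CI i j)%:~R) cq).
have /tq qz := zt.
have : \forall w \near z, q w < rad ^+ 2.
  exact: (@cvgr_lt _ _ (nbhs z) (@nbhs_filter _ z) q (q z) cqq).
apply: (@filterS _ (nbhs z) (@nbhs_filter _ z)) => w; exact: (proj2 (tq w)).
Qed.

Lemma df_ev (k : seq int) (z : VC) : differentiable (fun z : VC => ev k z : C) z.
Proof.
rewrite /ev; apply: df_sum => j; apply: dfM; [exact: dfc|exact: df_coord].
Qed.

Lemma df_refl (j : 'I_8) (z : VC) : differentiable (fun z : VC => act (simple_refl j) z) z.
Proof.
rewrite (_ : (fun z : VC => _) =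
  (fun z : VC => z - z j 0 *: of_int_mx C (simple_root j))); last first.
  by apply/funext => w; rewrite act_refl.
apply: (@differentiableB _ _ _ id (fun z : VC => z j 0 *: of_int_mx C (simple_root j))).
  exact: ex_diff.
apply: (@differentiableZl _ _ _ (fun z : VC => z j 0 : C) (of_int_mx C (simple_root j))).
exact: df_coord.
Qed.

Lemma df_word s (z : VC) : differentiable (fun z : VC => act (wmx s) z) z.
Proof.
elim: s z => [|j s IH] z.
  under eq_fun do rewrite /wmx big_nil act1; exact: ex_diff.
under eq_fun do rewrite wmx_cons actM.
apply: (@differentiable_comp _ _ _ _ (fun z : VC => act (wmx s) z)
  (fun z : VC => act (simple_refl j) z)); first exact: IH.
exact: df_refl.
Qed.

Lemma df_actw s (f : VC -> C) z : differentiable f (act (wmx s) z) ->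
  differentiable (fun z => f (act (wmx s) z)) z.
Proof. exact: (@df_comp R VC VC (fun z : VC => act (wmx s) z) f z (df_word s z)). Qed.

Lemma df_oppv (f : VC -> C) (z : VC) : differentiable f (- z) ->
  differentiable (fun z => f (- z)) z.
Proof.
have dn : differentiable (fun z : VC => - z) z.
  by apply: (@differentiableN _ _ _ id); exact: ex_diff.
exact: (@df_comp R VC VC (fun z : VC => - z) f z dn).
Qed.

End Tube.

Lemma ev_delta (K : numFieldType) k (i : 'I_8) : ev k (delta_mx i 0 : 'cV[K]_8) = (k`_i)%:~R.
Proof.
rewrite /ev (bigD1 i)//= mxE !eqxx mulr1 big1 ?addr0// => j ji.
by rewrite mxE (negbTE ji) mulr0.
Qed.

Lemma pos_indep (K : numFieldType) k k' : k \in posl -> k' \in posl -> k != k' ->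
  exists v : 'cV[K]_8, ev k' v = 0 /\ ev k v != 0.
Proof.
move=> kp kp' /negbTE kk; have := allP (allP posl_indep _ kp) _ kp'.
rewrite kk => /hasP[i + /hasP[j]]; rewrite !mem_iota /= => i8 j8 hij.
exists ((k'`_j)%:~R *: delta_mx (Ordinal i8) 0 - (k'`_i)%:~R *: delta_mx (Ordinal j8) 0).
rewrite !evD !evN !evZ !ev_delta mulrC subrr; split => //.
rewrite subr_eq0 -!rmorphM eqr_int; apply: contraNneq hij => h.
by rewrite mulrC h mulrC.
Qed.

(** * Alternating sums and their division by the positive roots *)

Section Antisymmetric.
Variable R : realType.
Local Notation C := (cplx R).
Local Notation VC := ('cV[cplx R]_8).

(** Each factor has at most one zero in t. *)
Lemma avoid (T : eqType) (L : seq T) (a b : T -> C) : (forall k, k \in L -> b k != 0) ->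
  exists2 r : R, 0 < r & forall t : C, 0 < nrm t < r -> forall k, k \in L -> a k + t * b k != 0.
Proof.
elim: L => [|k L IH] H; first by exists 1.
have [r r0 Hr] := IH (fun k' k'L => H k' (mem_behead (s := k :: L) k'L)).
have bk : b k != 0 by apply: H; rewrite inE eqxx.
pose d : R := if a k == 0 then 1 else nrm (a k) / nrm (b k).
have d0 : 0 < d.
  by rewrite /d; case: eqP => // /eqP ak; rewrite divr_gt0// nrm_gt0.
exists (Num.min r d); first by rewrite lt_min r0.
move=> t; rewrite lt_min => /andP[t0 /andP[tr td]] k'; rewrite inE => /predU1P[->|k'L].
  move: td; rewrite /d; case: eqP => [-> _|/eqP ak].
    rewrite add0r mulf_neq0//; apply: contraTneq t0 => ->; rewrite nrm0 ltxx//.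
  rewrite ltr_pdivlMr ?nrm_gt0// -nrmM => h.
  apply: contraTneq h => /eqP; rewrite addr_eq0 => /eqP ->.
  by rewrite nrmN ltxx.
by apply: Hr => //; rewrite t0.
Qed.

Lemma exists_small (r : R) : 0 < r -> exists t : C, 0 < nrm t < r.
Proof.
move=> r0; exists ((r / 2)%:C)%C; rewrite nrm_real gtr0_norm ?divr_gt0//.
by rewrite ltr_pdivrMr// mulr_natr mulr2n ltrDl.
Qed.

Section Dense.
Variable V : normedModType C.

(** Continuity at z, along a line on which f vanishes near z. *)
Lemma zero_by_density (f : V -> C) (z v : V) : differentiable f z ->
  (exists2 r : R, 0 < r & forall t : C, 0 < nrm t < r -> f (z + t *: v) = 0) -> f z = 0.
Proof.
move=> df [r r0 Hr]; apply: contrapT => /eqP fz.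
have [d d0 Hd] := diff_near df (nrm_gt0 fz).
have v1 : 0 < nrm v + 1 by rewrite ltr_wpDl ?nrm_ge0.
have [t] : exists t : C, 0 < nrm t < Num.min r (d / (nrm v + 1)).
  by apply: exists_small; rewrite lt_min r0 divr_gt0.
rewrite lt_min => /andP[t0 /andP[tr td]].
have : nrm (z + t *: v - z) < d.
  rewrite addrAC subrr add0r nrmZ; move: td; rewrite ltr_pdivlMr//.
  by apply: le_lt_trans; apply: ler_wpM2l; rewrite ?nrm_ge0// lerDl.
by move=> /Hd; rewrite Hr ?t0// sub0r nrmN ltxx.
Qed.

Definition open_dom (U : V -> Prop) := forall z, U z ->
  exists2 r : R, 0 < r & forall w, nrm (w - z) < r -> U w.

Lemma open_line (U : V -> Prop) (z v : V) : open_dom U -> U z ->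
  exists2 r : R, 0 < r & forall t : C, nrm t < r -> U (z + t *: v).
Proof.
move=> oU /oU[d d0 Hd]; have v1 : 0 < nrm v + 1 by rewrite ltr_wpDl ?nrm_ge0.
exists (d / (nrm v + 1)); first by rewrite divr_gt0.
move=> t; rewrite ltr_pdivlMr// => td; apply: Hd.
rewrite addrAC subrr add0r nrmZ; apply: le_lt_trans td.
by apply: ler_wpM2l; rewrite ?nrm_ge0// lerDl.
Qed.

End Dense.

Lemma df_in_sum (T : eqType) (s : seq T) (F : T -> VC -> C) z :
  (forall i, i \in s -> differentiable (F i) z) ->
  differentiable (fun z => \sum_(i <- s) F i z) z.
Proof.
elim: s => [|i s IH] H.
  by under eq_fun do rewrite big_nil; exact: dfc.
under eq_fun do rewrite big_cons.
apply: dfD; first by apply: H; rewrite inE eqxx.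
by apply: IH => j js; apply: H; rewrite inE js orbT.
Qed.

Lemma ev_line k (z v : VC) (t : C) : ev k (z + t *: v) = ev k z + t * ev k v.
Proof. by rewrite evD evZ. Qed.

(** Divide by one root after the other. The quotient vanishes on the mirrors of the remaining roots
    because distinct positive roots are not proportional: their common zeros are nowhere dense in
    each mirror. *)
Lemma div_list (U : VC -> Prop) (L : seq (seq int)) (N : VC -> C) :
  open_dom U -> {subset L <= posl} -> uniq L ->
  (forall z, U z -> differentiable N z) ->
  (forall k z, k \in L -> U z -> ev k z = 0 -> N z = 0) ->
  exists2 A : VC -> C, (forall z, U z -> differentiable A z) &
    forall z, U z -> N z = \prod_(k <- L) ev k z * A z.
Proof.
move=> oU; elim: L N => [|k L IH] N Lp uL dN N0.
  by exists N => // z _; rewrite big_nil mul1r.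
have kp : k \in posl by apply: Lp; rewrite inE eqxx.
have kr := posl_root kp.
(* Roots have square length 2, so [ev k] has slope 1 in this direction. *)
pose e : VC := 2^-1 *: of_int_mx C (vec k).
have eke : ev k e = 1 by rewrite /e evZ norm_root// mulVf// pnatr_eq0.
have lE z (xi : C) : ev k (z + xi *: e) = ev k z + xi by rewrite ev_line eke mulr1.
pose q := quo (fun z : VC => ev k z : C) e N.
have dq z : U z -> differentiable q z.
  move=> Uz; apply: (@quo_diff R VC _ e (df_ev k) lE).
  have [d d0 Hd] := oU z Uz; apply/(@nearP R ('cV[cplx R]_8 : normedModType C)).
  exists d => // w /Hd Uw; split; first exact: dN.
  by apply: N0 => //; rewrite inE eqxx.
have Nq z : U z -> N z = ev k z * q z.
  by move=> Uz; apply: quoM => h; apply: (N0 k) => //; rewrite inE eqxx.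
move: uL => /= /andP[kL uL].
have Lp' : {subset L <= posl} by move=> k' k'L; apply: Lp; rewrite inE k'L orbT.
have q0 k' z : k' \in L -> U z -> ev k' z = 0 -> q z = 0.
  move=> k'L Uz k'z.
  have kk' : k != k' by apply: contraNneq kL => ->.
  have [v [v1 v2]] := pos_indep C kp (Lp' _ k'L) kk'.
  apply: (@zero_by_density _ _ _ v (dq _ Uz)).
  have [r r0 Hr] := open_line v oU Uz.
  have vn : forall k0, k0 \in [:: k] -> ev k0 v != 0 by move=> i; rewrite inE => /eqP ->.
  have [r' r'0 Hr'] := avoid (fun k0 => ev k0 z) vn.
  exists (Num.min r r'); first by rewrite lt_min r0.
  move=> t; rewrite lt_min => /andP[t0 /andP[tr tr']].
  have Uz' := Hr _ tr.
  have kz' : ev k (z + t *: v) != 0.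
    by rewrite ev_line; apply: Hr'; rewrite ?t0// inE eqxx.
  apply: (mulfI kz'); rewrite mulr0 -Nq//; apply: (N0 k') => //.
    by rewrite inE k'L orbT.
  by rewrite ev_line k'z v1 mulr0 addr0.
have [A dA HA] := IH q Lp' uL dq q0.
by exists A => // z Uz; rewrite big_cons -mulrA -HA//; exact: Nq.
Qed.

Section Parabolic.
Variables (J : {set 'I_8}) (L : seq (seq int)).
Hypothesis HP : parab J L.

Definition pl (z : VC) : C := \prod_(k <- L) ev k z.

Lemma pl_refl (j : 'I_8) z : j \in J -> pl (act (simple_refl j) z) = - pl z.
Proof.
move=> jJ; rewrite /pl; under eq_bigr do rewrite ev_refl.
rewrite -(big_map (sr j) xpredT (fun k => ev k z)) (perm_big _ (parab_perm HP jJ)).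
rewrite big_cons ev_opp [LHS]mulNr; congr (- _).
by rewrite [RHS](perm_big _ (perm_to_rem (parab_simp HP jJ))) big_cons.
Qed.

Lemma pl_word s z : {subset s <= J} -> pl (act (wmx s) z) = (-1) ^+ size s * pl z.
Proof.
elim: s => [|j s IH] sJ; first by rewrite /wmx big_nil act1 mul1r.
rewrite wmx_cons actM pl_refl; last by apply: sJ; rewrite inE eqxx.
rewrite IH ?exprS ?mulN1r ?mulNr// => i si; apply: sJ; rewrite inE si orbT//.
Qed.

Definition onev : VC := const_mx 1.

Lemma ev_onev_neq0 k : k \in posl -> ev k onev != 0.
Proof.
move=> kp; have /andP[_ h] := allP posl_pos _ kp.
by rewrite ev_one intr_eq0 gt_eqF.
Qed.

Lemma pl_onev : pl onev != 0.
Proof.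
rewrite /pl prodf_seq_neq0; apply/allP => k /(parab_sub HP) kp /=.
exact: ev_onev_neq0.
Qed.

(** The sign character, as the effect on the product of the positive roots at a regular point; this
    makes it a function of the matrix, not of a word for it. *)
Definition sgnw (w : 'M[int]_8) : C := pl (act w onev) / pl onev.

Lemma sgnw_word s : {subset s <= J} -> sgnw (wmx s) = (-1) ^+ size s.
Proof. by move=> sJ; rewrite /sgnw pl_word// mulfK// pl_onev. Qed.

Variable Psi : VC -> C.

Definition asum (z : VC) : C := \sum_(w \in weyl J) sgnw w * Psi (act w z).

Lemma asum_refl (j : 'I_8) z : j \in J -> asum (act (simple_refl j) z) = - asum z.
Proof.
move=> jJ; rewrite /asum -(reindex_weyl (fun w => sgnw w * Psi (act w z)) jJ).
have fW : finite_set (weyl J) by apply: sub_finite_set finite_W; exact: weyl_sub.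
rewrite !fsbig_finite//= -sumrN big_seq [RHS]big_seq; apply: eq_bigr => w.
rewrite in_fset_set// inE => -[s sJ ->].
rewrite -/(wmx s) actM; have -> : wmx s *m simple_refl j = wmx (s ++ [:: j]).
  by rewrite wmx_cat [wmx [:: j]]big_seq1.
rewrite !sgnw_word//; last first.
  by move=> i; rewrite mem_cat inE => /orP[/sJ//|/eqP ->].
by rewrite size_cat addn1 exprS mulN1r mulNr opprK.
Qed.

Lemma asum_word s z : {subset s <= J} -> asum (act (wmx s) z) = (-1) ^+ size s * asum z.
Proof.
elim: s => [|j s IH] sJ; first by rewrite /wmx big_nil act1 mul1r.
rewrite wmx_cons actM asum_refl; last by apply: sJ; rewrite inE eqxx.
rewrite IH ?exprS ?mulN1r ?mulNr// => i si; apply: sJ; rewrite inE si orbT//.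
Qed.

(** The reflection in the mirror fixes z and changes the sign of the sum. *)
Lemma asum_mirror k z : k \in L -> ev k z = 0 -> asum z = 0.
Proof.
move=> /(parab_word HP)[s [j [sJ jJ ->]]]; rewrite -ev_word ev_simp => h.
have := asum_refl (act (wmx s) z) jJ.
rewrite act_refl h scale0r subr0 asum_word// => /eqP.
rewrite -addr_eq0 -mulr2n -mulr_natl mulf_eq0 pnatr_eq0 /= mulf_eq0 expf_eq0.
by rewrite oppr_eq0 oner_eq0 andbF /= => /eqP.
Qed.

Lemma asum_diff z : (forall s, {subset s <= J} -> differentiable Psi (act (wmx s) z)) ->
  differentiable asum z.
Proof.
move=> dP.
have fW : finite_set (weyl J) by apply: sub_finite_set finite_W; exact: weyl_sub.
rewrite (_ : asum = fun z => \sum_(w <- finmap.enum_fset (fset_set (weyl J))) sgnw w * Psi (act w z)); last first.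
  by apply/funext => w; rewrite /asum fsbig_finite.
apply: df_in_sum => w; rewrite in_fset_set// inE => -[s sJ ->].
by apply: dfM; [exact: dfc|apply: df_actw; exact: dP].
Qed.

Lemma asum_quotient (U : VC -> Prop) : open_dom U ->
  (forall s z, {subset s <= J} -> U z -> differentiable Psi (act (wmx s) z)) ->
  exists2 A : VC -> C, (forall z, U z -> differentiable A z) &
    forall z, U z -> asum z = pl z * A z.
Proof.
move=> oU dP; apply: div_list => //.
- exact: parab_sub HP.
- exact: parab_uniq HP.
- by move=> z Uz; apply: asum_diff => s sJ; exact: dP.
- by move=> k z kL _; exact: asum_mirror.
Qed.

(** Numerator and denominator both change sign; the points with nonzero denominator are dense. *)
Lemma quotient_refl (U : VC -> Prop) (A : VC -> C) (j : 'I_8) z : open_dom U ->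
  j \in J -> (forall z, U z -> U (act (simple_refl j) z)) ->
  (forall z, U z -> differentiable A z) ->
  (forall z, U z -> asum z = pl z * A z) ->
  U z -> A (act (simple_refl j) z) = A z.
Proof.
move=> oU jJ sU dA HA Uz; apply/eqP; rewrite -subr_eq0; apply/eqP.
have d : differentiable (fun z => A (act (simple_refl j) z) - A z) z.
  have e w : act (simple_refl j) w = act (wmx [:: j]) w by rewrite /wmx big_seq1.
  apply: dfB; last exact: dA.
  under eq_fun do rewrite e.
  by apply: df_actw; rewrite -e; apply/dA/sU.
apply: (@zero_by_density _ _ _ onev d).
have [r r0 Hr] := open_line onev oU Uz.
have [r' r'0 Hr'] := @avoid _ L (fun k => ev k z) (fun k => ev k onev)
  (fun k kL => ev_onev_neq0 (parab_sub HP kL)).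
exists (Num.min r r'); first by rewrite lt_min r0.
move=> t; rewrite lt_min => /andP[t0 /andP[tr tr']].
set w := z + _; have Uw : U w by exact: Hr.
have pw : pl w != 0.
  rewrite /pl prodf_seq_neq0; apply/allP => k kL /=.
  by rewrite ev_line; apply: Hr'; rewrite ?t0.
apply/eqP; rewrite subr_eq0; apply/eqP/(mulfI pw).
by apply: oppr_inj; rewrite -mulNr -(pl_refl _ jJ) -HA ?asum_refl ?HA//; exact: sU.
Qed.

End Parabolic.
End Antisymmetric.

(** * The two sums as quotients of holomorphic functions *)

Section Diff.
Variable R : realType.
Local Notation C := (cplx R).
Variable V : normedModType C.
Implicit Types f g : V -> C.

Lemma dM_E f g p v : differentiable f p -> differentiable g p ->
  'd (fun z => f z * g z) p v = f p * 'd g p v + g p * 'd f p v.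
Proof.
move=> df dg.
have e1 := deriveE v (dfM df dg).
have e2 := deriveM (@diff_derivable _ _ _ f p v df) (@diff_derivable _ _ _ g p v dg).
apply: (etrans (esym e1)); apply: (etrans e2).
rewrite (deriveE v df) (deriveE v dg).
by [].
Qed.

Lemma dV_E f p v : differentiable f p -> f p != 0 ->
  'd (fun z => (f z)^-1) p v = - (f p) ^- 2 * 'd f p v.
Proof.
move=> df f0.
have e1 := deriveE v (dfV df f0).
have e2 := deriveV f0 (@diff_derivable _ _ _ f p v df).
apply: (etrans (esym e1)); apply: (etrans e2).
rewrite (deriveE v df).
by [].
Qed.

End Diff.

Section Sigma.
Variable R : realType.
Local Notation C := (cplx R).
Local Notation VC := ('cV[cplx R]_8).
Variable rho : C -> C.
Hypothesis rho_entire : forall s : C, differentiable rho s.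
Hypothesis rho_zeroes : forall s : C, rho s = 0 -> 0 < complex.Re s < 1.

Lemma rfunE z : rfun rho z = \prod_(k <- posl) rho (ev k z).
Proof.
rewrite /rfun E8_posE -fsbig_seq; last by apply: uniq_vec uniq_posl => k /posl_root.
by rewrite big_map big_seq [RHS]big_seq; apply: eq_bigr => k /posl_root kr; rewrite coroot_vec.
Qed.

Lemma cfunE z : cfun E8_pos_roots z = \prod_(k <- posl) ((ev k z + 1) / ev k z) :> C.
Proof.
rewrite /cfun E8_posE -fsbig_seq; last by apply: uniq_vec uniq_posl => k /posl_root.
by rewrite big_map big_seq [RHS]big_seq; apply: eq_bigr => k /posl_root kr; rewrite coroot_vec.
Qed.

Lemma cfun7E z : cfun (E7_roots `&` E8_pos_roots) z =
  \prod_(k <- posl7) ((ev k z + 1) / ev k z) :> C.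
Proof.
rewrite /cfun E7_posE -fsbig_seq; last first.
  by apply: uniq_vec (parab_uniq parab_E7) => k /posl7_sub/posl_root.
rewrite big_map big_seq [RHS]big_seq; apply: eq_bigr => k /posl7_sub/posl_root kr.
by rewrite coroot_vec.
Qed.

Definition rho_all (z : VC) : C := \prod_(k <- rootl) rho (ev k z).

Lemma prod_rootl (G : C -> C) z : \prod_(k <- rootl) G (ev k z) =
  \prod_(k <- posl) G (ev k z) * \prod_(k <- posl) G (- ev k z).
Proof.
rewrite /rootl big_cat big_map /=; congr (_ * _).
by apply: eq_bigr => k _; rewrite ev_opp.
Qed.

Lemma rho_all_word s z : rho_all (act (wmx s) z) = rho_all z.
Proof.
rewrite /rho_all; under eq_bigr do rewrite ev_word.
rewrite -(big_map (wd s) xpredT (fun k => rho (ev k z))); apply: perm_big.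
apply: uniq_perm; rewrite ?uniq_rootl//.
  by rewrite map_inj_in_uniq ?uniq_rootl// => k k'; exact: wd_inj.
move=> k; apply/mapP/idP => [[k' kr ->]|kr]; first exact: wd_root.
exists (wd (rev s) k); first exact: wd_root.
by rewrite wdKr ?size_rootl.
Qed.

(** The roots positive for the word are the positive roots moved by its transpose. *)
Lemma prod_pos (G : C -> C) s z : \prod_(k <- posl) G (ev k (act (wmx s) z)) =
  \prod_(k <- rootl | 0 < hw s k) G (ev k z).
Proof.
under eq_bigr do rewrite ev_word.
rewrite -(big_map (wd s) xpredT (fun k => G (ev k z))) (perm_big _ (pos_perm s)).
by rewrite big_filter.
Qed.

Lemma prod_pos7 (G : C -> C) s z : {subset s <= J7} ->
  \prod_(k <- posl7) G (ev k (act (wmx (s ++ [:: o7; o6])) z)) =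
  \prod_(k <- rootl | ((d_root k)`_7 == 0) && (0 < hw (s ++ [:: o7; o6]) k)) G (ev k z).
Proof.
move=> sJ; under eq_bigr do rewrite ev_word.
rewrite -(big_map (wd _) xpredT (fun k => G (ev k z))) (perm_big _ (pos_perm7 sJ)).
by rewrite big_filter.
Qed.

Variable rad : R.
Hypothesis rad_gt0 : 0 < rad.
Variables phi psi : VC -> C.
Hypothesis dphi : forall z, tube rad z -> differentiable phi z.
Hypothesis dpsi : forall z, tube rad z -> differentiable psi z.

(** The numerator of the term of Sigma_W at [w], up to signs, as a function of m = w z: the
    numerators of c(-m), the product of [rho] over the negative roots at m (which completes 1/r(m)
    to 1/[rho_all]), and phi(-m). *)
Definition PsiA (m : VC) : C := \prod_(k <- posl) (ev k m - 1) *
  \prod_(k <- posl) rho (- ev k m) * phi (- m).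
(** The numerator of the term of Sigma'_{W'd} at u, as a function of m = u z. *)
Definition PsiB (m : VC) : C := \prod_(k <- posl7) (ev k m + 1) *
  \prod_(k <- posl) rho (ev k m) * psi m.

Lemma tube_dom : open_dom (tube rad).
Proof.
move=> z /(tube_open rad_gt0).
by move=> /(@nearP R ('cV[cplx R]_8 : normedModType C)).
Qed.

Lemma df_rho_ev k (z : VC) : differentiable (fun z : VC => rho (ev k z)) z.
Proof. exact: (@df_comp R VC C (fun z => ev k z) rho z (df_ev k z)). Qed.

Lemma dPsiA z : tube rad z -> differentiable PsiA z.
Proof.
move=> tz; apply: dfM; last by apply: df_oppv; apply: dphi; exact: (proj2 (tube_opp rad z)).
apply: dfM; apply: df_prod => k; first by apply: dfB; [exact: df_ev|exact: dfc].
exact: (@df_comp R VC C (fun z => - ev k z) rho z (dfN (df_ev k z))).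
Qed.

Lemma dPsiB z : tube rad z -> differentiable PsiB z.
Proof.
move=> tz; apply: dfM; last exact: dpsi.
apply: dfM; apply: df_prod => k; first by apply: dfD; [exact: df_ev|exact: dfc].
exact: df_rho_ev.
Qed.

Lemma calA_ex : exists2 A : VC -> C, (forall z, tube rad z -> differentiable A z) &
  forall z, tube rad z -> asum Jall posl PsiA z = pl posl z * A z.
Proof.
apply: (asum_quotient parab_all tube_dom) => s z _ tz.
by apply: dPsiA; exact: (proj2 (tube_word rad s z)).
Qed.

Lemma calB_ex : exists2 B : VC -> C, (forall z, tube rad z -> differentiable B z) &
  forall z, tube rad z -> asum J7 posl7 PsiB z = pl posl7 z * B z.
Proof.
apply: (asum_quotient parab_E7 tube_dom) => s z _ tz.
by apply: dPsiB; exact: (proj2 (tube_word rad s z)).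
Qed.

Lemma sgnw_pl J L (HP : parab J L) s (z : VC) : {subset s <= J} ->
  pl L (act (wmx s) z) = sgnw R L (wmx s) * pl L z /\
  (sgnw R L (wmx s))^-1 = sgnw R L (wmx s) /\ sgnw R L (wmx s) != 0.
Proof.
move=> sJ; rewrite (pl_word HP _ sJ) (sgnw_word R HP sJ); split => //.
by rewrite signr_eq0 -exprVn invrN1.
Qed.

Section Regular.
Variable z : VC.
Hypothesis Hev : forall k, k \in rootl -> ev k z != 0.
Hypothesis Hrho : forall k, k \in rootl -> rho (ev k z) != 0.

Lemma pl_word_neq0 L s : {subset L <= posl} -> pl L (act (wmx s) z) != 0.
Proof.
move=> Lp; rewrite /pl prodf_seq_neq0; apply/allP => k /Lp/posl_root kr /=.
by rewrite ev_word Hev// wd_root.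
Qed.

Lemma Sigma_WE A : asum Jall posl PsiA z = pl posl z * A ->
  Sigma_W rho phi z = rfun rho z * A / rho_all z.
Proof.
move=> HA; rewrite /Sigma_W.
have P0 : pl posl z != 0 by have := @pl_word_neq0 posl [::] (fun _ h => h); rewrite /wmx big_nil act1.
have RR0 : rho_all z != 0.
  by rewrite /rho_all prodf_seq_neq0; apply/allP => k kr /=; exact: Hrho.
rewrite (eq_fsbigr (fun w => (rfun rho z / (pl posl z * rho_all z)) *
   (sgnw R posl w * PsiA (act w z)))); last first.
  move=> w; rewrite inE => -[s _ ->]; rewrite -/(wmx s).
  have sJ : {subset s <= Jall} by move=> i; rewrite inE.
  have [e1 [e2 e3]] := sgnw_pl parab_all z sJ.
  have RRw : rho_all z = \prod_(k <- posl) rho (ev k (act (wmx s) z)) *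
      \prod_(k <- posl) rho (- ev k (act (wmx s) z)).
    by rewrite -prod_rootl -/(rho_all _) rho_all_word.
  have cE : cfun E8_pos_roots (- act (wmx s) z) =
     \prod_(k <- posl) (ev k (act (wmx s) z) - 1) / (sgnw R posl (wmx s) * pl posl z).
    rewrite -e1 cfunE /pl -prodfV -big_split /=; apply: eq_bigr => k _.
    by rewrite evN invrN mulrN -mulNr opprD opprK.
  move: RR0; rewrite RRw mulf_eq0 negb_or => /andP[r1 r2].
  rewrite cE /PsiA (rfunE (act _ _)) invfM e2.
  by field; rewrite P0 r1 r2.
rewrite -mulr_fsumr -/(asum Jall posl PsiA z) HA.
by field; rewrite RR0 P0.
Qed.

Lemma Sigma_W'dE B : asum J7 posl7 PsiB (act d_mx z) = pl posl7 (act d_mx z) * B ->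
  Sigma_W'd rho psi z = B / rfun rho z.
Proof.
move=> HB; rewrite /Sigma_W'd.
have P0 : pl posl7 (act d_mx z) != 0 by rewrite dmxE pl_word_neq0//; exact: posl7_sub.
have r0 : rfun rho z != 0.
  rewrite rfunE prodf_seq_neq0; apply/allP => k /posl_root kr /=; exact: Hrho.
have dd : d_mx *m (simple_refl o6 *m simple_refl o7) = 1%:M.
  by rewrite /d_mx mulmxA -(mulmxA (simple_refl o7)) reflK mulmx1 reflK.
rewrite fsbig_image; last first.
  by move=> w w' _ _ e; rewrite -[w]mulmx1 -[w']mulmx1 -dd !(mulmxA _ d_mx) e.
rewrite (eq_fsbigr (fun w => (rfun rho z * pl posl7 (act d_mx z))^-1 *
   (sgnw R posl7 w * PsiB (act w (act d_mx z))))); last first.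
  move=> w; rewrite inE => -[s sJ ->]; rewrite -/(wmx s) actM.
  have [e1 [e2 e3]] := sgnw_pl parab_E7 (act d_mx z) sJ.
  have cE : cfun (E7_roots `&` E8_pos_roots) (act (wmx s) (act d_mx z)) =
     \prod_(k <- posl7) (ev k (act (wmx s) (act d_mx z)) + 1) /
     (sgnw R posl7 (wmx s) * pl posl7 (act d_mx z)).
    by rewrite -e1 cfun7E /pl -prodfV -big_split.
  rewrite cE /PsiB (rfunE (act (wmx s) _)) invfM e2.
  by field; rewrite P0 r0.
rewrite -mulr_fsumr -/(asum J7 posl7 PsiB _) HB.
by field; rewrite r0 P0.
Qed.

End Regular.

End Sigma.

(** * The normal derivative along L_0 *)

Section Normal.
Variable R : realType.
Local Notation C := (cplx R).
Local Notation VC := ('cV[cplx R]_8).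
Local Notation VN := ('cV[cplx R]_8 : normedModType (cplx R)).
Variable rho : C -> C.
Hypothesis rho_entire : forall s : C, differentiable rho s.
Hypothesis rho_zeroes : forall s : C, rho s = 0 -> 0 < complex.Re s < 1.
Variable rad : R.
Hypothesis rad_gt0 : 0 < rad.
Variables phi psi : VC -> C.
Variables A B : VC -> C.
Hypothesis dA : forall z, tube rad z -> differentiable A z.
Hypothesis dB : forall z, tube rad z -> differentiable B z.
Hypothesis HA : forall z, tube rad z -> asum Jall posl (PsiA rho phi) z = pl posl z * A z.
Hypothesis HB : forall z, tube rad z -> asum J7 posl7 (PsiB rho psi) z = pl posl7 z * B z.

Local Notation D := (regular_locus rho rad).
Local Notation F := (fun z => Sigma_W rho phi z * Sigma_W'd rho psi z).

Definition omega8 : VC := delta_mx ord_max 0.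

Lemma lamE (x : C) : lam x = lam 0 + x *: omega8.
Proof.
apply/matrixP => i j; rewrite ord1 {j} !mxE.
by case: i => [[|[|[|[|[|[|[|[|//]]]]]]]] ii] /=;
   rewrite ?mulr0 ?addr0 ?mulr1 ?add0r.
Qed.

Lemma ev_omega8 k : ev k omega8 = (k`_7)%:~R.
Proof. by rewrite ev_delta. Qed.

Lemma ev_lam k (x : C) : ev k (lam x) = ev k (lam 0) + x * (k`_7)%:~R.
Proof. by rewrite lamE evD evZ ev_omega8. Qed.

(** The value of a root at the origin of L_0, where only the fundamental weight coordinates 1, 4
    and 7 are nonzero, and are 1. *)
Definition val0 (k : seq int) : int := k`_0 + k`_3 + k`_6.

Lemma ev_lam0 k : ev k (lam 0) = (val0 k)%:~R :> C.
Proof.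
rewrite /ev !big_ord_recl big_ord0 !mxE /= /val0 !rmorphD /=.
by rewrite !mulr1 !mulr0 !add0r !addr0 addrA.
Qed.

(** Zeros of [rho] have real part strictly between 0 and 1. *)
Lemma rho_int (m : int) : rho (m%:~R) != 0.
Proof.
apply/eqP => /rho_zeroes.
have -> : (m%:~R : C) = ((m%:~R : R)%:C)%C by rewrite rmorph_int.
rewrite /= ltr0z (_ : (1 : R) = 1%:~R)// ltr_int => /andP[h0 h1].
by move: h0 h1; case: m => // -[].
Qed.

Lemma rho_all_lam0 : rho_all rho (lam 0) != 0.
Proof.
rewrite /rho_all prodf_seq_neq0; apply/allP => k kr /=.
by rewrite ev_lam0 rho_int.
Qed.

Lemma df_rho_all z : differentiable (rho_all rho) z.
Proof. by apply: df_prod => k; exact: df_rho_ev. Qed.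

Lemma df_lam (x : C) : differentiable (fun x : C => lam x : VC) x.
Proof.
rewrite (_ : (fun x : C => lam x : VC) = (fun x => lam 0 + x *: omega8)).
  exact: (@df_line R VN (lam 0) omega8 x).
by apply/funext => y; exact: lamE.
Qed.

Lemma df_lam_comp (f : VC -> C) (x : C) : differentiable f (lam x) ->
  differentiable (fun x => f (lam x)) x.
Proof. exact: (@df_comp R C VN (fun x : C => lam x : VC) f x (df_lam x)). Qed.

Definition numer (z : VC) : C := A z * B (act d_mx z).

Lemma tube_d z : tube rad z -> tube rad (act d_mx z).
Proof. by rewrite dmxE; exact: (proj2 (tube_word rad _ z)). Qed.

Lemma df_Bd z : tube rad z -> differentiable (fun z => B (act d_mx z)) z.
Proof.
move=> tz; have := dB (tube_d tz); rewrite dmxE.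
exact: df_actw.
Qed.

Lemma df_numer z : tube rad z -> differentiable numer z.
Proof. by move=> tz; apply: dfM; [exact: dA|exact: df_Bd]. Qed.

(** The factor r in Sigma_W cancels against the factor 1/r in Sigma'_{W'd}. *)
Lemma F_ext z : D z -> numer z / rho_all rho z = F z.
Proof.
move=> [tz Hz].
have Hev k : k \in rootl -> ev k z != 0.
  move=> kr; have [|h _] := Hz (vec k); first by apply/E8_rootsP; exists k.
  by rewrite coroot_vec in h.
have Hrho k : k \in rootl -> rho (ev k z) != 0.
  move=> kr; have [|_ h] := Hz (vec k); first by apply/E8_rootsP; exists k.
  by rewrite coroot_vec in h.
rewrite /= (Sigma_WE Hev Hrho (HA tz)) (Sigma_W'dE Hev Hrho (HB (tube_d tz))) /numer.
have r0 : rfun rho z != 0.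
  rewrite rfunE prodf_seq_neq0; apply/allP => k /posl_root kr /=; exact: Hrho.
have RR0 : rho_all rho z != 0.
  by rewrite /rho_all prodf_seq_neq0; apply/allP => k kr /=; exact: Hrho.
by field; rewrite r0 RR0.
Qed.

(** The quotient rule for [numer] / [rho_all]. *)
Definition normal_value (n : VC) (x : C) : C :=
  ('d numer (lam x) n * rho_all rho (lam x) - numer (lam x) * 'd (rho_all rho) (lam x) n) /
  rho_all rho (lam x) ^+ 2.

Lemma quot_rule (a b p r : C) : r != 0 ->
  p * (- r ^- 2 * b) + r^-1 * a = (a * r - p * b) / r ^+ 2.
Proof. by move=> r0; field. Qed.

Lemma normal_deriv_val n x : tube rad (lam x) -> rho_all rho (lam x) != 0 ->
  normal_deriv D F n x (normal_value n x).
Proof.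
move=> tx rx; exists (fun z => numer z * (rho_all rho z)^-1).
  have [r r0 Hr] := tube_dom rad_gt0 tx.
  have [r' r'0 Hr'] := @diff_near R VN _ _ _ (df_rho_all (lam x)) (nrm_gt0 rx).
  apply/(@nearP R VN); exists (Num.min r r'); first by rewrite lt_min r0.
  move=> z; rewrite lt_min => /andP[/Hr tz /Hr' h].
  have rz : rho_all rho z != 0.
    by apply: contraTneq h => ->; rewrite sub0r nrmN ltxx.
  split; last exact: F_ext.
  by apply: dfM; [exact: df_numer|apply: dfV => //; exact: df_rho_all].
have dP := df_numer tx; have dR := df_rho_all (lam x).
have dV := dfV dR rx.
apply: (etrans (deriveE _ (dfM dP dV))).
apply: (etrans (dM_E n dP dV)).
apply: (etrans (congr1 (fun u => numer (lam x) * u + _) (dV_E n dR rx))).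
exact: quot_rule.
Qed.

Lemma near_tube x : tube rad (lam x) -> exists2 r : R, 0 < r &
  forall y, nrm (y - x) < r -> tube rad (lam y).
Proof.
move=> tx; have [r r0 Hr] := open_line omega8 (tube_dom rad_gt0) tx.
exists r => // y /Hr; suff -> : lam x + (y - x) *: omega8 = lam y by [].
by rewrite (lamE x) (lamE y) -addrA -scalerDl [x + _]addrC subrK.
Qed.

Lemma df_num n x : tube rad (lam x) -> differentiable (fun x =>
  'd numer (lam x) n * rho_all rho (lam x) - numer (lam x) * 'd (rho_all rho) (lam x) n) x.
Proof.
move=> tx.
have dR y : differentiable (fun x => rho_all rho (lam x)) y by apply: df_lam_comp; exact: df_rho_all.
have dP : differentiable (fun x => numer (lam x)) x by apply: df_lam_comp; exact: df_numer.
have ddP : differentiable (fun x => 'd numer (lam x) n) x.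
  apply: (df_lam_comp (f := fun z => 'd numer z n)).
  apply: (@hol_diff R VN).
  have [r r0 Hr] := tube_dom rad_gt0 tx.
  by apply/(@nearP R VN); exists r => // z /Hr; exact: df_numer.
have ddR : differentiable (fun x => 'd (rho_all rho) (lam x) n) x.
  apply: (df_lam_comp (f := fun z => 'd (rho_all rho) z n)).
  apply: (@hol_diff R VN).
  by apply/(@nearP R VN); exists 1 => // z _; exact: df_rho_all.
exact: (dfB (dfM ddP (dR x)) (dfM dP ddR)).
Qed.

(** [rho_all] has an isolated zero of some order m at the point, so that the derivative of the
    quotient has a pole of order at most 2 m. *)
Lemma meromorphic_normal n x0 : tube rad (lam x0) ->
  meromorphic_at (normal_deriv D F n) x0.
Proof.
move=> tx.
have dR y : differentiable (fun x => rho_all rho (lam x)) y by apply: df_lam_comp; exact: df_rho_all.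
have [m [u [du u0 Hu]]] := zero_order x0 dR rho_all_lam0.
have [r r0 Hr] := near_tube tx.
have [r' r'0 Hr'] := diff_near (du x0) (nrm_gt0 u0).
have un y : nrm (y - x0) < r' -> u y != 0.
  by move=> /Hr' h; apply: contraTneq h => ->; rewrite sub0r nrmN ltxx.
exists (m * 2)%N, (fun x => ('d numer (lam x) n * rho_all rho (lam x) -
  numer (lam x) * 'd (rho_all rho) (lam x) n) / u x ^+ 2); split.
  apply/nearP; exists (Num.min r r'); first by rewrite lt_min r0.
  move=> x; rewrite lt_min => /andP[/Hr tx' /un ux].
  apply: df_div; [exact: df_num|exact: dfX|by rewrite expf_neq0].
apply/dnearP; exists (Num.min r r'); first by rewrite lt_min r0.
move=> x; rewrite lt_min => /andP[/Hr tx' /un ux] xx0.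
have xm : (x - x0) ^+ m != 0 by rewrite expf_neq0// subr_eq0.
have rx : rho_all rho (lam x) != 0 by rewrite Hu mulf_neq0.
have := normal_deriv_val n tx' rx; rewrite /normal_value.
set N := (X in X / _) => h.
suff -> : N / u x ^+ 2 / (x - x0) ^+ (m * 2) = N / rho_all rho (lam x) ^+ 2 by [].
rewrite Hu exprM; clear h; move: N ((x - x0) ^+ m) xm (u x) ux => N d d0 v v0.
by field; rewrite d0 v0.
Qed.

End Normal.

(** * Division by a coprime product *)

Section Coprime.
Variable R : realType.
Local Notation C := (cplx R).
Variables (V : normedModType C) (U : V -> Prop).
Hypothesis oU : open_dom U.
Variables (T : Type) (l : T -> V -> C) (a Q : V -> C).
Hypothesis dl : forall k z, differentiable (l k) z.
Hypothesis da : forall z, U z -> differentiable a z.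
Hypothesis dQ : forall z, U z -> differentiable Q z.

(** Either the linear form [l k] has no zero, or it has no common component with Q: [e] is a
    direction transverse to its zero set, and [d] a direction within it along which Q has isolated
    zeros. *)
Definition coprime_to (k : T) : Prop :=
  (forall z, U z -> l k z != 0) \/
  exists e d : V, [/\ forall z (xi : C), l k (z + xi *: e) = l k z + xi,
    forall z (t : C), l k (z + t *: d) = l k z &
    forall z, U z -> exists2 r : R, 0 < r &
      forall t : C, 0 < nrm t < r -> Q (z + t *: d) != 0].

(** If a l = Q N then N vanishes on the zero set of l, first where Q is not 0 and then by
    continuity; so l can be cancelled, one factor at a time. *)
Lemma coprime_division (L : seq T) (N : V -> C) :
  (forall k, List.In k L -> coprime_to k) ->
  (forall z, U z -> differentiable N z) ->
  (forall z, U z -> a z * \prod_(k <- L) l k z = Q z * N z) ->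
  exists2 K : V -> C, (forall z, U z -> differentiable K z) &
    forall z, U z -> a z = Q z * K z.
Proof.
elim: L N => [|k L IH] N HL dN HN.
  by exists N => // z Uz; rewrite -HN// big_nil mulr1.
have HL' k' : List.In k' L -> coprime_to k' by move=> h; apply: HL; right.
have [lu|[e [d [le ld Qd]]]] := HL k (or_introl erefl).
  apply: (IH (fun z => N z / l k z) HL').
    by move=> z Uz; apply: df_div; [exact: dN|exact: dl|exact: lu].
  move=> z Uz; apply: (mulIf (lu z Uz)).
  rewrite -!mulrA mulVf ?lu// mulr1 -HN// big_cons.
  by congr (_ * _); rewrite mulrC.
have N0 z : U z -> l k z = 0 -> N z = 0.
  move=> Uz lz; apply: (@zero_by_density _ _ _ _ d (dN z Uz)).
  have [r r0 Hr] := open_line d oU Uz; have [r' r'0 Hr'] := Qd z Uz.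
  exists (Num.min r r'); first by rewrite lt_min r0.
  move=> t; rewrite lt_min => /andP[t0 /andP[tr tr']].
  have Qt : Q (z + t *: d) != 0 by apply: Hr'; rewrite t0.
  apply: (mulfI Qt); rewrite mulr0 -HN; last exact: Hr.
  by rewrite big_cons ld lz mul0r mulr0.
pose N' := quo (l k) e N.
have dN' z : U z -> differentiable N' z.
  move=> Uz; apply: (@quo_diff R V (l k) e (dl k) le).
  have [r r0 Hr] := oU Uz; apply/nearP; exists r => // w /Hr Uw.
  by split; [exact: dN|exact: N0].
have NN' z : U z -> N z = l k z * N' z.
  by move=> Uz; apply: quoM; exact: N0.
apply: (IH N' HL' dN').
move=> z Uz; apply/eqP; rewrite -subr_eq0; apply/eqP.
pose P z := \prod_(k' <- L) l k' z.
have dP w : differentiable P w by apply: df_prod.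
have dd : differentiable (fun z => a z * P z - Q z * N' z) z.
  apply: dfB; first by apply: dfM; [exact: da|exact: dP].
  by apply: dfM; [exact: dQ|exact: dN'].
apply: (@zero_by_density _ _ _ _ e dd).
have [r r0 Hr] := open_line e oU Uz.
have [r' r'0 Hr'] : exists2 r : R, 0 < r & forall t : C, 0 < nrm t < r -> l k (z + t *: e) != 0.
  have e1 : forall i, i \in [:: tt] -> (1 : C) != 0 by move=> i _; exact: oner_neq0.
  have [r' r'0 Hr'] := avoid (fun=> l k z) e1.
  exists r' => // t ht; rewrite le -[X in _ + X]mulr1.
  by apply: (Hr' t ht tt); rewrite inE.
exists (Num.min r r'); first by rewrite lt_min r0.
move=> t; rewrite lt_min => /andP[t0 /andP[tr tr']].
have Uw := Hr _ tr; set w := z + _ in Uw *.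
have lw : l k w != 0 by apply: Hr'; rewrite t0.
apply: (mulfI lw); rewrite mulr0 mulrBr mulrCA -[l k w * P w]/(l k w * \prod_(k' <- L) l k' w).
rewrite -[l k w * _](big_cons _ _ k L xpredT (fun k => l k w)) HN//.
by rewrite NN'// mulrCA subrr.
Qed.

End Coprime.

(** * Divisibility to first order along L_0 *)

(** The value of the form [k] at the vector with simple root coordinates [v]. *)
Definition dp (k v : seq int) : int := sum8 (fun j => k`_j * dotC j v).

Lemma mul_quot_rule (F : comNzRingType) (a q k da dq dk : F) :
  da = q * dk + k * dq -> a = q * k -> da * q - a * dq = dk * q ^+ 2.
Proof. by move=> -> ->; ring. Qed.

Section Divisible.
Variable R : realType.
Local Notation C := (cplx R).
Local Notation VC := ('cV[cplx R]_8).
Variables (a q : VC -> C) (x0 : C).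

Definition div_value : Prop := exists (k : C -> C) (r : R), 0 < r /\
  forall x, nrm (x - x0) < r -> differentiable k x /\ a (lam x) = q (lam x) * k x.

(** The quotient rule: this says that the derivative along n of a/q has no pole on L_0. *)
Definition div_deriv (n : VC) : Prop := exists (k : C -> C) (r : R), 0 < r /\
  forall x, nrm (x - x0) < r -> differentiable k x /\
    'd a (lam x) n * q (lam x) - a (lam x) * 'd q (lam x) n = k x * q (lam x) ^+ 2.

End Divisible.

Section Local.
Variable R : realType.
Local Notation C := (cplx R).
Local Notation VC := ('cV[cplx R]_8).
Local Notation VN := ('cV[cplx R]_8 : normedModType (cplx R)).
Local Notation E := ('cV[cplx R]_3).
Local Notation EN := ('cV[cplx R]_3 : normedModType (cplx R)).
Variable rho : C -> C.
Hypothesis rho_entire : forall s : C, differentiable rho s.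
Hypothesis rho_zeroes : forall s : C, rho s = 0 -> 0 < complex.Re s < 1.
Variable rad : R.
Hypothesis rad_gt0 : 0 < rad.

Definition lat (v : seq int) : VC := of_int_mx C (vec v).

Lemma ev_lat k v : ev k (lat v) = (dp k v)%:~R.
Proof.
rewrite /ev /dp sum8E rmorph_sum /=; apply: eq_bigr => j _.
by rewrite [lat v _ _]mxE vecE rmorphM.
Qed.

(** Each factor is an entire function of t, not identically zero because [rho] does not vanish at 2,
    and so has isolated zeros. *)
Lemma rho_line (T : eqType) (L : seq T) (b c : T -> C) :
  (forall k, k \in L -> c k != 0) ->
  exists2 r : R, 0 < r & forall t : C, 0 < nrm t < r ->
    \prod_(k <- L) rho (b k + t * c k) != 0.
Proof.
elim: L => [|k L IH] H; first by exists 1 => // t _; rewrite big_nil oner_neq0.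
have [r r0 Hr] := IH (fun k' k'L => H k' (mem_behead (s := k :: L) k'L)).
have ck : c k != 0 by apply: H; rewrite inE eqxx.
pose h (t : C) := rho (b k + t * c k).
have dh t : differentiable h t.
  apply: (@df_comp R C C (fun t => b k + t * c k) rho t _ (rho_entire _)).
  by apply: dfD; [exact: dfc|apply: dfM; [exact: df_id|exact: dfc]].
(* At this t the argument of [rho] is 2. *)
have h0 : h ((2%:~R - b k) / c k) != 0.
  by rewrite /h divfK// addrC subrK; exact: rho_int.
have /dnearP[d d0 Hd] := isolated_zeros 0 dh h0.
exists (Num.min r d); first by rewrite lt_min r0.
move=> t; rewrite lt_min => /andP[t0 /andP[tr td]].
rewrite big_cons mulf_neq0//; last by apply: Hr; rewrite t0.
apply: Hd; first by rewrite subr0.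
by apply: contraTneq t0 => ->; rewrite nrm0 ltxx.
Qed.

Definition j0 : 'I_3 := @Ordinal 3 0 isT.
Definition j1 : 'I_3 := @Ordinal 3 1 isT.
Definition j2 : 'I_3 := @Ordinal 3 2 isT.
Definition ee (i : 'I_3) : E := delta_mx i 0.

Variables (x0 : C) (v u : seq int).

(** The deformation of L_0: [z j0] moves along L_0, [z j1] in the direction v of the derivative to
    be controlled, and [z j2] in the auxiliary direction u. *)
Definition Lam (z : E) : VC :=
  lam x0 + (z j0 0 *: omega8 R + (z j1 0 *: lat v + z j2 0 *: lat u)).

Lemma ev_Lam k z : ev k (Lam z) = ev k (lam x0) +
  (z j0 0 * (k`_7)%:~R + (z j1 0 * (dp k v)%:~R + z j2 0 * (dp k u)%:~R)).
Proof. by rewrite !evD !evZ ev_omega8 !ev_lat. Qed.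

Lemma Lam_line z (t : C) i : Lam (z + t *: ee i) =
  Lam z + t *: (if i == j0 then omega8 R else if i == j1 then lat v else lat u).
Proof.
have Z (a b : C) (w : VC) : (a + b) *: w = a *: w + b *: w by rewrite scalerDl.
rewrite /Lam !mxE /= -addrA; congr (_ + _).
case: i => [[|[|[|//]]]] ii /=; rewrite ?mulr0 ?mulr1 ?addr0 !Z.
- by rewrite addrAC.
- by rewrite -!addrA; congr (_ + (_ + _)); rewrite addrC.
- by rewrite -!addrA.
Qed.

Lemma Lam_x (x : C) : Lam ((x - x0) *: ee j0) = lam x.
Proof.
rewrite /Lam !mxE /= !mulr0 mulr1 !scale0r !addr0.
by rewrite (lamE x) (lamE x0) -addrA -scalerDl [x0 + _]addrC subrK.
Qed.

Lemma df_Lam z : differentiable (Lam : EN -> VN) z.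
Proof.
have dc (i : 'I_3) (w : VC) : differentiable (fun z : EN => z i 0 *: w : VN) z.
  by apply: (@differentiableZl _ _ _ (fun z : EN => z i 0 : C) w); exact: differentiable_coord.
apply: (@differentiableD _ _ _ (cst (lam x0 : VN))); first exact: differentiable_cst.
by apply: differentiableD; [exact: dc|apply: differentiableD; exact: dc].
Qed.

Lemma df_Lam_comp (f : VC -> C) z : differentiable f (Lam z) ->
  differentiable (fun z : E => f (Lam z)) z.
Proof. exact: (@df_comp R EN VN Lam f z (df_Lam z)). Qed.

Lemma d_Lam (f : VC -> C) z : differentiable f (Lam z) ->
  'd (fun z : E => f (Lam z)) z (ee j1) = 'd f (Lam z) (lat v).
Proof.
move=> df.
have e1 := @diff_line R EN (fun z : E => f (Lam z)) z (ee j1) (df_Lam_comp df).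
have e2 := @diff_line R VN f (Lam z) (lat v) df.
apply: (etrans (esym e1)); apply: (etrans _ e2).
apply: (congr1 (fun h : C -> C => 'd h 0 1)); apply/funext => xi.
by rewrite Lam_line.
Qed.

Variables (Lr qs : seq (seq int)) (a S : VC -> C).

Definition rho_prod (z : VC) : C := \prod_(k <- qs) rho (ev k z).

Hypothesis da : forall z, tube rad z -> differentiable a z.
Hypothesis HS : forall z, tube rad z -> S z = \prod_(k <- Lr) ev k z * a z.
Hypothesis HN : exists2 N : E -> C, (forall z, tube rad (Lam z) -> differentiable N z) &
  forall z, tube rad (Lam z) -> S (Lam z) = rho_prod (Lam z) * N z.
Hypothesis Hq : forall k, k \in qs -> k`_7 != 0.
Hypothesis HL : forall k, k \in Lr -> [\/ ev k (lam x0 : VC) != 0,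
  k`_7 = 0 /\ dp k u != 0 |
  [/\ k`_7 != 0, dp k v = 0, dp k u = 0 & forall q, q \in qs -> dp q u != 0]].
Hypothesis tx0 : tube rad (lam x0).

Lemma df_rho_prod z : differentiable rho_prod z.
Proof. by apply: df_prod => k; exact: df_rho_ev. Qed.

Let P (z : E) : C := \prod_(k <- Lr | ev k (lam x0 : VC) != 0) ev k (Lam z).
Let U (z : E) := tube rad (Lam z) /\ P z != 0.

Let Lam0 : Lam 0 = lam x0.
Proof. by rewrite -[RHS]Lam_x subrr scale0r. Qed.

Let dPz z : differentiable P z.
Proof. by apply: df_prod => k; apply: df_Lam_comp; exact: df_ev. Qed.

Let oU : @open_dom R EN U.
Proof.
move=> z [tz Pz].
have [r r0 Hr] := @diff_near R EN P z _ (dPz z) (nrm_gt0 Pz).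
have cL := @differentiable_continuous _ _ _ z (Lam : EN -> VN) (df_Lam z).
have /(@nearP R EN)[r' r'0 Hr'] := cL _ (tube_open rad_gt0 tz).
exists (Num.min r r'); first by rewrite lt_min r0.
move=> w; rewrite lt_min => /andP[hr hr'].
split; first exact: Hr' hr'.
apply/eqP => Pw; have h := Hr _ hr; rewrite Pw sub0r nrmN ltxx in h.
by case/negP: h.
Qed.

Let U0 : U 0.
Proof.
split; first by rewrite Lam0.
by rewrite /P prodf_seq_neq0; apply/allP => k kL; apply/implyP; rewrite Lam0.
Qed.

(** The hypothesis on the roots k of [Lr] provides the directions for [coprime_division]: a root
    that vanishes identically on L_0 is transverse to u and constant along L_0, where the factors
    of [rho_prod] vary; one that vanishes at an isolated point of L_0 is transverse to L_0 and
    constant along u, where the factors vary too. *)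
Lemma local_quotient : exists2 K : E -> C, (forall z, U z -> differentiable K z) &
  forall z, U z -> a (Lam z) = rho_prod (Lam z) * K z.
Proof.
have [N dN HN'] := HN.
apply: (@coprime_division R EN U oU _ (fun k z => ev k (Lam z))
  (fun z => a (Lam z)) (fun z => rho_prod (Lam z)) _ _ _ Lr N).
- by move=> k z; apply: df_Lam_comp; exact: df_ev.
- by move=> z [tz _]; apply: df_Lam_comp; exact: da.
- by move=> z [tz _]; apply: df_Lam_comp; exact: df_rho_prod.
- move=> k kL'; have kL : k \in Lr.
    by elim: Lr kL' => //= k1 L IH [->|/IH h]; rewrite inE ?eqxx ?h ?orbT.
  have Qline z (w : VC) : (forall q, q \in qs -> ev q w != 0) ->
      exists2 r : R, 0 < r & forall t : C, 0 < nrm t < r -> rho_prod (Lam z + t *: w) != 0.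
    move=> /(rho_line (fun q => ev q (Lam z)))[r r0 Hr]; exists r => // t /Hr.
    by rewrite /rho_prod; under [in X in _ -> X]eq_bigr do rewrite evD evZ.
  have [k0|k1|k2] := HL kL.
  + left=> z [_]; rewrite /P prodf_seq_neq0 => /allP/(_ _ kL)/implyP; exact.
  + right; have [k7 ku] := k1.
    have ku' : (dp k u)%:~R != 0 :> C by rewrite intr_eq0.
    exists ((dp k u)%:~R^-1 *: ee j2), (ee j0); split.
    * move=> z xi; rewrite scalerA Lam_line /= evD evZ ev_lat.
      by rewrite -mulrA mulVf// mulr1.
    * by move=> z t; rewrite Lam_line /= evD evZ ev_omega8 k7 mulr0 addr0.
    * have he q : q \in qs -> ev q (omega8 R) != 0.
        by move=> /Hq; rewrite ev_omega8 intr_eq0.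
      move=> z _; have [r r0 Hr] := Qline z _ he.
      by exists r => // t /Hr; rewrite Lam_line.
  + right; have [k7 kv ku qu] := k2.
    have k7' : (k`_7)%:~R != 0 :> C by rewrite intr_eq0.
    exists ((k`_7)%:~R^-1 *: ee j0), (ee j2); split.
    * move=> z xi; rewrite scalerA Lam_line /= evD evZ ev_omega8.
      by rewrite -mulrA mulVf// mulr1.
    * by move=> z t; rewrite Lam_line /= evD evZ ev_lat ku mulr0 addr0.
    * have he q : q \in qs -> ev q (lat u) != 0.
        by move=> /qu; rewrite ev_lat intr_eq0.
      move=> z _; have [r r0 Hr] := Qline z _ he.
      by exists r => // t /Hr; rewrite Lam_line.
- by move=> z [tz _]; exact: dN.
- by move=> z [tz _]; rewrite mulrC -HS// HN'.
Qed.

(** On the slice a = q K with K holomorphic, so k0 and k1 are the restrictions to L_0 of K and of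
    its derivative along v. *)
Lemma local_good : div_value a rho_prod x0 /\ div_deriv a rho_prod x0 (lat v).
Proof.
have [K dK HK] := local_quotient.
have [r r0 Hr] := @open_line R EN U 0 (ee j0) oU U0.
pose k0 x := K ((x - x0) *: ee j0); pose k1 x := 'd K ((x - x0) *: ee j0) (ee j1).
suff H x : nrm (x - x0) < r -> [/\ differentiable k0 x, differentiable k1 x,
    a (lam x) = rho_prod (lam x) * k0 x &
    'd a (lam x) (lat v) * rho_prod (lam x) - a (lam x) * 'd rho_prod (lam x) (lat v) =
    k1 x * rho_prod (lam x) ^+ 2].
  by split; [exists k0, r|exists k1, r]; split=> // x /H[].
move=> hx; rewrite -(Lam_x x); set y := (x - x0) *: ee j0.
have Uy : U y by have := Hr _ hx; rewrite add0r.
have ty : tube rad (Lam y) := proj1 Uy.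
have dl : differentiable (fun x : C => (x - x0) *: ee j0 : EN) x.
  by apply: (@differentiableZl _ _ _ (fun x : C => x - x0) (ee j0)); exact: df_sub.
have nU (Q : E -> Prop) : (forall z, U z -> Q z) -> \forall z \near (y : EN), Q z.
  move=> HQ; have [s s0 Hs] := oU Uy; apply/(@nearP R EN); exists s; first exact: s0.
  by move=> w /Hs /HQ.
have nK := nU (fun z => differentiable (K : EN -> C) z) dK.
have day : differentiable a (Lam y) := da ty.
have dQy : differentiable (fun z => rho_prod (Lam z)) y := df_Lam_comp (df_rho_prod _).
have aK := HK _ Uy.
have dKy := dK _ Uy.
have e1 : 'd a (Lam y) (lat v) = rho_prod (Lam y) * 'd K y (ee j1) + K y * 'd rho_prod (Lam y) (lat v).
  have h1 := d_Lam day.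
  have h2 := d_Lam (df_rho_prod (Lam y)).
  apply: (etrans (esym h1)).
  have dprod : differentiable (fun z => rho_prod (Lam z) * K z) y := dfM dQy dKy.
  have h3 := proj2 (@near_eq_diff R EN _ _ y (nU _ HK) dprod) (ee j1).
  apply: (etrans h3).
  apply: (etrans (@dM_E R EN _ _ y (ee j1) dQy dKy)).
  exact: (congr1 (fun d => _ + K y * d) h2).
split.
- exact: (@df_comp R C EN (fun x => (x - x0) *: ee j0) K x dl dKy).
- apply: (@df_comp R C EN (fun x => (x - x0) *: ee j0) (fun z => 'd K z (ee j1)) x dl).
  exact: (@hol_diff R EN K y (ee j1) nK).
- exact: aK.
- exact: (mul_quot_rule e1 aK).
Qed.

End Local.

(** * Divisibility of the single terms *)

Section Terms.
Variable R : realType.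
Local Notation C := (cplx R).
Local Notation VC := ('cV[cplx R]_8).
Variable rho : C -> C.
Hypothesis rho_entire : forall s : C, differentiable rho s.
Hypothesis rho_sym : forall s : C, rho s = rho (1 - s).
Variable rad : R.
Variables phi psi : VC -> C.
Hypothesis dphi : forall z, tube rad z -> differentiable phi z.
Hypothesis dpsi : forall z, tube rad z -> differentiable psi z.

(** Makes the choice of either q or f q, for each q, injective. *)
Definition separated (f : seq int -> seq int) (qs : seq (seq int)) : bool :=
  all (fun q => all (fun q' => (q == q') ||
    [&& f q != f q', q != f q' & f q != q']) qs) qs.

(** For each q the product over L has the factor rho(q) = rho(f q), coming from q or from f q, and
    these factors are at different places. *)
Lemma prod_alt (L qs : seq (seq int)) f (z : VC) :
  uniq L -> uniq qs -> separated f qs ->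
  (forall q, q \in qs -> (q \in L) || (f q \in L)) ->
  (forall q, q \in qs -> rho (ev (f q) z) = rho (ev q z)) ->
  \prod_(k <- L) rho (ev k z) = rho_prod rho qs z *
  \prod_(k <- L | k \notin [seq if q \in L then q else f q | q <- qs]) rho (ev k z).
Proof.
move=> uL uq sep HL Hf; set c := fun q => if q \in L then q else f q.
have cinj : {in qs &, injective c}.
  move=> q q' hq hq'; have := allP (allP sep _ hq) _ hq'.
  have [//|_ /= /and3P[h1 h2 h3]] := eqVneq q q'.
  by rewrite /c; case: ifP => _; case: ifP => _ e; move: h1 h2 h3; rewrite e eqxx.
have cL q : q \in qs -> c q \in L by move=> /HL; rewrite /c; case: ifP.
rewrite (bigID (mem [seq c q | q <- qs])) /=; congr (_ * _).
rewrite -big_filter (perm_big [seq c q | q <- qs]).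
  rewrite big_map /rho_prod big_seq [RHS]big_seq; apply: eq_bigr => q hq.
  by rewrite /c; case: ifP => _ //; exact: Hf.
apply: uniq_perm; rewrite ?filter_uniq// ?map_inj_in_uniq// => k.
rewrite mem_filter; apply/andP/idP => [[]//|h]; split=> //.
by have /mapP[q hq ->] := h; exact: cL.
Qed.

Definition addk (k k' : seq int) : seq int := [seq k`_i + k'`_i | i <- iota 0 8].

Lemma ev_addk (K : numFieldType) k k' (z : 'cV[K]_8) : ev (addk k k') z = ev k z + ev k' z.
Proof.
rewrite /ev -big_split; apply: eq_bigr => i _ /=.
by rewrite (nth_map 0%N) ?size_iota// nth_iota// add0n rmorphD mulrDl.
Qed.

Lemma hw_addk s k k' : hw s (addk k k') = hw s k + hw s k'.
Proof. exact: ev_addk. Qed.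

Lemma hw_opp s k : hw s (oppk k) = - hw s k.
Proof. exact: ev_opp. Qed.

Lemma d_rootE x : d_root x = sr 7 (sr 6 x).
Proof. by rewrite /d_root /wd /= /o6 /o7 !inordK. Qed.

Variables (qs : seq (seq int)) (f : seq int -> seq int).
Hypothesis uqs : uniq qs.
Hypothesis sep : separated f qs.

(** Let q = - kappa and f q = kappa' in a pair with q + f q = 1. If neither is available as a
    factor, both are positive for the word, hence so is their sum, and the factor (q + f q) - 1
    of the term vanishes. *)
Lemma divides_termA s : (forall q, q \in qs -> [/\ q \in rootl, f q \in rootl & addk q (f q) \in rootl]) ->
  exists2 N : VC -> C, (forall z, tube rad z -> differentiable N z) &
  forall z, (forall q, q \in qs -> ev (f q) z = 1 - ev q z) ->
    PsiA rho phi (act (wmx s) z) = rho_prod rho qs z * N z.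
Proof.
move=> Hq; pose L := [seq oppk k | k <- rootl & 0 < hw s k].
have inL k : k \in rootl -> (k \in L) = (hw s k < 0).
  move=> kr; apply/mapP/idP => [[k']|h].
    by rewrite mem_filter => /andP[h _] ->; rewrite hw_opp oppr_lt0.
  by exists (oppk k); rewrite ?oppkK// mem_filter oppk_rootl kr hw_opp oppr_gt0 h.
have uL : uniq L.
  rewrite map_inj_uniq ?filter_uniq ?uniq_rootl// => k k' e.
  by rewrite -(oppkK k) e oppkK.
have EL z : \prod_(k <- posl) rho (- ev k (act (wmx s) z)) = \prod_(k <- L) rho (ev k z).
  rewrite (prod_pos (fun t => rho (- t))) /L big_map big_filter.
  by apply: eq_bigr => k _; rewrite ev_opp.
have [/allP hall|/allPn[q hq]] := boolP (all (fun q => (q \in L) || (f q \in L)) qs).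
  exists (fun z => (\prod_(k <- rootl | 0 < hw s k) (ev k z - 1)) *
    (\prod_(k <- L | k \notin [seq if q \in L then q else f q | q <- qs]) rho (ev k z)) *
    phi (- act (wmx s) z)).
    move=> z tz; apply: dfM; last first.
      apply: (df_actw (f := fun z => phi (- z))); apply: df_oppv; apply: dphi.
      by apply: (proj2 (tube_opp rad _)); exact: (proj2 (tube_word rad s z)).
    apply: dfM; apply: df_prod => k; last exact: df_rho_ev.
    by apply: dfB; [exact: df_ev|exact: dfc].
  move=> z Hz; rewrite /PsiA EL (prod_pos (fun t => t - 1)).
  rewrite (prod_alt uL uqs sep hall).
    by rewrite !mulrA; congr (_ * _ * _); exact: mulrC.
  by move=> q hq; rewrite Hz// -rho_sym.
have [qr fr ar] := Hq _ hq; rewrite negb_or !inL// -!leNgt => /andP[h1 h2].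
exists (fun=> 0); first by move=> z _; exact: dfc.
move=> z Hz; rewrite /PsiA mulr0 (prod_pos (fun t => t - 1)).
rewrite -big_filter (bigD1_seq (addk q (f q))) ?filter_uniq ?uniq_rootl//=.
  by rewrite ev_addk Hz// [ev q z + _]addrC subrK subrr !mul0r.
rewrite mem_filter ar andbT hw_addk lt_def addr_ge0// andbT.
by rewrite -hw_addk hw_neq0.
Qed.

(** As for the other sum, with c replaced by c': its factors come only from roots that d maps into
    R'. Roots that d maps to positive roots outside R' are always available. *)
Lemma divides_termB s : {subset s <= J7} ->
  (forall q, q \in qs -> q \in rootl) ->
  (forall q, q \in qs -> (0 < (d_root q)`_7) && (f q == q) || [&& f q != q, f q \in rootl,
     oppk (addk q (f q)) \in rootl & (d_root (oppk (addk q (f q))))`_7 == 0]) ->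
  exists2 N : VC -> C, (forall z, tube rad z -> differentiable N z) &
  forall z, (forall q, q \in qs -> (f q == q) || (ev (f q) z == 1 - ev q z)) ->
    PsiB rho psi (act (wmx s) (act d_mx z)) = rho_prod rho qs z * N z.
Proof.
move=> sJ qr Hq; set t := s ++ [:: o7; o6]; pose L := [seq k <- rootl | 0 < hw t k].
have tE z : act (wmx s) (act d_mx z) = act (wmx t) z :> VC.
  by rewrite dmxE -actM -wmx_cat.
have inL k : k \in rootl -> (k \in L) = (0 < hw t k) by move=> kr; rewrite mem_filter kr andbT.
have uL : uniq L by rewrite filter_uniq// uniq_rootl.
have EL z : \prod_(k <- posl) rho (ev k (act (wmx t) z)) = \prod_(k <- L) rho (ev k z).
  by rewrite (prod_pos rho) /L big_filter.
have [/allP hall|/allPn[q hq]] := boolP (all (fun q => (q \in L) || (f q \in L)) qs).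
  exists (fun z => (\prod_(k <- posl7) (ev k (act (wmx t) z) + 1)) *
    (\prod_(k <- L | k \notin [seq if q \in L then q else f q | q <- qs]) rho (ev k z)) *
    psi (act (wmx t) z)).
    move=> z tz; apply: dfM; last first.
      by apply: df_actw; apply: dpsi; exact: (proj2 (tube_word rad t z)).
    apply: dfM; last by apply: df_prod => k; exact: df_rho_ev.
    apply: df_prod => k.
    by apply: dfD; [apply: df_actw; exact: df_ev|exact: dfc].
  move=> z Hz; rewrite tE /PsiB EL.
  rewrite (prod_alt uL uqs sep hall).
    by rewrite !mulrA; congr (_ * _ * _); exact: mulrC.
  move=> q hq; have /orP[/eqP->//|/eqP->] := Hz _ hq; by rewrite -rho_sym.
have qr' := qr _ hq; have [/andP[out _]|/and4P[fq fr ar a7]] := orP (Hq _ hq).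
  by rewrite negb_or inL// out_pos.
rewrite negb_or !inL// -!leNgt => /andP[h1 h2].
exists (fun=> 0); first by move=> z _; exact: dfc.
have hs : 0 < hw t (oppk (addk q (f q))).
  by rewrite lt_def hw_neq0// andTb hw_opp hw_addk oppr_ge0 -[leRHS](addr0 0) lerD.
move=> z Hz; rewrite tE /PsiB mulr0.
rewrite (prod_pos7 (fun t => t + 1))//.
have eg : ev (oppk (addk q (f q))) z = -1.
  have /orP[e|/eqP e] := Hz _ hq; first by rewrite e in fq.
  by rewrite ev_opp ev_addk e [ev q z + _]addrC subrK.
move: (oppk (addk q (f q))) ar a7 hs eg => g gr g7 hs eg.
rewrite -big_filter (bigD1_seq g) ?filter_uniq ?uniq_rootl//=.
  by rewrite eg addNr !mul0r.
by rewrite mem_filter gr g7 hs.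
Qed.

End Terms.

(** * Divisibility of the two numerators *)

(** The forms [q] and [q'] have sum 1 on the whole deformation in the directions [v] and [u]. *)
Definition dualb (v u q q' : seq int) : bool :=
  [&& q'`_7 == - q`_7, val0 q' == 1 - val0 q, dp q' v == - dp q v & dp q' u == - dp q u].

(** The hypothesis of [local_quotient] on a root, decided on coefficients when Re x0 is not an
    integer. If [b] holds then the highest root, of value 11 + 2 x, is known not to vanish at x0. *)
Definition transverse (b : bool) (v u : seq int) (qs : seq (seq int)) (k : seq int) : bool :=
  [|| (k`_7 == 0) && ((val0 k != 0) || (dp k u != 0)), (k`_7 == 1) || (k`_7 == -1) |
   [&& k`_7 == 2, val0 k == 11 & b ||
    [&& dp k v == 0, dp k u == 0 & all (fun q => dp q u != 0) qs]]].

Section Side.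
Variable R : realType.
Local Notation C := (cplx R).
Local Notation VC := ('cV[cplx R]_8).
Variable rho : C -> C.
Hypothesis rho_entire : forall s : C, differentiable rho s.
Hypothesis rho_sym : forall s : C, rho s = rho (1 - s).
Hypothesis rho_zeroes : forall s : C, rho s = 0 -> 0 < complex.Re s < 1.
Variable rad : R.
Hypothesis rad_gt0 : 0 < rad.
Variables phi psi : VC -> C.
Hypothesis dphi : forall z, tube rad z -> differentiable phi z.
Hypothesis dpsi : forall z, tube rad z -> differentiable psi z.
Variables A B : VC -> C.
Hypothesis dA : forall z, tube rad z -> differentiable A z.
Hypothesis dB : forall z, tube rad z -> differentiable B z.
Hypothesis HA : forall z, tube rad z -> asum Jall posl (PsiA rho phi) z = pl posl z * A z.
Hypothesis HB : forall z, tube rad z -> asum J7 posl7 (PsiB rho psi) z = pl posl7 z * B z.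

(** The cofactors of the finitely many terms add up. *)
Lemma asum_divides (J : {set 'I_8}) (L : seq (seq int)) Psi (D : VC -> VC) (P : VC -> Prop) (Q : VC -> C) :
  (forall s, {subset s <= J} -> exists2 N : VC -> C,
     (forall z, tube rad z -> differentiable N z) &
     forall z, P z -> Psi (act (wmx s) (D z)) = Q z * N z) ->
  exists2 N : VC -> C, (forall z, tube rad z -> differentiable N z) &
  forall z, P z -> asum J L Psi (D z) = Q z * N z.
Proof.
move=> H.
have H' (w : 'M[int]_8) : exists N : VC -> C, weyl J w ->
    (forall z, tube rad z -> differentiable N z) /\
    forall z, P z -> Psi (act w (D z)) = Q z * N z.
  have [[s sJ ->]|nw] := pselect (weyl J w); last by exists (fun=> 0).
  by have [N dN HN] := H s sJ; exists N.
have [N HN] := boolp.choice H'.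
have fW : finite_set (weyl J) by apply: sub_finite_set finite_W; exact: weyl_sub.
exists (fun z => \sum_(w <- finmap.enum_fset (fset_set (weyl J))) sgnw R L w * N w z).
  move=> z tz; apply: df_in_sum => w; rewrite in_fset_set// inE => /HN[dN _].
  by apply: dfM; [exact: dfc|exact: dN].
move=> z Pz; rewrite /asum fsbig_finite//= mulr_sumr big_seq [RHS]big_seq.
apply: eq_bigr => w; rewrite in_fset_set// inE => /HN[_ ->]//.
by rewrite mulrCA.
Qed.

Variable x0 : C.
Hypothesis x0_int : forall m : int, x0 + m%:~R != 0.
Hypothesis tx0 : tube rad (lam x0).
Variable b : bool.
Hypothesis x0_half : b -> 11 + x0 * 2 != 0.

Lemma ev_lam_dual v u q q' (z : 'cV[C]_3) : dualb v u q q' ->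
  ev q' (Lam x0 v u z) = 1 - ev q (Lam x0 v u z).
Proof.
move=> /and4P[/eqP e7 /eqP e0 /eqP ev_ /eqP eu].
rewrite !ev_Lam !(ev_lam _ x0) !ev_lam0 e7 e0 ev_ eu.
rewrite !rmorphN !rmorphB /= rmorph1 !mulrN; ring.
Qed.

Lemma transverseP v u qs k : transverse b v u qs k ->
  [\/ ev k (lam x0 : VC) != 0, k`_7 = 0 /\ dp k u != 0 |
  [/\ k`_7 != 0, dp k v = 0, dp k u = 0 & forall q, q \in qs -> dp q u != 0]].
Proof.
rewrite (ev_lam _ x0) ev_lam0.
case/or3P=> [/andP[/eqP k7 /orP[k0|ku]]|/orP[/eqP k7|/eqP k7]|/and3P[/eqP k7 /eqP k0 hb]].
- by apply: Or31; rewrite k7 mulr0 addr0 intr_eq0.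
- exact: Or32.
- by apply: Or31; rewrite k7 mulr1 addrC x0_int.
- apply: Or31; rewrite k7 mulrN1 -oppr_eq0 opprB -rmorphN.
  exact: x0_int.
- rewrite k7 k0; case/orP: hb => [hb|/and3P[/eqP hv /eqP hu /allP hq]].
    by apply: Or31; exact: x0_half.
  by apply: Or33; split.
Qed.

(** What has to be verified about v, u and the pairing f, for the forms in [qs]. *)
Definition dataA (v u : seq int) (qs : seq (seq int)) (f : seq int -> seq int) : bool :=
  [&& uniq qs, separated f qs,
   all (fun q => [&& q \in rootl, f q \in rootl, addk q (f q) \in rootl,
     dualb v u q (f q) & q`_7 != 0]) qs &
   all (transverse b v u qs) posl].

Lemma local_A v u qs f : dataA v u qs f ->
  div_value A (rho_prod rho qs) x0 /\ div_deriv A (rho_prod rho qs) x0 (lat R v).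
Proof.
case/and4P=> uqs sep /allP Hq /allP HL.
apply: (@local_good R rho rho_entire rho_zeroes rad rad_gt0 x0 v u posl qs A
  (asum Jall posl (PsiA rho phi)) dA).
- by move=> z tz; exact: HA.
- have Hs s : {subset s <= Jall} -> exists2 N : VC -> C,
      (forall z, tube rad z -> differentiable N z) &
      forall z, (forall q, q \in qs -> ev (f q) z = 1 - ev q z) ->
      PsiA rho phi (act (wmx s) z) = rho_prod rho qs z * N z.
    by move=> _; apply: divides_termA => // q /Hq /and5P[].
  have [N dN HN] := @asum_divides Jall posl _ (fun z => z) _ _ Hs.
  exists (fun z => N (Lam x0 v u z)).
    by move=> z tz; apply: df_Lam_comp; exact: dN.
  move=> z _; apply: HN => q /Hq /and5P[_ _ _ hd _]; exact: ev_lam_dual hd.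
- by move=> k /Hq /and5P[].
- by move=> k /HL; exact: transverseP.
- exact: tx0.
Qed.

(** Here a root mapped by d to a positive root outside R' is its own partner. In coefficients, d is
    [sr 7 (sr 6 _)], and [sr 6 (sr 7 _)] its inverse. *)
Definition dataB (v u : seq int) (qs : seq (seq int)) (f : seq int -> seq int) : bool :=
  [&& uniq qs, separated f qs,
   all (fun q => [&& q \in rootl, (f q == q) || dualb v u q (f q), q`_7 != 0 &
     (0 < (sr 7 (sr 6 q))`_7) && (f q == q) || [&& f q != q, f q \in rootl,
     oppk (addk q (f q)) \in rootl & (sr 7 (sr 6 (oppk (addk q (f q)))))`_7 == 0]]) qs &
   all (fun k => transverse b v u qs (sr 6 (sr 7 k))) posl7].

Lemma local_B v u qs f : dataB v u qs f ->
  div_value (fun z => B (act d_mx z)) (rho_prod rho qs) x0 /\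
  div_deriv (fun z => B (act d_mx z)) (rho_prod rho qs) x0 (lat R v).
Proof.
case/and4P=> uqs sep /allP Hq /allP HL.
apply: (@local_good R rho rho_entire rho_zeroes rad rad_gt0 x0 v u
  [seq wd [:: o7; o6] k | k <- posl7] qs (fun z => B (act d_mx z))
  (fun z => asum J7 posl7 (PsiB rho psi) (act d_mx z)) (df_Bd dB)).
- move=> z tz; rewrite HB; last exact: tube_d.
  by rewrite /pl big_map dmxE; under eq_bigr do rewrite ev_word.
- have Hs s : {subset s <= J7} -> exists2 N : VC -> C,
      (forall z, tube rad z -> differentiable N z) &
      forall z, (forall q, q \in qs -> (f q == q) || (ev (f q) z == 1 - ev q z)) ->
      PsiB rho psi (act (wmx s) (act d_mx z)) = rho_prod rho qs z * N z.
    move=> sJ; apply: divides_termB => // q /Hq /and4P[]//.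
    by rewrite !d_rootE.
  have [N dN HN] := @asum_divides J7 posl7 _ (fun z => act d_mx z) _ _ Hs.
  exists (fun z => N (Lam x0 v u z)).
    by move=> z tz; apply: df_Lam_comp; exact: dN.
  move=> z _; apply: HN => q /Hq /and4P[_ hd _ _].
  by case/orP: hd => [->//|/ev_lam_dual->]; rewrite eqxx orbT.
- by move=> k /Hq /and4P[].
- move=> k /mapP[k' /HL h ->]; apply: transverseP.
  by move: h; rewrite /wd /= /o6 /o7 !inordK.
- exact: tx0.
Qed.

End Side.

(** * Combining directions and cancelling the denominators *)

Definition int_comb (n : seq int) (L : seq (int * seq int)) : bool :=
  all (fun i => dotC i n == foldr (fun p s => p.1 * dotC i p.2 + s) 0 L) (iota 0 8).

Section Assemble.
Variable R : realType.
Local Notation C := (cplx R).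
Local Notation VC := ('cV[cplx R]_8).
Local Notation VN := ('cV[cplx R]_8 : normedModType (cplx R)).
Variable rho : C -> C.
Hypothesis rho_entire : forall s : C, differentiable rho s.
Hypothesis rho_zeroes : forall s : C, rho s = 0 -> 0 < complex.Re s < 1.

Section Good.
Variables (a q : VC -> C) (x0 : C).
Local Notation div_deriv := (div_deriv a q x0).

Lemma wronskianD (L L' : {linear VC -> C}) (w p k k' : C) n n' :
  L n * p - w * L' n = k * p ^+ 2 -> L n' * p - w * L' n' = k' * p ^+ 2 ->
  L (n + n') * p - w * L' (n + n') = (k + k') * p ^+ 2.
Proof. by move=> h h'; rewrite !linearD [RHS]mulrDl -h -h'; ring. Qed.

Lemma wronskianZ (L L' : {linear VC -> C}) (c w p k : C) n :
  L n * p - w * L' n = k * p ^+ 2 ->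
  L (c *: n) * p - w * L' (c *: n) = (c * k) * p ^+ 2.
Proof.
move=> h; have E (f : {linear VC -> C}) : f (c *: n) = c * f n by rewrite linearZ.
by rewrite !E -[RHS]mulrA -h; ring.
Qed.

Lemma div_derivD n n' : div_deriv n -> div_deriv n' -> div_deriv (n + n').
Proof.
move=> [k [r [r0 Hr]]] [k' [r' [r'0 Hr']]].
exists (fun x => k x + k' x), (Num.min r r'); split; first by rewrite lt_min r0.
move=> x; rewrite lt_min => /andP[/Hr[dk h] /Hr'[dk' h']].
split; first exact: dfD.
exact: (wronskianD h h').
Qed.

Lemma div_derivZ c n : div_deriv n -> div_deriv (c *: n).
Proof.
move=> [k [r [r0 Hr]]]; exists (fun x => c * k x), r; split => // x /Hr[dk h].
split; first exact: (dfM (dfc c x) dk).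
exact: (wronskianZ c h).
Qed.

Lemma wronskian0 (w p da dp : C) : da = 0 -> dp = 0 -> da * p - w * dp = 0 * p ^+ 2.
Proof. by move=> -> ->; rewrite !mul0r mulr0 subrr. Qed.

Lemma div_deriv0 : div_deriv 0.
Proof.
exists (fun=> 0), 1; split=> // x _; split; first exact: dfc.
exact: (wronskian0 _ _ (linear0 _) (linear0 _)).
Qed.

Lemma div_deriv_comb n L : int_comb n L ->
  (forall p, p \in L -> div_deriv (lat R p.2)) -> div_deriv (lat R n).
Proof.
move=> hn HL.
have -> : lat R n = foldr (fun p w => p.1%:~R *: lat R p.2 + w) 0 L.
  apply/matrixP => i z; rewrite ord1 {z}.
  have E v : lat R v i 0 = (dotC i v)%:~R by rewrite [lat R v i 0]mxE vecE.
  rewrite E; have /eqP -> := all8P hn i.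
  elim: L {hn HL} => [|p L IH]; first by rewrite mxE.
  have D (c : C) (v w : VC) : (c *: v + w) i 0 = c * v i 0 + w i 0 by rewrite !mxE.
  by rewrite /= D E -IH rmorphD rmorphM.
elim: L HL {hn} => [|p L IH] HL; first exact: div_deriv0.
apply: div_derivD; first by apply: div_derivZ; apply: HL; rewrite inE eqxx.
by apply: IH => p' h; apply: HL; rewrite inE h orbT.
Qed.

End Good.

(** The restriction to the line through z orthogonal to the mirror is even. *)
Lemma d_mirror (f : VC -> C) (j : 'I_8) (z : VC) (r : R) : 0 < r ->
  differentiable f z -> z j 0 = 0 ->
  (forall w, nrm (w - z : VN) < r -> f (act (simple_refl j) w) = f w) ->
  'd f z (of_int_mx C (simple_root j)) = 0.
Proof.
move=> r0 df zj Hf; set v := of_int_mx C (simple_root j).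
have e1 := @diff_line R VN f z v df.
have e2 := @diff_line R VN f z (- v) df.
have [s s0 Hs] : exists2 s : R, 0 < s & forall t : C, nrm t < s -> nrm (z + t *: v - z : VN) < r.
  have oU : @open_dom R VN (fun w => nrm (w - z) < r).
    move=> w hw; exists (r - nrm (w - z : VN)); first by rewrite subr_gt0.
    move=> w' hw'; rewrite -(subrK w w') -addrA; apply: le_lt_trans (nrmD _ _) _.
    by rewrite -ltrBrDr.
  by apply: (open_line v oU); rewrite subrr nrm0.
have refl (t : C) : act (simple_refl j) (z + t *: v) = z + t *: (- v).
  have hj : (z + t *: v) j 0 = t + t.
    by rewrite mxE zj add0r mxE [v j 0]mxE root_diag mulr_natr mulr2n.
  by rewrite act_refl hj -/v scalerDl opprD !addrA addrK scalerN.
have h : 'd (fun t : C => f (z + t *: v)) 0 1 = 'd (fun t : C => f (z + t *: - v)) 0 1.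
  apply: (proj2 (@near_eq_diff R C _ _ 0 _ _)).
    apply/(@nearP R C); exists s; first exact: s0.
    move=> t; rewrite subr0 => /Hs/Hf <-.
    by rewrite refl.
  apply: (@df_comp R C VN (fun t : C => z + t *: - v) f 0 (@df_line R VN z (- v) 0)).
  by rewrite scale0r addr0.
have : 'd f z v = - 'd f z v.
  by rewrite -(linearN ('d f z)) -e1 -e2.
by move/eqP; rewrite -addr_eq0 -mulr2n mulrn_eq0 => /eqP.
Qed.

Lemma rho_prod_refl (qs : seq (seq int)) (j : 'I_8) z :
  perm_eq [seq sr j q | q <- qs] qs -> rho_prod rho qs (act (simple_refl j) z) = rho_prod rho qs z.
Proof.
move=> p; rewrite /rho_prod; under eq_bigr do rewrite ev_refl.
by rewrite -(big_map (sr j) xpredT (fun k => rho (ev k z))) (perm_big _ p).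
Qed.

Variable rad : R.
Hypothesis rad_gt0 : 0 < rad.
Variables phi psi : VC -> C.
Variables A B : VC -> C.
Hypothesis dA : forall z, tube rad z -> differentiable A z.
Hypothesis dB : forall z, tube rad z -> differentiable B z.
Hypothesis HA : forall z, tube rad z -> asum Jall posl (PsiA rho phi) z = pl posl z * A z.
Hypothesis HB : forall z, tube rad z -> asum J7 posl7 (PsiB rho psi) z = pl posl7 z * B z.
Local Notation F := (fun z => Sigma_W rho phi z * Sigma_W'd rho psi z).
Local Notation f := (normal_deriv (regular_locus rho rad) F).

Lemma A_refl (j : 'I_8) z : tube rad z -> A (act (simple_refl j) z) = A z.
Proof.
move=> tz; apply: (quotient_refl parab_all (tube_dom rad_gt0) _ _ dA HA tz); first by rewrite inE.
move=> w; have := tube_word rad [:: j] w; rewrite /wmx big_seq1 => h; exact: (proj2 h).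
Qed.

(** The reflection s_j fixes L_0 pointwise, A is the quotient of two alternating functions, and s_j
    permutes the factors of [rho_prod]. *)
Lemma div_deriv_mirror (qs : seq (seq int)) (j : 'I_8) x0 :
  tube rad (lam x0) -> (lam 0 : VC) j 0 = 0 -> j != ord_max ->
  perm_eq [seq sr j q | q <- qs] qs ->
  div_deriv A (rho_prod rho qs) x0 (of_int_mx C (simple_root j)).
Proof.
move=> tx l0 jm p; have [r [r0 Hr]] := near_tube rad_gt0 tx.
exists (fun=> 0), r; split => // x /Hr tx'; split; first exact: dfc.
have lj : (lam x : VC) j 0 = 0.
  by rewrite lamE mxE l0 add0r mxE [omega8 R j 0]mxE (negbTE jm) mulr0.
have [r' r'0 Hr'] := tube_dom rad_gt0 tx'.
have hA := @d_mirror A j (lam x) r' r'0 (dA tx') lj (fun w hw => A_refl j (Hr' w hw)).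
have hQ := @d_mirror (rho_prod rho qs) j (lam x) r' r'0 (df_rho_prod rho_entire qs (lam x)) lj
  (fun w _ => rho_prod_refl w p).
exact: (wronskian0 _ _ hA hQ).
Qed.

(** Where [rho_all] is nonzero the formula for the normal derivative has no pole. *)
Lemma holo_regular n x0 : tube rad (lam x0) -> rho_all rho (lam x0) != 0 ->
  holomorphic_at (f n) x0.
Proof.
move=> tx rx.
have [r r0 Hr] := near_tube rad_gt0 tx.
have dR y : differentiable (fun x => rho_all rho (lam x)) y.
  by apply: df_lam_comp; exact: df_rho_all.
have [r' r'0 Hr'] := diff_near (dR x0) (nrm_gt0 rx).
have rn y : nrm (y - x0) < r' -> rho_all rho (lam y) != 0.
  by move=> /Hr' h; apply: contraTneq h => ->; rewrite sub0r nrmN ltxx.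
exists (normal_value rho A B n); split.
  apply/nearP; exists (Num.min r r'); first by rewrite lt_min r0.
  move=> x; rewrite lt_min => /andP[/Hr tx' /rn ux].
  apply: df_div.
  - exact: (df_num rho_entire rad_gt0 dA dB n tx').
  - exact: dfX.
  - by rewrite expf_neq0.
apply/dnearP; exists (Num.min r r'); first by rewrite lt_min r0.
move=> x; rewrite lt_min => /andP[/Hr tx' /rn ux] _.
exact: (normal_deriv_val rho_entire rad_gt0 dA dB HA HB n tx' ux).
Qed.

(** Both quotient rules produce the factor (q_a q_b)^2, which cancels the one in the denominator. *)
Lemma assemble_rule (P Q dP dQ a b da db qa qb dqa dqb U dU k0 k1 m0 m1 : C) :
  dP = a * db + b * da -> P = a * b -> Q = qa * qb * U ->
  dQ = qa * qb * dU + U * (qa * dqb + qb * dqa) ->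
  qa != 0 -> qb != 0 -> U != 0 ->
  a = qa * k0 -> da * qa - a * dqa = k1 * qa ^+ 2 ->
  b = qb * m0 -> db * qb - b * dqb = m1 * qb ^+ 2 ->
  (dP * Q - P * dQ) / Q ^+ 2 = (k1 * m0 + k0 * m1 - k0 * m0 * (dU / U)) / U.
Proof.
move=> -> -> -> -> qa0 qb0 U0 -> h1 -> h2.
have -> : (qa * k0 * db + qb * m0 * da) * (qa * qb * U) -
   qa * k0 * (qb * m0) * (qa * qb * dU + U * (qa * dqb + qb * dqa)) =
   (da * qa - qa * k0 * dqa) * (qb ^+ 2 * m0 * U) +
   (db * qb - qb * m0 * dqb) * (qa ^+ 2 * k0 * U) -
   qa ^+ 2 * qb ^+ 2 * k0 * m0 * dU by ring.
by rewrite h1 h2; field; rewrite qa0 qb0 U0.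
Qed.

(** The punctured neighbourhood is chosen so that q_a and q_b, whose zeros on L_0 are isolated, do
    not vanish on it. *)
Lemma holo_assemble (qa qb : seq (seq int)) n x0 : tube rad (lam x0) ->
  uniq (qa ++ qb) -> all (mem rootl) (qa ++ qb) ->
  (forall k, k \in qa ++ qb -> k`_7 != 0) ->
  (forall k, k \in rootl -> k \notin qa ++ qb -> rho (ev k (lam x0)) != 0) ->
  div_value A (rho_prod rho qa) x0 -> div_deriv A (rho_prod rho qa) x0 n ->
  div_value (fun z => B (act d_mx z)) (rho_prod rho qb) x0 ->
  div_deriv (fun z => B (act d_mx z)) (rho_prod rho qb) x0 n ->
  holomorphic_at (f n) x0.
Proof.
move=> tx0 uq /allP sub q7 Hrest [k0 [r1 [r10 H1]]] [k1 [r2 [r20 H2]]]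
  [m0 [r3 [r30 H3]]] [m1 [r4 [r40 H4]]].
pose rest := [seq k <- rootl | k \notin qa ++ qb].
pose U := rho_prod rho rest.
have RE z : rho_all rho z = rho_prod rho qa z * rho_prod rho qb z * U z.
  rewrite /rho_all (bigID (mem (qa ++ qb))) /= -big_filter (perm_big (qa ++ qb)).
    by rewrite big_cat /U /rho_prod big_filter.
  apply: uniq_perm; rewrite ?filter_uniq ?uniq_rootl// => k.
  by rewrite mem_filter; apply/andP/idP => [[]//|h]; split=> //; exact: sub.
have dU z : differentiable U z by exact: df_rho_prod.
have U0 : U (lam x0) != 0.
  rewrite /U /rho_prod prodf_seq_neq0; apply/allP => k; rewrite mem_filter => /andP[kn kr].
  exact: Hrest.
have dUl y : differentiable (fun x => U (lam x)) y by apply: df_lam_comp.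
have [r5 r50 H5] := diff_near (dUl x0) (nrm_gt0 U0).
have Un y : nrm (y - x0) < r5 -> U (lam y) != 0.
  by move=> /H5 h; apply: contraTneq h => ->; rewrite sub0r nrmN ltxx.
have [r6 r60 H6] := near_tube rad_gt0 tx0.
have [r7 r70 H7] : exists2 r : R, 0 < r & forall t : C, 0 < nrm t < r ->
    \prod_(k <- qa ++ qb) rho (ev k (lam x0) + t * (k`_7)%:~R) != 0.
  by apply: rho_line => // k /q7; rewrite intr_eq0.
have Qn x : 0 < nrm (x - x0) < r7 -> rho_prod rho qa (lam x) != 0 /\ rho_prod rho qb (lam x) != 0.
  move=> /H7; under eq_bigr do rewrite -ev_omega8 -evZ -evD.
  have -> : lam x0 + (x - x0) *: omega8 R = lam x.
    by rewrite (lamE x) (lamE x0) -addrA -scalerDl [x0 + _]addrC subrK.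
  by rewrite big_cat mulf_eq0 negb_or => /andP.
pose r := Num.min (Num.min (Num.min r1 r2) (Num.min r3 r4)) (Num.min (Num.min r5 r6) r7).
have r0 : 0 < r by rewrite !lt_min r10 r20 r30 r40 r50 r60.
pose g x := (k1 x * m0 x + k0 x * m1 x - k0 x * m0 x * ('d U (lam x) n / U (lam x))) / U (lam x).
exists g; split.
  apply/nearP; exists r; first exact: r0.
  move=> x; rewrite !lt_min => /andP[/andP[/andP[h1 h2] /andP[h3 h4]] /andP[/andP[h5 h6] h7]].
  have [dk0 _] := H1 _ h1; have [dk1 _] := H2 _ h2.
  have [dm0 _] := H3 _ h3; have [dm1 _] := H4 _ h4.
  have ddU : differentiable (fun x => 'd U (lam x) n) x.
    apply: (df_lam_comp (f := fun z => 'd U z n)); apply: (@hol_diff R VN).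
    by apply/(@nearP R VN); exists 1; [exact: ltr01|move=> w _; exact: dU].
  have Ux := Un _ h5.
  exact: (df_div (dfB (dfD (dfM dk1 dm0) (dfM dk0 dm1))
    (dfM (dfM dk0 dm0) (df_div ddU (dUl x) Ux))) (dUl x) Ux).
apply/dnearP; exists r; first exact: r0.
move=> x; rewrite !lt_min => /andP[/andP[/andP[h1 h2] /andP[h3 h4]] /andP[/andP[h5 h6] h7]] xn.
have [_ e0] := H1 _ h1; have [_ e1] := H2 _ h2.
have [_ e2] := H3 _ h3; have [_ e3] := H4 _ h4.
have Ux := Un _ h5; have tx := H6 _ h6.
have [qa0 qb0] : rho_prod rho qa (lam x) != 0 /\ rho_prod rho qb (lam x) != 0.
  by apply: Qn; rewrite h7 andbT; apply: nrm_gt0; rewrite subr_eq0.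
have rx : rho_all rho (lam x) != 0 by rewrite RE !mulf_neq0.
have h := normal_deriv_val rho_entire rad_gt0 dA dB HA HB n tx rx.
have dP := dM_E n (dA tx) (df_Bd dB tx).
have dQQ := dM_E n (df_rho_prod rho_entire qa (lam x)) (df_rho_prod rho_entire qb (lam x)).
have dQU := dM_E n (dfM (df_rho_prod rho_entire qa (lam x)) (df_rho_prod rho_entire qb (lam x))) (dU (lam x)).
have dR : 'd (rho_all rho) (lam x) n = rho_prod rho qa (lam x) * rho_prod rho qb (lam x) * 'd U (lam x) n +
    U (lam x) * (rho_prod rho qa (lam x) * 'd (rho_prod rho qb) (lam x) n +
                 rho_prod rho qb (lam x) * 'd (rho_prod rho qa) (lam x) n).
  apply: (etrans (congr1 (fun h : VC -> C => 'd (h : VN -> C) (lam x) n) (funext RE))).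
  apply: (etrans dQU).
  exact: (congr1 (fun t => _ + U (lam x) * t) dQQ).
have e : normal_value rho A B n x = g x := assemble_rule dP erefl (RE _) dR qa0 qb0 Ux e0 e1 e2 e3.
by rewrite -e.
Qed.

End Assemble.

(** * The two intervals and their pairings *)

(** The roots whose value on L_0 is K + x; the coefficient of index 7 is that of Bourbaki's alpha_8. *)
Definition level (K : int) : seq (seq int) := [seq x <- rootl | (x`_7 == 1) && (val0 x == K)].

(** The partner of q; roots absent from the list are their own partners. *)
Definition alt (M : seq (seq int * seq int)) (q : seq int) : seq int :=
  nth q (unzip2 M) (index q (unzip1 M)).

(** The lists of pairs below consist of (kappa, kappa') with kappa of level K - 1 and kappa' of
    level K. For A the form - kappa has the partner kappa'; for B the form kappa' has the partner
    - kappa. *)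
Definition altA (M : seq (seq int * seq int)) := alt [seq (oppk p.1, p.2) | p <- M].
Definition altB (M : seq (seq int * seq int)) := alt [seq (p.2, oppk p.1) | p <- M].

Definition hroot : seq int := [:: 2; 3; 4; 6; 5; 4; 3; 2].
(** For A the factors are at - kappa, because the terms of Sigma_W contain [rho] at negative roots. *)
Definition qsA K := [seq oppk k | k <- level (K - 1)].
Definition qsB K := rcons (level K) hroot.

(** For K = 5 the directions v of two pairings are combined. The two roots of each pair agree on v
    and on u, and u is chosen such that [transverse] holds. *)
Definition v5a : seq int := [:: 2; 1; 2; 4; 1; 0; 1; 0].
Definition u5a : seq int := [:: 0; -1; -1; -1; -2; -2; -1; 0].
Definition pairs5a : seq (seq int * seq int) :=
  [:: ([:: 0;1;1;2;2;2;2;1], [:: 1;1;2;2;2;2;2;1]); ([:: 1;1;1;2;1;1;1;1], [:: 1;1;2;3;2;1;1;1]);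
      ([:: 1;1;2;2;2;2;1;1], [:: 1;2;2;3;3;2;1;1]); ([:: 1;1;1;2;2;1;1;1], [:: 1;2;2;3;2;1;1;1]);
      ([:: 1;1;2;2;1;1;1;1], [:: 1;1;2;3;2;2;1;1]); ([:: 1;1;2;2;2;1;1;1], [:: 1;1;2;3;3;2;1;1]);
      ([:: 1;1;1;2;2;2;1;1], [:: 1;2;2;3;2;2;1;1])].
Definition v5b : seq int := [:: 0; 0; 2; 2; 2; 0; 0; 0].
Definition u5b : seq int := [:: -1; -1; 0; -1; 0; -1; -1; 0].
Definition pairs5b : seq (seq int * seq int) :=
  [:: ([:: 0;1;1;2;2;2;2;1], [:: 1;1;2;2;2;2;2;1]); ([:: 1;1;1;2;1;1;1;1], [:: 1;1;1;2;2;2;2;1]);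
      ([:: 1;1;2;2;2;2;1;1], [:: 1;2;2;3;3;2;1;1]); ([:: 1;1;1;2;2;1;1;1], [:: 1;2;2;3;2;1;1;1]);
      ([:: 1;1;2;2;1;1;1;1], [:: 1;1;2;3;2;2;1;1]); ([:: 1;1;1;2;2;2;1;1], [:: 1;2;2;3;2;2;1;1]);
      ([:: 1;1;2;2;2;1;1;1], [:: 1;1;2;3;3;2;1;1])].
(** For K = 6 one direction v and simple roots alpha_j combine to n. *)
Definition v6 : seq int := [:: 2; 2; 3; 6; 5; 2; 1; 0].
Definition u6 : seq int := [:: 0; 1; 1; 0; -2; 0; 0; 0].
Definition pairs6 : seq (seq int * seq int) :=
  [:: ([:: 1;1;2;3;2;2;1;1], [:: 1;1;2;3;2;2;2;1]); ([:: 1;2;2;3;2;1;1;1], [:: 1;2;3;4;3;2;1;1]);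
      ([:: 1;1;2;2;2;2;2;1], [:: 1;2;2;3;3;3;2;1]); ([:: 1;1;2;3;2;1;1;1], [:: 1;2;2;4;3;2;1;1]);
      ([:: 1;1;2;3;3;2;1;1], [:: 1;1;2;3;3;2;2;1]); ([:: 1;2;2;3;2;2;1;1], [:: 1;2;2;3;2;2;2;1]);
      ([:: 1;1;1;2;2;2;2;1], [:: 1;1;2;3;3;3;2;1]); ([:: 1;2;2;3;3;2;1;1], [:: 1;2;2;3;3;2;2;1])].
(** The direction n itself. *)
Definition vB : seq int := [:: 2; 3; 4; 6; 5; 4; 1; 0].
Definition uB : seq int := [:: 0; 0; 0; -1; 0; 0; 0; 0].

Definition pairsB5 : seq (seq int * seq int) :=
  [:: ([:: 1;1;2;2;1;1;1;1], [:: 1;2;2;3;2;1;1;1]); ([:: 1;1;2;2;2;1;1;1], [:: 1;1;2;2;2;2;2;1]);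
      ([:: 1;1;1;2;1;1;1;1], [:: 1;1;2;3;2;1;1;1]); ([:: 1;1;1;2;2;1;1;1], [:: 1;1;1;2;2;2;2;1])].
Definition pairsB6 : seq (seq int * seq int) :=
  [:: ([:: 1;2;2;3;2;1;1;1], [:: 1;2;2;3;2;2;2;1]); ([:: 1;1;2;2;2;2;2;1], [:: 1;2;2;3;3;2;2;1]);
      ([:: 1;1;2;3;2;1;1;1], [:: 1;1;2;3;2;2;2;1]); ([:: 1;1;1;2;2;2;2;1], [:: 1;1;2;3;3;2;2;1])].

Lemma dataA5a : dataA true v5a u5a (qsA 5) (altA pairs5a).
Proof. by rewrite /dataA /qsA /level /rootl posl.unlock; vm_compute. Qed.

Lemma dataA5b : dataA true v5b u5b (qsA 5) (altA pairs5b).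
Proof. by rewrite /dataA /qsA /level /rootl posl.unlock; vm_compute. Qed.

Lemma dataA6 : dataA false v6 u6 (qsA 6) (altA pairs6).
Proof. by rewrite /dataA /qsA /level /rootl posl.unlock; vm_compute. Qed.

Lemma dataB5 : dataB true vB uB (qsB 5) (altB pairsB5).
Proof. by rewrite /dataB /qsB /level /rootl /posl7 posl.unlock; vm_compute. Qed.

Lemma dataB6 : dataB false vB uB (qsB 6) (altB pairsB6).
Proof. by rewrite /dataB /qsB /level /rootl /posl7 posl.unlock; vm_compute. Qed.

(** 1, 2, 4, 5 are the simple reflections fixing L_0 that are used to complete v to n. *)
Lemma qs_check : all (fun K => [&& uniq (qsA K ++ qsB K), all (mem rootl) (qsA K ++ qsB K),
  all (fun k => k`_7 != 0) (qsA K ++ qsB K) &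
  all (fun j => perm_eq [seq sr j q | q <- qsA K] (qsA K)) [:: 1; 2; 4; 5]%N]) [:: 5; 6].
Proof. by rewrite /qsA /qsB /level /rootl posl.unlock; vm_compute. Qed.

(** The only roots with k_8 = 2 or -2 are the highest and the lowest root, whose values on L_0 are
    11 + 2 x and its opposite. *)
Lemma root_class : all (fun k => [|| k`_7 == 0, k`_7 == 1, k`_7 == -1, k == hroot |
  (k`_7 == -2) && (val0 k == -11)]) rootl.
Proof. by rewrite /rootl posl.unlock; vm_compute. Qed.

Lemma normal_split5 : int_comb vB
  [:: (1, v5a); (1, v5b); (2, simp 1); (2, simp 4); (4, simp 5)].
Proof. by vm_compute. Qed.

Lemma normal_split6 : int_comb vB [:: (1, v6); (1, simp 1); (1, simp 2); (2, simp 5)].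
Proof. by vm_compute. Qed.

Lemma normal_dotC : all (fun i => dotC i vB ==
  dotC i hroot - (dotC i (simp 6) + dotC i (simp 7)) * 2) (iota 0 8).
Proof. by vm_compute. Qed.

Lemma normalE : normal_vec = vec vB.
Proof.
have hE : highest_root = vec hroot.
  rewrite vec_sum /highest_root; apply: eq_bigr => j _.
  rewrite pmulrn /hroot; congr (_ *~ _).
  by case: j => [[|[|[|[|[|[|[|[|//]]]]]]]] jj].
have s6 : simple_root (inord 6) = vec (simp 6) by rewrite -[in RHS](@inordK 7 6)// vec_simp.
have s7 : simple_root (inord 7) = vec (simp 7) by rewrite -[in RHS](@inordK 7 7)// vec_simp.
rewrite /normal_vec hE s6 s7; apply/matrixP => i z; rewrite ord1 {z}.
have E (a b c : 'cV[int]_8) : (a - (b + c) *+ 2) i 0 = a i 0 - (b i 0 + c i 0) * 2.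
  by rewrite mulr2n !mxE; ring.
rewrite E !vecE; have /eqP -> // := all8P normal_dotC i.
Qed.

Section Segment.
Variable R : realType.
Local Notation C := (cplx R).
Local Notation VC := ('cV[cplx R]_8).
Variable rho : C -> C.
Hypothesis rho_entire : forall s : C, differentiable rho s.
Hypothesis rho_sym : forall s : C, rho s = rho (1 - s).
Hypothesis rho_zeroes : forall s : C, rho s = 0 -> 0 < complex.Re s < 1.
Variable rad : R.
Hypothesis rad_gt0 : 0 < rad.

Lemma intC (m : int) : (m%:~R : C) = ((m%:~R : R)%:C)%C.
Proof. by rewrite rmorph_int. Qed.

Lemma ReDi (z : C) (m : int) : complex.Re (z + m%:~R) = complex.Re z + m%:~R.
Proof. by rewrite ReD intC. Qed.

Lemma ReMi (z : C) (m : int) : complex.Re (z * m%:~R) = complex.Re z * m%:~R.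
Proof. by rewrite intC ReM /= mulr0 subr0. Qed.

Lemma Re_ev_lam k (x : C) :
  complex.Re (ev k (lam x)) = (val0 k)%:~R + complex.Re x * (k`_7)%:~R.
Proof. by rewrite ev_lam ev_lam0 addrC ReDi ReMi addrC. Qed.

Lemma mem_level K k : (k \in level K) = [&& k`_7 == 1, val0 k == K & k \in rootl].
Proof. by rewrite mem_filter andbA. Qed.

Lemma level_unique (a : R) (K K' : int) :
  - K%:~R < a < 1 - K%:~R -> - K'%:~R < a < 1 - K'%:~R -> K = K'.
Proof.
move=> /andP[a1 a2] /andP[a3 a4].
have h1 : K%:~R < (1 + K')%:~R :> R by rewrite rmorphD; lra.
have h2 : K'%:~R < (1 + K)%:~R :> R by rewrite rmorphD; lra.
by move: h1 h2; rewrite !ltr_int; clear; lia.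
Qed.

(** The real part of the value lies in the open interval (0, 1), and is an integer plus k_8 Re x.
    The lowest root, with value - 11 - 2 x, is excluded by Re x >= - 11 / 2. *)
Lemma zero_level k (x : C) : k \in rootl -> rho (ev k (lam x)) = 0 ->
  - (11 / 2) <= complex.Re x <= - 4 ->
  exists K : int, [/\ K \in [:: 5; 6], - K%:~R < complex.Re x < 1 - K%:~R &
    k \in qsA K ++ qsB K].
Proof.
move=> kr /rho_zeroes; rewrite Re_ev_lam; set a := complex.Re x => h /andP[a1 a2].
have := allP root_class _ kr; move: h; set m := val0 k.
have mem56 (K : int) : (4%:~R : R) < K%:~R -> (K%:~R : R) < 7%:~R -> K \in [:: 5; 6].
  by rewrite !ltr_int; case: K => // -[|[|[|[|[|[|[|//]]]]]]].
move=> /andP[h1 h2] /or4P[/eqP k7|/eqP k7|/eqP k7|/orP[/eqP ek|/andP[/eqP k7 /eqP k0]]].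
- move: h1 h2; rewrite k7 mulr0 addr0 ltr0z (_ : (1 : R) = 1%:~R)// ltr_int.
  by case: m => // -[].
- move: h1 h2; rewrite k7 mulr1 => h1 h2; exists m; split.
  + by apply: mem56; rewrite ?pmulrn; lra.
  + by apply/andP; split; lra.
  + by rewrite mem_cat mem_rcons inE mem_level k7 kr !eqxx !orbT.
- move: h1 h2; rewrite k7 mulrN1 => h1 h2; exists (1 - m).
  have e : (1 - m)%:~R = 1 - m%:~R :> R by rewrite rmorphB.
  split.
  + by apply: mem56; rewrite e ?pmulrn; lra.
  + by rewrite e; apply/andP; split; lra.
  + rewrite mem_cat -[X in X \in qsA _]oppkK map_f//.
    rewrite mem_level oppk_rootl kr nth_oppk k7 opprK eqxx /=.
    rewrite /val0 !nth_oppk -/m.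
    rewrite andbT /m /val0; apply/eqP; ring.
- exists 6; move: h1 h2; rewrite /m ek /val0 /= => h1 h2; split=> //.
    by apply/andP; split; lra.
  by rewrite mem_cat mem_rcons inE eqxx orbT.
- by exfalso; move: h1 h2; rewrite k7 k0 => h1 h2; lra.
Qed.

(** d is an isometry. *)
Lemma tube_segment (x : C) : (forall v : 'cV[R]_8, sigma_L v -> enorm v < rad) ->
  - (11 / 2) <= complex.Re x <= - 4 -> tube rad (lam x).
Proof.
move=> Hs hx; rewrite /tube /=.
have e : Re_vec (lam x : VC) = lam (complex.Re x).
  apply/matrixP => i j; rewrite ord1 {j} !mxE.
  by case: i => [[|[|[|[|[|[|[|[|//]]]]]]]] ii].
have := Hs (act d_mx (lam (complex.Re x))); rewrite e /enorm dmxE bform_word; apply.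
by exists (complex.Re x); rewrite -?dmxE.
Qed.

Variables phi psi : VC -> C.
Hypothesis dphi : forall z, tube rad z -> differentiable phi z.
Hypothesis dpsi : forall z, tube rad z -> differentiable psi z.
Variables A B : VC -> C.
Hypothesis dA : forall z, tube rad z -> differentiable A z.
Hypothesis dB : forall z, tube rad z -> differentiable B z.
Hypothesis HA : forall z, tube rad z -> asum Jall posl (PsiA rho phi) z = pl posl z * A z.
Hypothesis HB : forall z, tube rad z -> asum J7 posl7 (PsiB rho psi) z = pl posl7 z * B z.
Local Notation F := (fun z => Sigma_W rho phi z * Sigma_W'd rho psi z).
Local Notation f := (normal_deriv (regular_locus rho rad) F).

Lemma lat_simp (j : 'I_8) : lat R (simp j) = of_int_mx C (simple_root j).
Proof. by rewrite /lat vec_simp. Qed.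

Section Point.
Variable x0 : C.
Hypothesis tx0 : tube rad (lam x0).
Variables (K : int).
Hypothesis hK : - K%:~R < complex.Re x0 < 1 - K%:~R.

(** So the roots with k_8 = 1 or -1 do not vanish at x0. *)
Lemma nonint (m : int) : x0 + m%:~R != 0.
Proof.
apply/eqP => /(congr1 (@complex.Re R)); rewrite ReDi /= => e.
have h1 : (- K)%:~R < (- m)%:~R :> R by rewrite !rmorphN /=; move: hK => /andP[]; lra.
have h2 : (- m)%:~R < (1 - K)%:~R :> R by rewrite rmorphB rmorphN /=; move: hK => /andP[]; lra.
by move: h1 h2; rewrite !ltr_int => h1 h2; lia.
Qed.

End Point.

Lemma div_simple x0 K (j : nat) : tube rad (lam x0) -> K \in [:: 5; 6] ->
  j \in [:: 1; 2; 4; 5]%N -> div_deriv A (rho_prod rho (qsA K)) x0 (lat R (simp j)).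
Proof.
move=> tx hK hj; have j8 : (j < 8)%N by move: hj; rewrite !inE => /or4P[]/eqP->.
have /and4P[_ _ _ /allP hp] := allP qs_check _ hK.
have := @div_deriv_mirror R rho rho_entire rad rad_gt0 phi A dA HA (qsA K) (Ordinal j8) x0 tx.
rewrite -lat_simp; apply; last exact: hp hj.
  by rewrite mxE /=; move: hj {j8}; rewrite !inE => /or4P[]/eqP->.
by move: hj; rewrite -val_eqE /= !inE => /or4P[]/eqP->.
Qed.

(** If [rho_all] vanishes at the point then Re x0 lies in one of the two open intervals, and all
    the vanishing factors belong to q_A or q_B. *)
Lemma holo_segment x0 : tube rad (lam x0) ->
  - (11 / 2) <= complex.Re x0 <= - 4 -> holomorphic_at (f (of_int_mx C normal_vec)) x0.
Proof.
move=> tx0 hx; rewrite normalE -/(lat R vB).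
have [/eqP h|rx] := boolP (rho_all rho (lam x0) == 0); last first.
  exact: (holo_regular rho_entire rad_gt0 dA dB HA HB _ tx0 rx).
have [k kr kz] : exists2 k, k \in rootl & rho (ev k (lam x0)) = 0.
  move/eqP: h; rewrite prodf_seq_eq0 => /hasP[k kr /= /eqP h]; by exists k.
have [K [K56 hK _]] := zero_level kr kz hx.
have /and4P[uq sub /allP q7 _] := allP qs_check _ K56.
have Hrest k' : k' \in rootl -> k' \notin qsA K ++ qsB K -> rho (ev k' (lam x0)) != 0.
  move=> kr' kn; apply: contraNneq kn => /(zero_level kr')/(_ hx)[K' [_ hK' kin]].
  by rewrite (level_unique hK hK').
have xi := nonint hK.
suff [vA [dA' [vB' dB']]] : div_value A (rho_prod rho (qsA K)) x0 /\
    (div_deriv A (rho_prod rho (qsA K)) x0 (lat R vB) /\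
    (div_value (fun z => B (act d_mx z)) (rho_prod rho (qsB K)) x0 /\
     div_deriv (fun z => B (act d_mx z)) (rho_prod rho (qsB K)) x0 (lat R vB))).
  exact: (holo_assemble rho_entire rho_zeroes rad_gt0 dA dB HA HB tx0 uq sub q7 Hrest vA dA' vB' dB').
have LA b := @local_A R rho rho_entire rho_sym rho_zeroes rad rad_gt0 phi dphi A dA HA x0 xi tx0 b.
have LB b := @local_B R rho rho_entire rho_sym rho_zeroes rad rad_gt0 psi dpsi B dB HB x0 xi tx0 b.
have DS j := @div_simple x0 K j tx0 K56.
move: K56; rewrite !inE => /orP[] /eqP eK; rewrite {}eK in hK uq sub q7 Hrest DS *.
  have hb : true -> 11 + x0 * 2 != 0.
    move=> _; rewrite (_ : 11 + x0 * 2 = x0 * 2%:~R + 11%:~R); last by rewrite addrC.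
    apply/eqP => /(congr1 (@complex.Re R)); rewrite ReDi ReMi /= => e.
    by move: hK => /andP[]; lra.
  have [a0 a1] := LA true hb _ _ _ _ dataA5a.
  have [_ a2] := LA true hb _ _ _ _ dataA5b.
  have [b0 b1] := LB true hb _ _ _ _ dataB5.
  split; first exact: a0; split; last by split; [exact: b0|exact: b1].
  apply: (div_deriv_comb normal_split5) => p; rewrite !inE.
  case/predU1P=> [->//|]; case/predU1P=> [->//|].
  by case/predU1P=> [->|/predU1P[->|/eqP->]]; exact: DS.
have hb : false -> 11 + x0 * 2 != 0 by [].
have [a0 a1] := LA false hb _ _ _ _ dataA6.
have [b0 b1] := LB false hb _ _ _ _ dataB6.
split; first exact: a0; split; last by split; [exact: b0|exact: b1].
apply: (div_deriv_comb normal_split6) => p; rewrite !inE.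
case/predU1P=> [->//|]; case/predU1P=> [->|/predU1P[->|/eqP->]]; exact: DS.
Qed.

End Segment.

Theorem theorem9p13 (R : realType) (rho : cplx R -> cplx R)
    (rho_entire : forall s : cplx R, differentiable rho s)
    (rho_sym : forall s : cplx R, rho s = rho (1 - s))
    (rho_zeroes : forall s : cplx R, rho s = 0 -> 0 < complex.Re s < 1)
    (rad : R) (rad_gt0 : 0 < rad)
    (sigma_L_ball : forall v : 'cV[R]_8, sigma_L v -> enorm v < rad)
    (phi psi : 'cV[cplx R]_8 -> cplx R)
    (phi_PW : paley_wiener rad phi) (psi_PW : paley_wiener rad psi) :
  let f : cplx R -> cplx R -> Prop :=
    normal_deriv (regular_locus rho rad)
      (fun z => Sigma_W rho phi z * Sigma_W'd rho psi z)
      (of_int_mx (cplx R) normal_vec) in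
  (forall x : cplx R, tube rad (lam x) -> meromorphic_at f x) /\
  (forall x : cplx R, - (11 / 2) <= complex.Re x <= - 4 ->
     holomorphic_at f x).
Proof.
have [dphi _] := phi_PW; have [dpsi _] := psi_PW.
have [A dA HA] := calA_ex rho_entire rad_gt0 dphi.
have [B dB HB] := calB_ex rho_entire rad_gt0 dpsi.
move=> f; split=> x hx.
  exact: (meromorphic_normal rho_entire rho_zeroes rad_gt0 dA dB HA HB _ hx).
exact: (holo_segment rho_entire rho_sym rho_zeroes rad_gt0 dphi dpsi dA dB HA HB
  (tube_segment sigma_L_ball hx) hx).
Qed.
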